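(* Let $0<\alpha<2$ and $d\ge1$ an integer with $\alpha<d$. For $0\le\delta\le d-\alpha$ let $\mu^\delta(dx)=\kappa(\delta)|x|^{-\alpha}dx$ on $\mathbb{R}^d$, where $$\kappa(\delta)=\frac{2^\alpha\,\Gamma\big(\frac{\delta+\alpha}{2}\big)\Gamma\big(\frac{d-\delta}{2}\big)}{\Gamma\big(\frac\delta2\big)\Gamma\big(\frac{d-\delta-\alpha}{2}\big)}$$ (with $1/\Gamma(0)=0$). If $\delta\ne(d-\alpha)/2$, then the Schrödinger form $(\mathcal{E}^{\mu^\delta},\mathcal{D}(\mathcal{E}^{\mu^\delta}))$ is subcritical, and the Dirichlet form $(\mathcal{E}^{\mu^\delta,h},\mathcal{D}(\mathcal{E}^{\mu^\delta,h}))$ is transient for every $h\in\mathcal{H}^+(\mu^\delta)$.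
   Context: $(\mathcal{E}^{(\alpha)},\mathcal{D}(\mathcal{E}^{(\alpha)}))$ is the Dirichlet form of the symmetric $\alpha$-stable process on $L^2(\mathbb{R}^d)$: $$\mathcal{E}^{(\alpha)}(u)=\frac12\mathcal{A}(d,\alpha)\iint_{x\ne y}\frac{(u(x)-u(y))^2}{|x-y|^{d+\alpha}}\,dx\,dy,\qquad \mathcal{A}(d,\alpha)=\frac{\alpha2^{d-1}\Gamma(\frac{\alpha+d}{2})}{\pi^{d/2}\Gamma(1-\frac\alpha2)},$$ with $\mathcal{D}(\mathcal{E}^{(\alpha)})$ the set of $u\in L^2(\mathbb{R}^d)$ with finite double integral. $\mathcal{E}^{\mu^\delta}(u)=\mathcal{E}^{(\alpha)}(u)-\int u^2\,d\mu^\delta$ on $\mathcal{D}(\mathcal{E}^{(\alpha)})\cap C_0(\mathbb{R}^d)$ is positive semi-definite and closable in $L^2(\mathbb{R}^d)$; $(\mathcal{E}^{\mu^\delta},\mathcal{D}(\mathcal{E}^{\mu^\delta}))$ is its closure. The extended Schrödinger space $\mathcal{D}_e(\mathcal{E}^{\mu^\delta})$ is the set of measurable $u$, $|u|<\infty$ a.e., for which there is an $\mathcal{E}^{\mu^\delta}$-Cauchy sequence $u_n\in\mathcal{D}(\mathcal{E}^{\mu^\delta})$ with $u_n\to u$ a.e.; $\mathcal{E}^{\mu^\delta}(u)=\lim_n\mathcal{E}^{\mu^\delta}(u_n)$. Subcritical: there is a bounded $g\in L^1(\mathbb{R}^d)$, $g>0$ a.e., with $\int|u|g\,dx\le\sqrt{\mathcal{E}^{\mu^\delta}(u)}$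 for all $u\in\mathcal{D}_e(\mathcal{E}^{\mu^\delta})$. $T^{\mu^\delta}_t$ is the $L^2(\mathbb{R}^d)$-semigroup of $(\mathcal{E}^{\mu^\delta},\mathcal{D}(\mathcal{E}^{\mu^\delta}))$, positivity preserving and extended to non-negative measurable functions. $\mathcal{H}^+(\mu^\delta)=\{h:0<h<\infty\text{ a.e.},\ T^{\mu^\delta}_th\le h\text{ a.e. for all }t>0\}$. For $h\in\mathcal{H}^+(\mu^\delta)$, $\mathcal{E}^{\mu^\delta,h}(u,v)=\mathcal{E}^{\mu^\delta}(hu,hv)$ on $\mathcal{D}(\mathcal{E}^{\mu^\delta,h})=\{u\in L^2(\mathbb{R}^d;h^2dx):hu\in\mathcal{D}(\mathcal{E}^{\mu^\delta})\}$, a Dirichlet form on $L^2(\mathbb{R}^d;h^2dx)$. A Dirichlet form $(\mathcal{A},\mathcal{D}(\mathcal{A}))$ on $L^2(E;n)$ is transient if there is a bounded $g\in L^1(E;n)$, $g>0$ a.e., with $\int|u|g\,dn\le\sqrt{\mathcal{A}(u)}$ for $u\in\mathcal{D}(\mathcal{A})$. *)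

(* Defs.v *)
From HB Require Import structures.
From mathcomp Require Import all_boot all_order all_algebra.
From mathcomp Require Import all_classical all_reals all_analysis.
From mathcomp Require Import measurable_realfun.

Set Implicit Arguments.
Unset Strict Implicit.
Unset Printing Implicit Defensive.
Import Order.TTheory GRing.Theory Num.Theory.
Import numFieldNormedType.Exports.

Local Open Scope classical_set_scope.
Local Open Scope ring_scope.

Lemma sigma_finite_prod d1 d2 (T1 : measurableType d1) (T2 : measurableType d2)
    (R : realType) (m1 : {sigma_finite_measure set T1 -> \bar R})
    (m2 : {sigma_finite_measure set T2 -> \bar R}) :
  sigma_finite setT (m1 \x m2)%E.
Proof.
have /sigma_finiteP[F [TF ndF Foo]] := sigma_finiteT m1.
have /sigma_finiteP[G [TG ndG Goo]] := sigma_finiteT m2.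
exists (fun n => F n `*` G n).
  rewrite -setXTT TF TG; apply/seteqP; split => -[x y].
    move=> [/= [n _ Fnx] [k _ Gky]]; exists (maxn n k) => //; split.
    - by move: x Fnx; exact/subsetPset/ndF/leq_maxl.
    - by move: y Gky; exact/subsetPset/ndG/leq_maxr.
  by move=> [n _ []/= ? ?]; split; exists n.
move=> k; have [? ?] := Foo k; have [? ?] := Goo k.
split; first exact: measurableX.
by rewrite product_measure1E// lte_mul_pinfty// ge0_fin_numE.
Qed.

(* R^d is d.-tuple R with its product sigma-algebra, i.e. the Borel one.
   Functions are therefore Borel measurable; each a.e. class of Lebesgue
   measurable functions has such a representative. *)
Section tuple_cons.
Context {R : realType} {n : nat}.

Definition tcons (p : R * n.-tuple R) : n.+1.-tuple R := [tuple of p.1 :: p.2].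
Definition tuncons (t : n.+1.-tuple R) : R * n.-tuple R :=
  (thead t, [tuple of behead t]).

Lemma tconsK : cancel tcons tuncons.
Proof. by case=> x t; congr pair => //=; exact: val_inj. Qed.

Lemma tunconsK : cancel tuncons tcons.
Proof. by move=> t; rewrite /tcons /tuncons /= -tuple_eta. Qed.

Lemma measurable_tcons : measurable_fun [set: R * n.-tuple R] tcons.
Proof. exact: measurable_cons. Qed.

Lemma measurable_tuncons : measurable_fun [set: n.+1.-tuple R] tuncons.
Proof.
apply/measurable_fun_pairP; split; last exact: measurable_behead.
exact: measurable_tnth.
Qed.

Variable mu : {sigma_finite_measure set (n.-tuple R) -> \bar R}.

Definition leb_succ : set (n.+1.-tuple R) -> \bar R :=
  pushforward (@lebesgue_measure R \x mu)%E tcons.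

Let leb_succ0 : leb_succ set0 = 0%E.
Proof. by rewrite /leb_succ /pushforward preimage_set0 measure0. Qed.

Let leb_succ_ge0 A : (0 <= leb_succ A)%E.
Proof. exact: (measure_ge0 (@lebesgue_measure R \x mu)%E). Qed.

Let leb_succ_sigma_additive : semi_sigma_additive leb_succ.
Proof.
move=> F mF tF mUF; rewrite /leb_succ /pushforward preimage_bigcup.
apply: (@measure_semi_sigma_additive _ _ _ (@lebesgue_measure R \x mu)%E).
- by move=> n'; rewrite -[X in measurable X]setTI; exact: measurable_tcons.
- apply/trivIsetP => /= i j _ _ ij; rewrite -preimage_setI.
  by move/trivIsetP : tF => /(_ _ _ _ _ ij) ->//; rewrite preimage_set0.
- rewrite -preimage_bigcup -[X in measurable X]setTI.
  exact: measurable_tcons.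
Qed.

HB.instance Definition _ := isMeasure.Build _ _ _ leb_succ
  leb_succ0 leb_succ_ge0 leb_succ_sigma_additive.

Let leb_succ_sigma_finite : sigma_finite setT leb_succ.
Proof.
have [F UF mF] := sigma_finite_prod (@lebesgue_measure R) mu.
exists (fun k => tuncons @^-1` F k).
  apply/seteqP; split=> t // _.
  have : setT (tuncons t) by [].
  by rewrite UF => -[k _ Fk]; exists k.
move=> k; have [mFk Fkoo] := mF k; split.
  by rewrite -[X in measurable X]setTI; exact: measurable_tuncons.
rewrite /leb_succ /pushforward -comp_preimage.
by rewrite (_ : tuncons \o tcons = id) //; apply/funext => p; exact: tconsK.
Qed.

HB.instance Definition _ := Measure_isSigmaFinite.Build _ _ _ leb_succ
  leb_succ_sigma_finite.

End tuple_cons.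

Fixpoint leb (R : realType) (d : nat) :
    {sigma_finite_measure set (d.-tuple R) -> \bar R} :=
  match d with
  | 0 => dirac [tuple]
  | d'.+1 => leb_succ (leb R d')
  end.

Lemma leb_box (R : realType) (d : nat) (A : 'I_d -> set R) :
  (forall i, measurable (A i)) ->
  leb R d [set x | forall i, A i (tnth x i)] =
  (\prod_(i < d) lebesgue_measure (A i))%E.
Proof.
elim: d A => [|d IH] A mA.
  by rewrite big_ord0 /= diracE mem_set // => -[].
rewrite big_ord_recl -(IH (fun i => A (lift ord0 i))) //= /leb_succ /pushforward.
set B := [set x : d.-tuple R | _].
have mB : measurable B.
  rewrite (_ : B =
    \bigcap_i (fun x : d.-tuple R => tnth x i) @^-1` A (lift ord0 i)).
    apply: fin_bigcap_measurable => // i _.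
    by rewrite -[X in measurable X]setTI; exact: measurable_tnth.
  by apply/seteqP; split=> [x Ax i _|x Ax i]; [exact: Ax|exact: (Ax i Logic.I)].
rewrite -product_measure1E //; last exact: (mA ord0).
congr (_ _); apply/seteqP; split=> [[x t] /= H|[x t] /= [H1 H2] i].
  split; first exact: (H ord0).
  by move=> i; have := H (lift ord0 i); rewrite tnthS.
by case: (unliftP ord0 i) => [j ->|->] //; rewrite tnthS; exact: H2.
Qed.

Section density.
Context d (T : measurableType d) (R : realType).
Variables (mu : {measure set T -> \bar R}) (f : T -> \bar R).
Hypotheses (mf : measurable_fun setT f) (f0 : forall x, (0 <= f x)%E).

(* The (unused) hypotheses are arguments so that the measure structure below
   can be inferred. *)
Definition density (mf : measurable_fun setT f) (f0 : forall x, (0 <= f x)%E) :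
  set T -> \bar R := fun A => (\int[mu]_(x in A) f x)%E.

Let density0 : density mf f0 set0 = 0%E.
Proof. by rewrite /density integral_set0. Qed.

Let density_ge0 A : (0 <= density mf f0 A)%E.
Proof. by rewrite /density integral_ge0. Qed.

Let density_sigma_additive : semi_sigma_additive (density mf f0).
Proof.
move=> /= A mA tA mUA; rewrite /density ge0_integral_bigcup//=; last first.
  exact: measurable_funTS.
by apply: is_cvg_ereal_nneg_natsum_cond => n _ _; exact: integral_ge0.
Qed.

HB.instance Definition _ := isMeasure.Build _ _ _ (density mf f0)
  density0 density_ge0 density_sigma_additive.

End density.

Section constants.
Context {R : realType}.

Definition Gamma (s : R) : R :=
  \int[lebesgue_measure]_(t in `]0, +oo[) (t `^ (s - 1) * expR (- t)).

(* 1 / Gamma, used at arguments s >= 0; the integral diverges at s = 0. *)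
Definition rGamma (s : R) : R := if s == 0 then 0 else (Gamma s)^-1.

(* A(d, alpha). The factor 2^(d-1) is the source's; the generator with symbol
   -|xi|^alpha corresponds to 2^(alpha-1) instead. *)
Definition stable_const (d : nat) (alpha : R) : R :=
  alpha * 2 ^+ d.-1 * Gamma ((alpha + d%:R) / 2) /
  (pi `^ (d%:R / 2) * Gamma (1 - alpha / 2)).

Definition kappa (d : nat) (alpha delta : R) : R :=
  2 `^ alpha * Gamma ((delta + alpha) / 2) * Gamma ((d%:R - delta) / 2) *
  rGamma (delta / 2) * rGamma ((d%:R - delta - alpha) / 2).

Lemma Gamma_ge0 s : 0 <= Gamma s.
Proof.
by apply: Rintegral_ge0 => t _; rewrite mulr_ge0 ?powR_ge0 ?expR_ge0.
Qed.

Lemma rGamma_ge0 s : 0 <= rGamma s.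
Proof. by rewrite /rGamma; case: ifP => // _; rewrite invr_ge0 Gamma_ge0. Qed.

Lemma kappa_ge0 d alpha delta : 0 <= kappa d alpha delta.
Proof. by rewrite /kappa !mulr_ge0 ?powR_ge0 ?Gamma_ge0 ?rGamma_ge0. Qed.

End constants.

Section euclidean.
Context {R : realType} {d : nat}.

Definition eucl_dist (x y : d.-tuple R) : R :=
  Num.sqrt (\sum_(i < d) (tnth x i - tnth y i) ^+ 2).

Definition eucl_norm (x : d.-tuple R) : R := Num.sqrt (\sum_(i < d) tnth x i ^+ 2).

(* [d.-tuple R] carries no topology in the library: continuity and compactness
   are read on ['rV[R]_d] through this bijection. *)
Definition tuple_of_row (v : 'rV[R]_d) : d.-tuple R := [tuple v ord0 i | i < d].

(* C_0(R^d): continuous functions with compact support. *)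
Definition C0 : set (d.-tuple R -> R) :=
  [set u : d.-tuple R -> R | continuous (u \o tuple_of_row) /\
           compact (closure [set v : 'rV[R]_d | u (tuple_of_row v) != 0])].

Lemma measurable_eucl_norm : measurable_fun [set: d.-tuple R] eucl_norm.
Proof.
apply: (@measurableT_comp _ _ _ _ _ _ (@Num.sqrt R)).
  by apply: continuous_measurable_fun; exact: sqrt_continuous.
apply: measurable_sum => i; apply: measurable_funX; exact: measurable_tnth.
Qed.

(* mu^delta = kappa(delta) |x|^-alpha dx; the value of the density at the
   origin is irrelevant. *)
Definition mudelta_dens (alpha delta : R) (x : d.-tuple R) : \bar R :=
  (kappa d alpha delta * eucl_norm x `^ (- alpha))%:E.

Lemma measurable_mudelta_dens alpha delta :
  measurable_fun setT (mudelta_dens alpha delta).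
Proof.
apply/measurable_EFinP; apply: measurable_funM => //.
apply: (@measurableT_comp _ _ _ _ _ _ (fun r : R => r `^ (- alpha))).
  exact: measurable_powR.
exact: measurable_eucl_norm.
Qed.

Lemma mudelta_dens_ge0 alpha delta x : (0 <= mudelta_dens alpha delta x)%E.
Proof. by rewrite lee_fin mulr_ge0 ?kappa_ge0 ?powR_ge0. Qed.

Definition mudelta (alpha delta : R) : {measure set (d.-tuple R) -> \bar R} :=
  density (leb R d) (measurable_mudelta_dens alpha delta)
    (mudelta_dens_ge0 alpha delta).

End euclidean.

(* A symmetric form, given by its domain and its diagonal u |-> E(u, u), which
   determines E(u, v) by polarization. Elements of L^2 are represented by
   measurable functions. *)
Record qform (T : Type) (R : realType) := QForm {
  qdom : set (T -> R);
  qval : (T -> R) -> R }.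

Section forms.
Context d (T : measurableType d) (R : realType).
Implicit Types (mu : {measure set T -> \bar R}) (E : qform T R).

Definition L2 mu : set (T -> R) := [set u | u \in Lfun mu 2%:E].

Definition L2norm mu (u : T -> R) : \bar R := 'N[mu]_2%:E[EFin \o u]%E.

Definition L2cvg mu (u_ : nat -> T -> R) (u : T -> R) :=
  L2norm mu (u_ n \- u) @[n --> \oo] --> 0%E.

Definition form_cauchy E (u_ : nat -> T -> R) :=
  (fun nm : nat * nat => qval E (u_ nm.1 \- u_ nm.2)) @ (\oo, \oo) --> (0 : R).

Definition closure_approx mu E (u_ : nat -> T -> R) (u : T -> R) :=
  [/\ forall n, qdom E (u_ n), form_cauchy E u_ & L2cvg mu u_ u].

(* The closure in L^2(T; mu) of a closable form; for such a form the limit in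
   the second component does not depend on the approximating sequence. *)
Definition closure_form mu E : qform T R :=
  QForm [set u | L2 mu u /\ exists u_, closure_approx mu E u_ u]
        (fun u => get [set a | exists2 u_, closure_approx mu E u_ u &
                                 qval E (u_ n) @[n --> \oo] --> a]).

Definition ext_approx mu E (u_ : nat -> T -> R) (u : T -> \bar R) :=
  [/\ forall n, qdom E (u_ n), form_cauchy E u_ &
      {ae mu, forall x, (u_ n x)%:E @[n --> \oo] --> u x}].

Definition ext_dom mu E : set (T -> \bar R) :=
  [set u | [/\ measurable_fun setT u, {ae mu, forall x, `|u x| < +oo}%E &
               exists u_, ext_approx mu E u_ u]].

Definition ext_val mu E (u : T -> \bar R) : R :=
  get [set a | exists2 u_, ext_approx mu E u_ u &
                 qval E (u_ n) @[n --> \oo] --> a].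

Definition reference mu (g : T -> R) :=
  [/\ measurable_fun setT g, exists M, forall x, `|g x| <= M,
      mu.-integrable setT (EFin \o g) & {ae mu, forall x, 0 < g x}].

Definition subcritical mu E :=
  exists2 g, reference mu g & forall u, ext_dom mu E u ->
    (\int[mu]_x (`|u x| * (g x)%:E) <= (Num.sqrt (ext_val mu E u))%:E)%E.

Definition transient mu E :=
  exists2 g, reference mu g & forall u, qdom E u ->
    (\int[mu]_x (`|u x| * g x)%:E <= (Num.sqrt (qval E u))%:E)%E.

Definition inner mu (u v : T -> R) : R := \int[mu]_x (u x * v x).

(* S is the strongly continuous contraction semigroup of symmetric operators on
   L^2(T; mu) of the closed form E: its approximating forms
   (u - S_t u, u) / t converge, as t decreases to 0, exactly on the domain of
   E, and the limit is E(u). *)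
Record semigroup_of mu E (S : R -> (T -> R) -> T -> R) : Prop := {
  sg_L2 : forall t f, 0 < t -> L2 mu f -> L2 mu (S t f);
  sg_linear : forall t a f g, 0 < t -> L2 mu f -> L2 mu g ->
    {ae mu, forall x, S t (fun y => a * f y + g y) x = a * S t f x + S t g x};
  sg_symmetric : forall t f g, 0 < t -> L2 mu f -> L2 mu g ->
    inner mu (S t f) g = inner mu f (S t g);
  sg_contraction : forall t f, 0 < t -> L2 mu f ->
    (L2norm mu (S t f) <= L2norm mu f)%E;
  sg_mul : forall s t f, 0 < s -> 0 < t -> L2 mu f ->
    {ae mu, forall x, S (s + t) f x = S s (S t f) x};
  sg_continuous : forall f, L2 mu f ->
    L2norm mu (S t f \- f) @[t --> 0^'+] --> 0%E;
  sg_dom : forall u, qdom E u <-> L2 mu u /\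
    exists a : R, inner mu (u \- S t u) u / t @[t --> 0^'+] --> a;
  sg_val : forall u, qdom E u ->
    inner mu (u \- S t u) u / t @[t --> 0^'+] --> qval E u }.

End forms.

Section schroedinger.
Context {R : realType} {d : nat}.
Implicit Types (alpha : R) (mu : {measure set (d.-tuple R) -> \bar R}).

Definition stable_energy alpha (u : d.-tuple R -> R) : \bar R :=
  (\int[leb R d \x leb R d]_(z in [set z | z.1 != z.2])
    ((u z.1 - u z.2) ^+ 2 / eucl_dist z.1 z.2 `^ (d%:R + alpha))%:E)%E.

Definition stable_form alpha : qform (d.-tuple R) R :=
  QForm [set u | L2 (leb R d) u /\ (stable_energy alpha u < +oo)%E]
        (fun u => 2^-1 * stable_const d alpha * fine (stable_energy alpha u)).

Definition pre_schroedinger alpha mu : qform (d.-tuple R) R :=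
  QForm (qdom (stable_form alpha) `&` C0)
        (fun u => qval (stable_form alpha) u - \int[mu]_x (u x ^+ 2)).

Definition schroedinger alpha mu : qform (d.-tuple R) R :=
  closure_form (leb R d) (pre_schroedinger alpha mu).

(* Truncations h_n = (h /\ n) 1_{|x| <= n} in L^2 increasing to h. *)
Definition trunc (h : d.-tuple R -> \bar R) (n : nat) (x : d.-tuple R) : R :=
  fine (mine (h x) n%:R%:E) * \1_[set y | eucl_norm y <= n%:R] x.

(* Extension of a positivity preserving semigroup to non-negative functions. *)
Definition sg_ext (S : R -> (d.-tuple R -> R) -> d.-tuple R -> R)
    (t : R) (h : d.-tuple R -> \bar R) (x : d.-tuple R) : \bar R :=
  limn (fun n => (S t (trunc h n) x)%:E).

Definition excessive (S : R -> (d.-tuple R -> R) -> d.-tuple R -> R) :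
    set {mfun d.-tuple R >-> \bar R} :=
  [set h | {ae leb R d, forall x, (0 < h x < +oo)%E} /\
    forall t, 0 < t -> {ae leb R d, forall x, (sg_ext S t h x <= h x)%E}].

Lemma measurable_sq (h : {mfun d.-tuple R >-> \bar R}) :
  measurable_fun setT (fun x => h x * h x)%E.
Proof. by apply: emeasurable_funM. Qed.

Lemma sq_ge0 (h : {mfun d.-tuple R >-> \bar R}) x : (0 <= h x * h x)%E.
Proof. by case: (h x) => [r| |]; rewrite ?lee_fin -?expr2 ?sqr_ge0. Qed.

Definition h2dx (h : {mfun d.-tuple R >-> \bar R}) :
    {measure set (d.-tuple R) -> \bar R} :=
  density (leb R d) (measurable_sq h) (sq_ge0 h).

(* h is a.e. finite, so [fine] only alters h on a null set. *)
Definition hmul (h : {mfun d.-tuple R >-> \bar R}) (u : d.-tuple R -> R)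
  (x : d.-tuple R) : R := fine (h x) * u x.

Definition h_transform (E : qform (d.-tuple R) R)
    (h : {mfun d.-tuple R >-> \bar R}) : qform (d.-tuple R) R :=
  QForm [set u | L2 (h2dx h) u /\ qdom E (hmul h u)]
        (fun u => qval E (hmul h u)).

End schroedinger.

(* Main.v *)
Require Import Defs.
From mathcomp Require Import all_boot all_order all_algebra.
From mathcomp Require Import all_classical all_reals all_analysis.
From mathcomp Require Import measurable_realfun ring lra.
Import Order.TTheory GRing.Theory Num.Theory.
Import numFieldNormedType.Exports.
Local Open Scope classical_set_scope.
Local Open Scope ring_scope.

(** With [a = alpha/2] and [a < b < d/2], the function [h = \int s^(b-1) p_s ds]
    ([p_s] the heat kernel) is a multiple of [|x|^(2b-d)], and the stable kernel is
    a multiple of [\int t^(-a-1) p_t dt]. Cutting the latter at [t > eps] makes it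
    integrable, and by the semigroup law and one integration by parts [h] is a
    strict supersolution for the cut kernel. The ground state inequality for [h],
    with [eps -> 0], is the Hardy inequality with constant [kappa (d - 2b)].

    The stable constant carries the factor [2^(d-1)] instead of [2^(alpha-1)], so the
    form dominates [2^(d-alpha) kappa(delta)] times the Hardy potential, and the
    factor [2^(d-alpha) > 1] leaves a positive multiple of the Hardy potential even
    for the critical [delta]. By Cauchy-Schwarz a suitable [g0 > 0] then satisfies
    [\int |u| g0 <= sqrt (E u)]; this bound passes to the closure and to the
    extended space by Fatou's lemma, and to the [h]-transforms by taking
    [g = g0 / (1 + h^2)], since [h g <= g0]. *)

(** * Integration on the line and on products *)

(** The cut at [t > eps] is forced by the ground state argument, which separates the terms of
    [(u x - u y)^2] and so needs a kernel of finite mass, here [eps^(-a) / a]; the stable kernel has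
    infinite mass near the diagonal. As kernel and supersolution are both superpositions of heat
    kernels, applying one to the other becomes a Beta-type integral in time. Its divergent part
    [eps^(-a) / a * s^(b-1)] reproduces the mass times [h] and cancels; the rest tends to a multiple
    of [|x|^(-2a) h]. The Gamma quotients in [kappa] are a Beta integral and two Riesz constants.

    Hardy's inequality is applied at two parameters: at [delta], where it leaves the share
    [1 - 2^(alpha-d)] of the stable energy, and at the midpoint [(d-alpha)/2], which turns this
    share into a weighted L2 norm. [kappa(delta)] could not do the latter, since it vanishes at the
    endpoints.

    Forms are given by their diagonal, and values on closures and extended spaces are selected by
    [get]. They are identified through one explicit functional [Q] on the whole stable domain:
    [sqrt Q] satisfies the triangle inequality and is comparable with the root of the stable
    energy. *)

Section lebesgue_affine.
Context {R : realType}.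
Local Notation ell := (@lebesgue_measure R).
Local Open Scope ereal_scope.

Lemma ge0_integral_translate (f : R -> \bar R) (c : R) :
  measurable_fun setT f -> (forall t, 0 <= f t) ->
  \int[ell]_t f (t + c)%R = \int[ell]_t f t.
Proof.
move=> mf f0.
have mphi : measurable_fun setT ((fun t : R => t + c)%R : _ -> measurableTypeR R).
  exact: measurable_funD.
transitivity (\int[pushforward ell ((fun t : R => t + c)%R : _ -> measurableTypeR R)]_t f t).
  by rewrite ge0_integral_pushforward.
apply: eq_measure_integral => A mA _; symmetry.
apply: lebesgue_measure_unique => // _ [[a b]] _ <-.
rewrite /pushforward /=.
transitivity (ell `](a - c)%R, (b - c)%R]%classic); last first.
  congr (ell _); apply/seteqP; split => x /=;
    by rewrite !in_itv/= => /andP[? ?]; apply/andP; lra.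
rewrite !lebesgue_measure_itv/= !lte_fin ltrD2r.
by case: ifP => // _; rewrite -!EFinD; congr EFin; ring.
Qed.

Lemma ge0_integral_dilate (f : R -> \bar R) (c : R) : (0 < c)%R ->
  measurable_fun setT f -> (forall t, 0 <= f t) ->
  c%:E * \int[ell]_t f (c * t)%R = \int[ell]_t f t.
Proof.
move=> c0 mf f0.
have mphi : measurable_fun setT ((fun t : R => c * t)%R : _ -> measurableTypeR R).
  exact: measurable_funM.
have c0' : (0 <= c)%R by exact: ltW.
pose pm := measure_function_pushforward__canonical__measure_function_Measure
  ell mphi.
transitivity (\int[mscale (NngNum c0') pm]_t f t).
  by rewrite ge0_integral_mscale// ge0_integral_pushforward.
apply: eq_measure_integral => A mA _; symmetry.
apply: lebesgue_measure_unique => // _ [[a b]] _ <-.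
rewrite /mscale /pushforward /=.
transitivity (c%:E * ell `](a / c)%R, (b / c)%R]%classic); last first.
  congr (_ * ell _); apply/seteqP; split => x /=;
    by rewrite !in_itv/= ltr_pdivrMr// ler_pdivlMr// mulrC.
rewrite !lebesgue_measure_itv/= !lte_fin ltr_pM2r ?invr_gt0//.
case: ifP => // _; last by rewrite mule0.
rewrite -!EFinD -EFinM; congr EFin.
by rewrite -mulrBl mulrC divfK// gt_eqF.
Qed.

End lebesgue_affine.

Section tonelli.
Context {d1 d2} {T1 : measurableType d1} {T2 : measurableType d2} {R : realType}.
Variables (m1 : {sigma_finite_measure set T1 -> \bar R})
  (m2 : {sigma_finite_measure set T2 -> \bar R}).

Lemma tonelliC (f : T1 -> T2 -> R) :
  measurable_fun setT (fun z : T1 * T2 => f z.1 z.2) ->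
  (forall x y, 0 <= f x y) ->
  (\int[m1]_x \int[m2]_y (f x y)%:E = \int[m2]_y \int[m1]_x (f x y)%:E)%E.
Proof.
move=> mf f0; apply: (fubini_tonelli (fun z => (f z.1 z.2)%:E)).
  exact/measurable_EFinP.
by move=> z; rewrite lee_fin.
Qed.

Lemma measurable_integral_r (f : T1 -> T2 -> R) :
  measurable_fun setT (fun z : T1 * T2 => f z.1 z.2) ->
  (forall x y, 0 <= f x y) ->
  measurable_fun setT (fun x => \int[m2]_y (f x y)%:E)%E.
Proof.
move=> mf f0.
apply: (@measurable_fun_fubini_tonelli_F _ _ _ _ _ m2 (fun z => (f z.1 z.2)%:E)).
  exact/measurable_EFinP.
by move=> z; rewrite lee_fin.
Qed.

Lemma measurable_eintegral_r (f : T1 -> T2 -> \bar R) :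
  measurable_fun setT (fun z : T1 * T2 => f z.1 z.2) ->
  (forall x y, 0 <= f x y)%E ->
  measurable_fun setT (fun x => \int[m2]_y (f x y))%E.
Proof.
move=> mf f0.
exact: (@measurable_fun_fubini_tonelli_F _ _ _ _ _ m2 (fun z => f z.1 z.2)).
Qed.

Lemma integral_prodE (f : T1 -> T2 -> R) :
  measurable_fun setT (fun z : T1 * T2 => f z.1 z.2) ->
  (forall x y, 0 <= f x y) ->
  (\int[m1 \x m2]_z (f z.1 z.2)%:E = \int[m1]_x \int[m2]_y (f x y)%:E)%E.
Proof.
move=> mf f0; rewrite fubini_tonelli1//; first exact/measurable_EFinP.
by move=> z; rewrite lee_fin.
Qed.

Lemma measurable_integral_l (f : T1 -> T2 -> R) :
  measurable_fun setT (fun z : T1 * T2 => f z.1 z.2) ->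
  (forall x y, 0 <= f x y) ->
  measurable_fun setT (fun y => \int[m1]_x (f x y)%:E)%E.
Proof.
move=> mf f0.
apply: (@measurable_fun_fubini_tonelli_G _ _ _ _ _ m1 (fun z => (f z.1 z.2)%:E)).
  exact/measurable_EFinP.
by move=> z; rewrite lee_fin.
Qed.

End tonelli.

Section ftc_open.
Context {R : realType}.
Local Notation ell := (@lebesgue_measure R).

(** Serves integrands such as [t^(p-1)] near 0 or [(s-t)^(b-1)] near [s], which may blow up at an
    endpoint while the primitive has a limit there. The closed-interval theorem is applied on an
    exhaustion, and nonnegativity gives monotone convergence. *)
Lemma ge0_FTC_oo (f F : R -> R) (a b la lb : R) : a < b ->
  (forall x, a < x < b -> 0 <= f x) ->
  (forall x, a < x < b -> {for x, continuous f}) ->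
  (forall x, a < x < b -> is_derive x 1 F (f x)) ->
  F x @[x --> a^'+] --> la -> F x @[x --> b^'-] --> lb ->
  (\int[ell]_(x in `]a, b[) (f x)%:E = (lb - la)%:E)%E.
Proof.
move=> ab f0 cf dF Fa Fb.
(* The 3 keeps [a + e n < b - e n] already for [n = 0]. *)
pose e n : R := (b - a) / n.+3%:R.
have ba0 : 0 < b - a by rewrite subr_gt0.
have e0 n : 0 < e n by rewrite divr_gt0.
have e3 n : e n * 3 <= b - a.
  by rewrite /e mulrAC ler_pdivrMr// ler_pM2l// ler_nat.
have ecvg : e n @[n --> \oo] --> (0 : R).
  rewrite /e -[X in _ --> X](mulr0 (b - a)); apply: cvgM; first exact: cvg_cst.
  have := @cvg_harmonic R.
  rewrite -(cvg_shiftS _)/= -(cvg_shiftS _)/=; exact.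
have edec m n : (m <= n)%N -> e n <= e m.
  by move=> mn; rewrite /e ler_pM2l// lef_pV2 ?posrE// ler_nat.
pose D n : set R := `[a + e n, b - e n]%classic.
have Dab n x : D n x -> a < x < b.
  by rewrite /D/= in_itv/= => /andP[? ?]; have := e0 n; lra.
have UD : \bigcup_n D n = `]a, b[%classic.
  apply/seteqP; split => x /=.
    by move=> [n _ /Dab]; rewrite in_itv.
  rewrite in_itv/= => /andP[ax xb].
  have m0 : 0 < Num.min (x - a) (b - x) by rewrite lt_min !subr_gt0 ax xb.
  have /cvgrPdist_lt/(_ _ m0)[N _ /(_ N (leqnn N))/=] := ecvg.
  rewrite sub0r normrN gtr0_norm// lt_min => /andP[? ?].
  by exists N => //; rewrite /D /= in_itv/=; apply/andP; lra.
have mf : measurable_fun `]a, b[ f.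
  apply: open_continuous_measurable_fun => //.
  by move=> x; rewrite inE/= in_itv/=; exact: cf.
have ndD : nondecreasing_seq D.
  move=> m n mn; apply/subsetPset => x; rewrite /D/= !in_itv/= => /andP[? ?].
  by have := edec _ _ mn => ?; apply/andP; lra.
have subD n : D n `<=` `]a, b[%classic by move=> x /Dab; rewrite /= in_itv.
have : (\int[ell]_(x in D n) (EFin \o f) x @[n --> \oo] -->
    \int[ell]_(x in \bigcup_n D n) (EFin \o f) x)%E.
  apply: ge0_nondecreasing_set_cvg_integral => //.
  - by move=> n; exact: measurable_itv.
  - by move=> n; apply/measurable_EFinP; apply: measurable_funS mf.
  - by move=> n x /Dab; rewrite lee_fin; exact: f0.
rewrite UD => /cvg_unique; apply => //.
have -> : (fun n => \int[ell]_(x in D n) (EFin \o f) x)%E =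
   (fun n => (F (b - e n) - F (a + e n))%:E).
  apply/funext => n; rewrite /D (@continuous_FTC2 _ f F) ?EFinB//.
  - by have := e0 n; have := e3 n; lra.
  - apply: continuous_in_subspaceT => x; rewrite inE => xD.
    by apply: cf; exact: Dab xD.
  - have inn x : a + e n <= x <= b - e n -> a < x < b.
      by move=> h; apply: (Dab n); rewrite /D/= in_itv.
    split.
    + move=> x; rewrite in_itv/= => /andP[h1 h2]; apply: ex_derive; apply: dF.
      by apply: inn; rewrite !ltW.
    + apply: cvg_at_right_filter; apply: differentiable_continuous.
      apply/derivable1_diffP; apply: ex_derive; apply: dF; apply: inn.
      by have := e0 n; have := e3 n; move=> ? ?; apply/andP; lra.
    + apply: cvg_at_left_filter; apply: differentiable_continuous.
      apply/derivable1_diffP; apply: ex_derive; apply: dF; apply: inn.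
      by have := e0 n; have := e3 n; move=> ? ?; apply/andP; lra.
  - move=> x; rewrite in_itv/= => /andP[? ?].
    have := dF x; rewrite derive1E => h; apply: derive_val; apply: h.
    by have := e0 n => ?; apply/andP; lra.
apply: cvg_EFin; first exact: nearW.
apply: cvgB.
  move/cvg_at_leftP : Fb; apply; split; last first.
    rewrite -[X in _ --> X]subr0; apply: cvgB => //; exact: cvg_cst.
  by move=> n; rewrite ltrBlDr ltrDl.
move/cvg_at_rightP : Fa; apply; split; last first.
  rewrite -[X in _ --> X]addr0; apply: cvgD => //; exact: cvg_cst.
by move=> n; rewrite ltrDl.
Qed.

End ftc_open.

Section real_integrands.
Context {d} {T : measurableType d} {R : realType} (mu : {measure set T -> \bar R}).
Implicit Types f g : T -> R.

Lemma ge0_integralZ (k : R) f : 0 <= k -> measurable_fun setT f ->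
  (forall x, 0 <= f x) ->
  (\int[mu]_x (k * f x)%:E = k%:E * \int[mu]_x (f x)%:E)%E.
Proof.
move=> k0 mf f0; under eq_integral do rewrite EFinM.
by rewrite ge0_integralZl_EFin//; [move=> x _; rewrite lee_fin|exact/measurable_EFinP].
Qed.

Lemma ge0_integralDr f g : measurable_fun setT f -> measurable_fun setT g ->
  (forall x, 0 <= f x) -> (forall x, 0 <= g x) ->
  (\int[mu]_x (f x + g x)%:E = \int[mu]_x (f x)%:E + \int[mu]_x (g x)%:E)%E.
Proof.
move=> mf mg f0 g0; under eq_integral do rewrite EFinD.
by rewrite ge0_integralD//; do ?[exact/measurable_EFinP];
  move=> x _; rewrite lee_fin.
Qed.

Lemma le_integral_real f g : measurable_fun setT f -> measurable_fun setT g ->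
  (forall x, 0 <= f x <= g x) ->
  (\int[mu]_x (f x)%:E <= \int[mu]_x (g x)%:E)%E.
Proof.
move=> mf mg fg; apply: ge0_le_integral => //; do ?[exact/measurable_EFinP];
  by move=> x _; rewrite lee_fin; have /andP[h1 h2] := fg x => //; exact: le_trans h2.
Qed.

Lemma integral_real_ge0 f : (forall x, 0 <= f x) -> (0 <= \int[mu]_x (f x)%:E)%E.
Proof. by move=> f0; apply: integral_ge0 => x _; rewrite lee_fin. Qed.

Lemma cvg_integral_nondecreasing (f : nat -> T -> \bar R) (g : T -> \bar R) :
  (forall n, measurable_fun setT (f n)) -> (forall n x, 0 <= f n x)%E ->
  (forall x, nondecreasing_seq (f ^~ x)) ->
  (forall x, f n x @[n --> \oo] --> g x) ->
  nondecreasing_seq (fun n => \int[mu]_x f n x)%E /\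
  (\int[mu]_x f n x)%E @[n --> \oo] --> (\int[mu]_x g x)%E.
Proof.
move=> mf f0 ndf fg; split.
  by move=> m n mn; apply: ge0_le_integral => // x _; exact: ndf.
rewrite (eq_integral (fun x => limn (f ^~ x))).
  by apply: cvg_monotone_convergence => // x _; exact: ndf.
by move=> x _; apply/esym/cvg_lim.
Qed.

End real_integrands.

Section product_integrands.
Context {d1 d2} {T1 : measurableType d1} {T2 : measurableType d2} {R : realType}.
Variables (m1 : {sigma_finite_measure set T1 -> \bar R})
  (m2 : {sigma_finite_measure set T2 -> \bar R}).

Lemma integral_tensor (f : T1 -> R) (g : T2 -> R) :
  measurable_fun setT f -> measurable_fun setT g ->
  (forall x, 0 <= f x) -> (forall y, 0 <= g y) ->
  (\int[m1 \x m2]_z (f z.1 * g z.2)%:E =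
   (\int[m1]_x (f x)%:E) * (\int[m2]_y (g y)%:E))%E.
Proof.
move=> mf mg f0 g0.
rewrite (integral_prodE m1 m2 (fun x y => f x * g y)).
- under eq_integral do rewrite ge0_integralZ//.
  rewrite ge0_integralZr//; first exact/measurable_EFinP.
    by move=> x _; rewrite lee_fin.
  exact: integral_real_ge0.
- by apply: measurable_funM; apply: measurableT_comp.
- by move=> x y; rewrite mulr_ge0.
Qed.

End product_integrands.

Section tonelli3.
Context {d1 d2 d3} {T1 : measurableType d1} {T2 : measurableType d2}
  {T3 : measurableType d3} {R : realType}.
Variables (m1 : {sigma_finite_measure set T1 -> \bar R})
  (m2 : {sigma_finite_measure set T2 -> \bar R})
  (m3 : {sigma_finite_measure set T3 -> \bar R}).
Variable f : T1 -> T2 -> T3 -> R.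
Hypothesis mf : measurable_fun setT (fun w : T1 * T2 * T3 => f w.1.1 w.1.2 w.2).
Hypothesis f0 : forall x y z, 0 <= f x y z.

Lemma measurable_integral2 :
  measurable_fun setT (fun x => \int[m2]_y \int[m3]_z (f x y z)%:E)%E.
Proof.
apply: (measurable_eintegral_r m2 (fun x y => \int[m3]_z (f x y z)%:E)%E).
  exact: (measurable_integral_r m3 (fun w z => f w.1 w.2 z)).
by move=> x y; exact: integral_real_ge0.
Qed.

Lemma tonelliC3 :
  (\int[m1]_x \int[m2]_y \int[m3]_z (f x y z)%:E =
   \int[m2]_y \int[m3]_z \int[m1]_x (f x y z)%:E)%E.
Proof.
rewrite (fubini_tonelli (fun w => \int[m3]_z (f w.1 w.2 z)%:E)%E)/=; last 2 first.
- exact: (measurable_integral_r m3 (fun w z => f w.1 w.2 z)).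
- by move=> w; exact: integral_real_ge0.
apply: eq_integral => y _; rewrite tonelliC//.
have m2' : measurable_fun setT (fun w : T1 * T3 => ((w.1, y), w.2)).
  apply: measurable_fun_pair; last exact: measurable_snd.
  by apply: measurable_fun_pair; [exact: measurable_fst|exact: measurable_cst].
exact: (measurableT_comp mf m2').
Qed.

End tonelli3.

(** * Gamma and Beta integrals *)

Section truncated_powers.
Context {R : realType}.
Local Notation ell := (@lebesgue_measure R).
Implicit Types e p t s : R.

(** The cutoff is part of the function, so that all time integrals run over the whole line and
    translation, dilation and Tonelli apply without tracking domains. The exponent is shifted as in
    the Gamma integral: [p = b] gives [t^(b-1)], [p = -a] gives the stable weight [t^(-a-1)]. *)
Definition tpow e p t : R := \1_(`]e, +oo[%classic) t * t `^ (p - 1).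

Lemma tpowE e p t : tpow e p t = if e < t then t `^ (p - 1) else 0.
Proof.
rewrite /tpow indicE; case: ifPn => et.
  by rewrite mem_set ?mul1r//= in_itv/= et.
by rewrite memNset ?mul0r//= in_itv/= andbT; exact/negP.
Qed.

Lemma tpow_ge0 e p t : 0 <= tpow e p t.
Proof. by rewrite tpowE; case: ifP => // _; exact: powR_ge0. Qed.

End truncated_powers.

Ltac nonneg := repeat (cbv beta; first [assumption | lazymatch goal with
  | |- is_true (Order.le _ (GRing.mul _ _)) => apply: mulr_ge0
  | |- is_true (Order.le _ (GRing.add _ _)) => apply: addr_ge0
  | |- is_true (Order.le _ (expR _)) => exact: expR_ge0
  | |- is_true (Order.le _ (powR _ _)) => exact: powR_ge0
  | |- is_true (Order.le _ (tpow _ _ _)) => exact: tpow_ge0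
  | |- is_true (Order.le _ (GRing.natmul _ _)) => exact: ler0n
  | |- is_true (Order.le _ (GRing.exp _ _)) => exact: sqr_ge0
  | |- _ => done
  end]).

Section gamma_function.
Context {R : realType}.
Local Notation ell := (@lebesgue_measure R).
Implicit Types e p t s : R.

Lemma measurable_tpow e p : measurable_fun setT (tpow e p).
Proof. by apply: measurable_funM => //; exact: measurable_powR. Qed.

Lemma measurable_comp_tpow d (T : measurableType d) e p (f : T -> R) :
  measurable_fun setT f -> measurable_fun setT (fun x => tpow e p (f x)).
Proof. by move=> mf; apply: measurableT_comp => //; exact: measurable_tpow. Qed.

Lemma integral_indicM d (T : measurableType d) (mu : {measure set T -> \bar R})
    (A : set T) (f : T -> R) :
  (\int[mu]_t (\1_A t * f t)%:E = \int[mu]_(t in A) (f t)%:E)%E.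
Proof.
rewrite [RHS]integral_mkcond; apply: eq_integral => t _.
by rewrite patchE indicE; case: ifPn => _; rewrite ?mul1r ?mul0r.
Qed.

Lemma integral_expR_tail (r w : R) : 0 < r ->
  (\int[ell]_(t in `]w, +oo[) (r * expR (- (r * t)))%:E = (expR (- (r * w)))%:E)%E.
Proof.
move=> r0; rewrite integral_itv_obnd_cbnd; last first.
  apply/measurable_EFinP; apply: measurable_funTS; apply: measurable_funM => //.
  apply: measurableT_comp => //; apply: measurableT_comp => //.
rewrite (@ge0_continuous_FTC2y _ _ (fun t => - expR (- (r * t))) _ 0).
- by rewrite sub0e EFinN oppeK.
- by move=> x _; rewrite mulr_ge0 ?expR_ge0 ?ltW.
- apply: continuous_subspaceT => x; apply: cvgM; first exact: cvg_cst.
  apply: (@continuous_comp _ _ _ (fun t => - (r * t)) expR).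
    by apply: continuousN; apply: mulrl_continuous.
  exact: continuous_expR.
- rewrite -oppr0; apply: cvgN.
  apply: (@cvg_comp _ _ _ (fun t => r * t) (fun y => expR (- y)) _ +oo%R).
    by apply: gt0_cvgMry => //; exact: cvg_id.
  exact: cvgr_expR.
- by move=> x _; apply: ex_derive.
- apply: cvg_at_right_filter; apply: cvgN.
  apply: (@continuous_comp _ _ _ (fun t => - (r * t)) expR).
    by apply: continuousN; apply: mulrl_continuous.
  exact: continuous_expR.
- move=> x _; rewrite derive1E; apply: derive_val.
  apply: is_derive_eq; rewrite /GRing.scale/= mulr1; ring.
Qed.

Lemma powR_cts p t : 0 < t -> {for t, continuous (fun x : R => x `^ p)}.
Proof.
move=> t0; apply: differentiable_continuous; apply/derivable1_diffP.
by have [] := is_derive1_powR p t0.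
Qed.

Lemma integral_powR_head p s : 0 < p -> 0 < s ->
  (\int[ell]_(t in `]0%R, s[) (t `^ (p - 1))%:E = (s `^ p / p)%:E)%E.
Proof.
move=> p0 s0.
rewrite -[in RHS](subr0 (s `^ p / p)).
apply: (@ge0_FTC_oo R _ (fun t => t `^ p / p)) => //.
- by move=> x _; exact: powR_ge0.
- by move=> x /andP[x0 _]; exact: powR_cts.
- move=> x /andP[x0 _].
  rewrite [X in is_derive _ _ X _](_ : _ = p^-1 *: (@powR R ^~ p)); last first.
    by apply/funext => y; rewrite /= mulrC.
  apply: is_derive_eq; first by apply: is_deriveZ; exact: is_derive1_powR.
  by rewrite scalerA mulVf ?scale1r// gt_eqF.
- by rewrite -[X in _ --> X](mul0r p^-1); apply: cvgM; [exact: powR_cvg0|exact: cvg_cst].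
- apply: cvg_at_left_filter; apply: cvgM; last exact: cvg_cst.
  exact: powR_cts.
Qed.

Lemma powRN_cvgy p : 0 < p -> x `^ (- p) @[x --> +oo%R] --> (0 : R).
Proof.
move=> p0; apply/cvgrPdist_le => e e0; near=> a.
have c0 : 0 < e `^ (- p^-1) by rewrite powR_gt0.
have ca : e `^ (- p^-1) <= a by near: a; exact: nbhs_pinfty_ge.
have a0 : 0 < a by exact: lt_le_trans ca.
rewrite sub0r normrN ger0_norm ?powR_ge0// powRN invf_ple ?posrE ?powR_gt0//.
rewrite (_ : e^-1 = (e `^ (- p^-1)) `^ p).
  by rewrite ge0_ler_powR ?nnegrE ?ltW.
by rewrite -powRrM mulNr mulVf ?gt_eqF// powR_inv1 ?ltW.
Unshelve. all: by end_near. Qed.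

Lemma integral_powR_tail (b e : R) : 0 < b -> 0 < e ->
  (\int[ell]_(t in `]e, +oo[) (t `^ (- b - 1))%:E = (e `^ (- b) / b)%:E)%E.
Proof.
move=> b0 e0; rewrite integral_itv_obnd_cbnd; last first.
  apply/measurable_EFinP; apply: measurable_funTS; exact: measurable_powR.
have eb : forall x, e <= x -> 0 < x by move=> x; apply: lt_le_trans.
rewrite (@ge0_continuous_FTC2y _ _ (fun t => - (b^-1 * t `^ (- b))) _ 0).
- by rewrite sub0e EFinN oppeK mulrC.
- by move=> x _; exact: powR_ge0.
- apply: continuous_in_subspaceT => x; rewrite inE/= in_itv/= andbT => /eb.
  exact: powR_cts.
- rewrite -oppr0; apply: cvgN; rewrite -[X in _ --> X](mulr0 b^-1); apply: cvgM; first exact: cvg_cst.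
  exact: powRN_cvgy.
- move=> x /ltW/eb x0; apply: derivableN; apply: derivableM => //.
  by have [] := is_derive1_powR (- b) x0.
- apply: cvg_at_right_filter; apply: cvgN; apply: cvgM; first exact: cvg_cst.
  exact: powR_cts.
- move=> x; rewrite in_itv/= andbT => /ltW/eb x0; rewrite derive1E.
  rewrite (_ : (fun t => _) = - (b^-1 *: (@powR R ^~ (- b)))) //.
  have [h1 h2] := is_derive1_powR (- b) x0.
  rewrite deriveN; last exact: derivableZ.
  rewrite deriveZ// h2.
  by rewrite scalerA mulrN mulVf ?gt_eqF// scaleN1r opprK.
Qed.

Lemma integral_tpow_tail b e : 0 < b -> 0 < e ->
  (\int[ell]_t (tpow e (- b) t)%:E = (e `^ (- b) / b)%:E)%E.
Proof. by move=> b0 e0; rewrite integral_indicM integral_powR_tail. Qed.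

Lemma Gamma_def p :
  (Gamma p = fine (\int[ell]_t (tpow 0 p t * expR (- t))%:E))%R.
Proof.
rewrite /Gamma /Rintegral; congr fine; rewrite -integral_indicM.
by apply: eq_integral => t _; rewrite mulrA.
Qed.

Lemma integral_expR1_tail w :
  (\int[ell]_(t in `]w, +oo[) (expR (- t))%:E = (expR (- w))%:E)%E.
Proof.
have := @integral_expR_tail 1 w ltr01; rewrite mul1r => <-.
by apply: eq_integral => t _; rewrite !mul1r.
Qed.

Lemma measurable_expRN : measurable_fun setT (fun t : R => expR (- t)).
Proof. exact: measurableT_comp. Qed.

Lemma measurable_lt_indic d (T : measurableType d) (f g : T -> R) :
  measurable_fun setT f -> measurable_fun setT g ->
  measurable_fun setT (fun x => (f x < g x)%R%:R : R).
Proof.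
move=> mf mg.
rewrite (_ : (fun _ => _) = \1_[set x | f x < g x]); last first.
  apply/funext => x; rewrite indicE; have [h|h] := boolP (f x < g x).
    by rewrite mem_set.
  by rewrite memNset//=; exact/negP.
apply: measurable_indic.
rewrite -[X in measurable X]setTI.
by apply: (measurable_fun_ltr mf mg measurableT (_ : measurable [set true])).
Qed.

(** Write [expR (- s)] as the integral of [expR (- t)] over [t > s] and exchange the integrals; the
    inner one is then [t^p / p]. Since this takes place in the extended reals, it does not
    presuppose convergence and can be used to prove it. *)
Lemma ereal_Gamma_rec p : 0 < p ->
  (\int[ell]_t (tpow 0 (p + 1) t * expR (- t))%:E =
   p%:E * \int[ell]_t (tpow 0 p t * expR (- t))%:E)%E.
Proof.
move=> p0.
pose f (s t : R) : R := tpow 0 p s * ((s < t)%R%:R * expR (- t)).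
have mf : measurable_fun setT (fun z : R * R => f z.1 z.2).
  apply: measurable_funM; first exact: measurable_comp_tpow.
  apply: measurable_funM; first exact: measurable_lt_indic.
  by apply: measurableT_comp => //; exact: measurableT_comp.
have f0 s t : 0 <= f s t.
  by apply: mulr_ge0; [exact: tpow_ge0|apply: mulr_ge0; [exact: ler0n|exact: expR_ge0]].
have indE (s t : R) : (s < t)%R%:R = \1_(`]s, +oo[%classic) t :> R.
  rewrite indicE; have [st|st] := boolP (s < t).
    by rewrite mem_set//= in_itv/= st.
  by rewrite memNset//= in_itv/= andbT; exact/negP.
transitivity (p%:E * \int[ell]_s \int[ell]_t (f s t)%:E)%E; last first.
  congr (_ * _)%E; apply: eq_integral => s _; rewrite /f.
  rewrite ge0_integralZ ?tpow_ge0//; last first.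
    apply: measurable_funM; last exact: measurable_expRN.
    exact: measurable_lt_indic.
  under eq_integral do rewrite indE.
  by rewrite integral_indicM integral_expR1_tail EFinM.
rewrite tonelliC// -ge0_integralZl_EFin ?ltW//; last 2 first.
- by move=> t _; apply: integral_ge0 => s _; rewrite lee_fin.
- exact: measurable_integral_l.
apply: eq_integral => t _; rewrite /f.
transitivity (p%:E * \int[ell]_s (expR (- t) * (tpow 0 p s * (s < t)%R%:R))%:E)%E; last first.
  by congr (_ * _)%E; apply: eq_integral => s _; congr EFin; ring.
rewrite ge0_integralZ ?expR_ge0//; last 2 first.
- by apply: measurable_funM; [exact: measurable_tpow|exact: measurable_lt_indic].
- by move=> s; rewrite mulr_ge0 ?ler0n ?tpow_ge0.
have [t0|t0] := ltP 0 t; last first.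
  rewrite tpowE ltNge t0/= mul0r integral0_eq ?mule0// => s _.
  by rewrite tpowE; case: ltP => s0; rewrite ?mul0r// ltNge (le_trans t0) ?mulr0// ltW.
transitivity (p%:E * ((expR (- t))%:E * \int[ell]_(s in `]0%R, t[) (s `^ (p - 1))%:E))%E.
  rewrite integral_powR_head// tpowE t0 addrK -!EFinM; congr EFin.
  by field; rewrite gt_eqF.
congr (_ * (_ * _))%E; rewrite -[LHS]integral_indicM; apply: eq_integral => s _.
rewrite tpowE indicE; congr EFin; have [s0|s0] := ltP 0 s.
  have [st|st] := ltP s t; first by rewrite mem_set ?mul1r ?mulr1//= in_itv/= s0 st.
  by rewrite memNset ?mul0r ?mulr0//= in_itv/= s0/= => /lt_geF; rewrite st.
by rewrite memNset ?mul0r//= in_itv/= ltNge s0.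
Qed.

(** For exponents in []0, 1]] the integrand is at most [t^(p-1)] near 0 and [expR (- t)] beyond 1;
    the recurrence carries finiteness to larger exponents. *)
Lemma ereal_Gamma_lty p : 0 < p ->
  (\int[ell]_t (tpow 0 p t * expR (- t))%:E < +oo)%E.
Proof.
have small q : 0 < q -> q <= 1 ->
    (\int[ell]_t (tpow 0 q t * expR (- t))%:E < +oo)%E.
  move=> q0 q1.
  apply: (@le_lt_trans _ _
     (\int[ell]_t (\1_(`]0, 2[%classic) t * t `^ (q - 1) +
                   \1_(`]1, +oo[%classic) t * expR (- t))%:E)%E).
    apply: le_integral_real => //.
    - apply: measurable_funM; last exact: measurable_expRN.
      exact: measurable_tpow.
    - apply: measurable_funD.
        by apply: measurable_funM => //; exact: measurable_powR.
      by apply: measurable_funM => //; exact: measurable_expRN.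
    - move=> t; rewrite mulr_ge0 ?tpow_ge0 ?expR_ge0//= !indicE tpowE.
      have [t0|t0] := ltP 0 t; last first.
        by rewrite mul0r; nonneg.
      have [t2|t2] := ltP t 2.
        rewrite (_ : t \in _ = true); last by rewrite mem_set//= in_itv/= t0.
        rewrite mul1r; apply: ler_wpDr; first by nonneg.
        apply: ler_piMr; first exact: powR_ge0.
        by rewrite -expR0 ler_expR oppr_le0 ltW.
      rewrite (_ : t \in `]1, +oo[%classic = true); last first.
        by rewrite mem_set//= in_itv/= andbT (lt_le_trans _ t2)// ltr1n.
      rewrite mul1r; apply: ler_wpDl; first by nonneg.
      apply: ler_piMl; first exact: expR_ge0.
      rewrite -[leRHS](powRr0 t); apply: ler_powR; last by rewrite subr_le0.
      by rewrite (le_trans _ t2)// ler1n.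
  rewrite ge0_integralDr; last 4 first.
  - by apply: measurable_funM => //; exact: measurable_powR.
  - by apply: measurable_funM => //; exact: measurable_expRN.
  - by move=> t; nonneg.
  - by move=> t; nonneg.
  rewrite !integral_indicM integral_powR_head// integral_expR1_tail -EFinD.
  exact: ltry.
move=> p0.
have [n pn] : exists n : nat, p <= n.+1%:R.
  by exists (Num.truncn p); rewrite ltW// truncnS_gt.
elim: n p p0 pn => [|n IH] p p0 pn; first exact: small.
have [p1|p1] := leP p 1; first exact: small.
rewrite -(subrK 1 p) ereal_Gamma_rec ?subr_gt0//.
rewrite lte_mul_pinfty ?lee_fin ?subr_ge0 ?ltW//.
by rewrite IH ?subr_gt0// lerBlDr natr1.
Qed.

Lemma Gamma_EFin p : 0 < p ->
  (\int[ell]_t (tpow 0 p t * expR (- t))%:E = (Gamma p)%:E)%E.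
Proof.
move=> p0; rewrite Gamma_def fineK// ge0_fin_numE ?ereal_Gamma_lty//.
by apply: integral_ge0 => t _; rewrite lee_fin mulr_ge0 ?tpow_ge0 ?expR_ge0.
Qed.

Lemma Gamma_gt0 p : 0 < p -> 0 < Gamma p.
Proof.
move=> p0; rewrite -lte_fin -Gamma_EFin//.
apply: (@lt_le_trans _ _
  (\int[ell]_t (expR (- 1) * (\1_(`]0, 1[%classic) t * t `^ (p - 1)))%:E)%E).
  rewrite ge0_integralZ; last 3 first.
  - exact: expR_ge0.
  - by apply: measurable_funM => //; exact: measurable_powR.
  - by move=> t; nonneg.
  rewrite integral_indicM integral_powR_head// -EFinM lte_fin.
  by rewrite mulr_gt0 ?expR_gt0// divr_gt0// powR_gt0.
apply: le_integral_real => //.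
- apply: measurable_funM; first exact: measurable_cst.
  by apply: measurable_funM => //; exact: measurable_powR.
- apply: measurable_funM; last exact: measurable_expRN.
  exact: measurable_tpow.
- move=> t; rewrite mulr_ge0 ?mulr_ge0 ?expR_ge0 ?powR_ge0//= indicE tpowE.
  have [/[!inE]/=|_] := boolP (t \in _); last first.
    by rewrite mul0r mulr0 mulr_ge0 ?expR_ge0//; case: ifP => //; rewrite powR_ge0.
  rewrite in_itv/= => /andP[t0 t1]; rewrite t0 mul1r mulrC ler_wpM2l ?powR_ge0//.
  by rewrite ler_expR lerN2 ltW.
Qed.

Lemma GammaS p : 0 < p -> Gamma (p + 1) = p * Gamma p.
Proof.
move=> p0; apply: EFin_inj; rewrite EFinM -!Gamma_EFin ?addr_gt0//.
exact: ereal_Gamma_rec.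
Qed.

End gamma_function.

(** The inverse is odd and equals the power [t^-1] for [t > 0]; at 0 both cut powers vanish, in
    agreement with the convention [0^-1 = 0]. *)
Lemma measurable_inv {R : realType} : measurable_fun setT (@GRing.inv R).
Proof.
rewrite (_ : GRing.inv = fun t : R => tpow 0 0 t - tpow 0 0 (- t)).
  apply: measurable_funB; first exact: measurable_tpow.
  apply: measurable_comp_tpow; exact: measurable_funN.
apply/funext => t; rewrite !tpowE sub0r oppr_gt0.
have [t0|t0|t0] := ltgtP 0 t.
- by rewrite subr0 powR_inv1 ?ltW.
- by rewrite sub0r powR_inv1 ?oppr_ge0 ?ltW// invrN opprK.
- by rewrite -t0 invr0 subr0.
Qed.

Section measurability.
Context {d} {T : measurableType d} {R : realType}.
Implicit Types f : T -> R.

Lemma measurable_comp_inv f : measurable_fun setT f ->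
  measurable_fun setT (fun x => (f x)^-1).
Proof.
by move=> mf; apply: (@measurableT_comp _ _ _ _ _ _ (@GRing.inv R));
  first exact: measurable_inv.
Qed.

Lemma measurable_comp_expR f : measurable_fun setT f ->
  measurable_fun setT (fun x => expR (f x)).
Proof. by move=> mf; apply: measurableT_comp. Qed.

Lemma measurable_comp_powR p f : measurable_fun setT f ->
  measurable_fun setT (fun x => f x `^ p).
Proof.
by move=> mf; apply: (@measurableT_comp _ _ _ _ _ _ (fun r : R => r `^ p)).
Qed.

End measurability.

Ltac meas := repeat (cbv beta; lazymatch goal with
  | |- measurable_fun _ (fun x => GRing.mul (@?f1 x) (@?f2 x)) => apply: measurable_funM
  | |- measurable_fun _ (fun x => GRing.add (@?f1 x) (GRing.opp (@?f2 x))) => apply: measurable_funB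
  | |- measurable_fun _ (fun x => GRing.add (@?f1 x) (@?f2 x)) => apply: measurable_funD
  | |- measurable_fun _ (fun x => GRing.opp (@?f1 x)) => apply: measurable_funN
  | |- measurable_fun _ (fun x => GRing.exp (@?f1 x) (@?f2 x)) => apply: measurable_funX
  | |- measurable_fun _ (fun x => GRing.inv (@?f1 x)) => apply: measurable_comp_inv
  | |- measurable_fun _ (fun x => expR (@?f1 x)) => apply: measurable_comp_expR
  | |- measurable_fun _ (fun x => powR (@?f1 x) (@?f2 x)) => apply: measurable_comp_powR
  | |- measurable_fun _ (fun x => tpow (@?f1 x) (@?f2 x) (@?f3 x)) => apply: measurable_comp_tpow
  | |- measurable_fun _ (fun x => indic (@?f1 x) (@?f2 x)) => exact: measurable_indic
  | |- measurable_fun _ (fun x => GRing.natmul (@?f1 x) (@?f2 x)) => apply: measurable_lt_indic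
  | |- _ => first [assumption | exact: measurable_cst | exact: measurable_fst
      | exact: measurable_snd | exact: measurable_id | exact: measurable_tpow
      | exact: measurable_powR | exact: measurable_indic
      | exact: measurable_inv
      | apply: measurable_funM; [exact: measurable_cst|exact: measurable_id]]
  end).

Section gamma_beta.
Context {R : realType}.
Local Notation ell := (@lebesgue_measure R).
Implicit Types p q r s t : R.

Lemma tpow_dilate p r t : 0 < r ->
  tpow 0 p (r * t) = r `^ (p - 1) * tpow 0 p t.
Proof.
move=> r0; rewrite !tpowE pmulr_rgt0//; case: ifP => t0; last by rewrite mulr0.
by rewrite powRM ?ltW.
Qed.

Lemma gt0_powRD r p q : 0 < r -> r `^ (p + q) = r `^ p * r `^ q.
Proof. by move=> r0; rewrite powRD// (gt_eqF r0) implybT. Qed.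

Lemma powR_pred p r : 0 < r -> r * r `^ (p - 1) = r `^ p.
Proof.
move=> r0; rewrite -{1}(powRr1 (ltW r0)) -gt0_powRD//.
by congr powR; ring.
Qed.

Lemma Gamma_dilate p r : 0 < p -> 0 < r ->
  (\int[ell]_t (tpow 0 p t * expR (- (r * t)))%:E = (r `^ (- p) * Gamma p)%:E)%E.
Proof.
move=> p0 r0; set X := (X in X = _).
suff h : ((r `^ p)%:E * X = (Gamma p)%:E)%E.
  rewrite EFinM -h muleA -EFinM powRN mulVf ?mul1e// gt_eqF// powR_gt0//.
rewrite -Gamma_EFin// -(ge0_integral_dilate (fun t => (tpow 0 p t * expR (- t))%:E)_ r0).
- rewrite -(powR_pred _ _ r0) [X in (X * _)%E]EFinM -muleA; congr (_ * _)%E; rewrite /X.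
  rewrite -ge0_integralZ; [|exact: powR_ge0|by meas|by move=> t; nonneg].
  by apply: eq_integral => t _; rewrite tpow_dilate// mulrA.
- by apply/measurable_EFinP; meas.
- by move=> t; rewrite lee_fin; nonneg.
Qed.

(* Writing [exp (- r / t)] as an integral over [v > 1 / t] and exchanging the
   integrals spares the substitution [t -> 1 / t]. *)
Lemma integral_heat_power b r : 0 < b -> 0 < r ->
  (\int[ell]_t (tpow 0 (- b) t * expR (- (r / t)))%:E = (r `^ (- b) * Gamma b)%:E)%E.
Proof.
move=> b0 r0.
pose f (v t : R) : R := (r * expR (- (r * v))) * (tpow 0 (- b) t * (t^-1 < v)%R%:R).
have mf : measurable_fun setT (fun z : R * R => f z.1 z.2) by rewrite /f; meas.
have f0 v t : 0 <= f v t by rewrite /f; nonneg; exact: ltW.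
transitivity (\int[ell]_t \int[ell]_v (f v t)%:E)%E.
  apply: eq_integral => t _.
  transitivity (\int[ell]_v (tpow 0 (- b) t *
      (\1_(`]t^-1, +oo[%classic) v * (r * expR (- (r * v)))))%:E)%E; last first.
    apply: eq_integral => v _; rewrite /f indicE; congr EFin.
    have [h|h] := boolP (t^-1 < v).
      by rewrite mem_set//= ?in_itv/= ?h//; ring.
    by rewrite memNset//= ?in_itv/= ?andbT//; [ring|exact/negP].
  rewrite ge0_integralZ; last 3 first.
  - exact: tpow_ge0.
  - by meas.
  - by move=> v; nonneg; exact: ltW.
  by rewrite integral_indicM integral_expR_tail// EFinM.
rewrite -tonelliC//.
transitivity (\int[ell]_v ((r / b) * (tpow 0 (b + 1) v * expR (- (r * v))))%:E)%E.
  apply: eq_integral => v _; rewrite /f ge0_integralZ; last 3 first.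
  - by nonneg; exact: ltW.
  - by meas.
  - by move=> t; nonneg.
  have [v0|v0] := ltP 0 v; last first.
    rewrite [tpow _ _ v]tpowE ltNge v0/= mul0r mulr0 integral0_eq ?mule0// => t _.
    rewrite tpowE; case: ltP => t0; last by rewrite mul0r.
    rewrite ltNge (le_trans v0) ?mulr0// invr_ge0; exact: ltW.
  transitivity ((r * expR (- (r * v)))%:E * \int[ell]_t (tpow v^-1 (- b) t)%:E)%E.
    congr (_ * _)%E; apply: eq_integral => t _; rewrite !tpowE; congr EFin.
    have [t0|t0] := ltP 0 t; last by rewrite mul0r ltNge (le_trans t0) ?invr_ge0 ?ltW.
    by rewrite invf_plt ?posrE//; case: ltP; rewrite ?mulr1 ?mulr0.
  rewrite integral_tpow_tail ?invr_gt0// -EFinM; congr EFin.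
  rewrite tpowE v0 addrK -powR_inv1 ?ltW// -powRrM mulN1r opprK.
  by field; rewrite gt_eqF.
rewrite ge0_integralZ; last 3 first.
- by rewrite ltW// divr_gt0.
- by meas.
- by move=> v; nonneg.
rewrite Gamma_dilate ?addr_gt0// GammaS// -EFinM; congr EFin.
rewrite opprD -[in RHS](powR_pred (- b) _ r0).
by field; rewrite gt_eqF.
Qed.

(** Euler's Beta integral. Dilation by [s] extracts the power of [s] and leaves the constant [B],
    the value at [s = 1]. *)
Lemma convolution_tpow p q : 0 < p -> 0 < q -> forall s,
  (\int[ell]_t (tpow 0 p t * tpow 0 q (s - t))%:E =
   (Gamma p * Gamma q / Gamma (p + q) * tpow 0 (p + q) s)%:E)%E.
Proof.
move=> p0 q0.
pose B := (\int[ell]_t (tpow 0 p t * tpow 0 q (1 - t))%:E)%E.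
have Bs s : (\int[ell]_t (tpow 0 p t * tpow 0 q (s - t))%:E =
    B * (tpow 0 (p + q) s)%:E)%E.
  have [s0|s0] := ltP 0 s; last first.
    rewrite [tpow 0 (p + q) s]tpowE ltNge s0/= mule0 integral0_eq// => t _.
    rewrite !tpowE; case: ltP => t0; last by rewrite mul0r.
    by rewrite ltNge (_ : s - t <= 0) ?mulr0//; lra.
  rewrite -(ge0_integral_dilate (fun t => (tpow 0 p t * tpow 0 q (s - t))%:E) _ s0).
  - rewrite [tpow 0 (p + q) s]tpowE s0 [RHS]muleC /B.
    transitivity (s%:E * \int[ell]_t (s `^ (p - 1) * s `^ (q - 1) *
       (tpow 0 p t * tpow 0 q (1 - t)))%:E)%E.
      congr (_ * _)%E; apply: eq_integral => t _.
      have -> : s - s * t = s * (1 - t) by ring.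
      by rewrite !tpow_dilate//; congr EFin; ring.
    rewrite ge0_integralZ; [|by nonneg|by meas|by move=> t; nonneg].
    rewrite muleA -EFinM; congr (_%:E * _)%E.
    by rewrite mulrA powR_pred// -gt0_powRD//; congr powR; ring.
  - by apply/measurable_EFinP; meas.
  - by move=> t; rewrite lee_fin; nonneg.
(* The constant is found by integrating the convolution against [expR (- s)], which splits as
   [expR (- t) * expR (- (s - t))]. *)
have BG : (B * (Gamma (p + q))%:E = (Gamma p * Gamma q)%:E)%E.
  pose f s t : R := tpow 0 p t * (tpow 0 q (s - t) * expR (- s)).
  have mf : measurable_fun setT (fun z : R * R => f z.1 z.2) by rewrite /f; meas.
  have f0 v t : 0 <= f v t by rewrite /f; nonneg.
  have B0 : (0 <= B)%E by apply: integral_real_ge0 => t; nonneg.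
  transitivity (\int[ell]_s \int[ell]_t (f s t)%:E)%E.
    rewrite -Gamma_EFin ?addr_gt0// -ge0_integralZl//; last 2 first.
    - by apply/measurable_EFinP; meas.
    - by move=> t _; rewrite lee_fin; nonneg.
    apply: eq_integral => s _; rewrite EFinM muleA -Bs muleC.
    rewrite -ge0_integralZ; [|exact: expR_ge0|by meas|by move=> t; nonneg].
    by apply: eq_integral => t _; congr EFin; rewrite /f; ring.
  rewrite tonelliC// EFinM -!Gamma_EFin// muleC.
  rewrite -ge0_integralZl//; last 3 first.
  - by apply/measurable_EFinP; meas.
  - by move=> t _; rewrite lee_fin; nonneg.
  - by apply: integral_real_ge0 => t; nonneg.
  apply: eq_integral => t _; rewrite /f.
  rewrite ge0_integralZ; [|exact: tpow_ge0|by meas|by move=> s; nonneg].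
  rewrite -(ge0_integral_translate (fun s => (tpow 0 q (s - t) * expR (- s))%:E) t).
  - rewrite [in RHS]EFinM [RHS]muleCA; congr (_ * _)%E; rewrite [RHS]muleC.
    rewrite -ge0_integralZ; [|exact: expR_ge0|by meas|by move=> s; nonneg].
    apply: eq_integral => s _; rewrite addrK opprD expRD; congr EFin; ring.
  - by apply/measurable_EFinP; meas.
  - by move=> s; rewrite lee_fin; nonneg.
have G0 : 0 < Gamma (p + q) by rewrite Gamma_gt0 ?addr_gt0.
move=> s; rewrite Bs [RHS]EFinM; congr (_ * _)%E.
rewrite EFinM -BG -muleA -EFinM mulfV ?mule1// gt_eqF//.
Qed.

(* Integrates the derivative of [t^-a (s - t)^b], which splits into the two
   integrands on the left. *)
Lemma truncated_beta_le a b e s : 0 < a -> a < b -> 0 < e ->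
  (\int[ell]_t (tpow e (- a) t * tpow 0 b (s - t))%:E +
   ((b - a) / a * tpow 0 0 s)%:E * \int[ell]_t (tpow e (1 - a) t * tpow 0 b (s - t))%:E
   <= (e `^ (- a) / a * tpow 0 b s)%:E)%E.
Proof.
move=> a0 ab e0.
have b0 : 0 < b by exact: lt_trans ab.
have [se|es] := leP s e.
  have z t c : tpow e c t * tpow 0 b (s - t) = 0.
    rewrite !tpowE; case: ltP => et; last by rewrite mul0r.
    by rewrite ltNge (_ : s - t <= 0) ?mulr0//; lra.
  rewrite !integral0_eq ?mule0 ?adde0 ?lee_fin//; do ?by move=> t _; rewrite z.
  by rewrite mulr_ge0 ?tpow_ge0// divr_ge0 ?powR_ge0 ?ltW.
have s0 : 0 < s by exact: lt_trans es.
rewrite [tpow 0 0 s]tpowE s0 sub0r powR_inv1 ?(ltW s0)//.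
have k0 : 0 <= (b - a) / a / s by rewrite !divr_ge0 ?subr_ge0 ?ltW.
rewrite -ge0_integralZ//; [|by meas|by move=> t; nonneg].
rewrite -ge0_integralDr; [|by meas|by meas|by move=> t; nonneg|by move=> t; nonneg].
pose F t := (a * s)^-1 * - (t `^ (- a) * (s - t) `^ b).
pose f t := t `^ (- a - 1) * (s - t) `^ (b - 1) +
   (b - a) / a / s * (t `^ (- a) * (s - t) `^ (b - 1)).
rewrite (_ : (\int[ell]_t _ = \int[ell]_(t in `]e, s[) (f t)%:E)%E); last first.
  rewrite -[RHS]integral_indicM; apply: eq_integral => t _; congr EFin.
  rewrite !tpowE indicE subr_gt0 /f.
  have [et|et] := ltP e t; last by rewrite !mul0r mulr0 addr0 memNset ?mul0r//= in_itv/= ltNge et.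
  have [ts|ts] := ltP t s; last by rewrite !mulr0 addr0 memNset ?mul0r//= in_itv/= et/= => /lt_geF; rewrite ts.
  rewrite mem_set ?mul1r//= ?in_itv/= ?et//.
  by congr (_ + _ * (_ `^ _ * _)); ring.
suff -> : (\int[ell]_(t in `]e, s[) (f t)%:E = (0 - F e)%:E)%E.
  (* The boundary term at [e] is [e^(-a) (s-e)^b / (a s)]; bounding [s - e] by [s] in it is the only
     loss. *)
  rewrite sub0r lee_fin /F mulrN opprK [tpow _ _ _]tpowE s0.
  have h : (s - e) `^ b <= s `^ b by rewrite ge0_ler_powR ?nnegrE ?ltW ?subr_gt0//; lra.
  have -> : e `^ (- a) / a * s `^ (b - 1) = (a * s)^-1 * (e `^ (- a) * s `^ b).
    by rewrite -(powR_pred b _ s0); field; rewrite !gt_eqF.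
  by rewrite !ler_wpM2l ?powR_ge0// invr_ge0 ltW// mulr_gt0.
apply: (@ge0_FTC_oo R f F e s (F e) 0) => //.
- by move=> t _; rewrite /f; nonneg.
- move=> t /andP[et ts]; have t0 : 0 < t by exact: lt_trans et.
  have st0 : 0 < s - t by rewrite subr_gt0.
  have c1 p : {for t, continuous (fun x : R => x `^ p)} by exact: powR_cts.
  have c2 p : {for t, continuous (fun x : R => (s - x) `^ p)}.
    apply: (@continuous_comp _ _ _ (fun x => s - x) (fun x : R => x `^ p)).
      by apply: continuousB; [exact: cst_continuous|exact: cvg_id].
    exact: powR_cts.
  apply: continuousD; first exact: continuousM.
  by apply: continuousM; [exact: cst_continuous|exact: continuousM].
- move=> t /andP[et ts]; have t0 : 0 < t by exact: lt_trans et.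
  have st0 : 0 < s - t by rewrite subr_gt0.
  have d1 := is_derive1_powR (- a) t0.
  have d2 : is_derive t 1 (fun x : R => (s - x) `^ b) (- (b * (s - t) `^ (b - 1))).
    apply: is_derive_eq.
      apply: (@is_derive1_comp _ (fun x : R => x `^ b) (fun x => s - x)).
      exact: is_derive1_powR.
    by rewrite add0r mul1r mulrN1.
  rewrite /F; apply: is_derive_eq.
  rewrite /GRing.scale/= /f -(powR_pred b _ st0) -[in LHS](powR_pred (- a) _ t0).
  rewrite -[in RHS](powR_pred (- a) _ t0).
  by field; rewrite !gt_eqF.
- apply: cvg_at_right_filter; apply: cvgM; first exact: cvg_cst.
  apply: cvgN; apply: cvgM; first exact: powR_cts.
  apply: (@continuous_comp _ _ _ (fun x => s - x) (fun x : R => x `^ b)).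
    by apply: continuousB; [exact: cst_continuous|exact: cvg_id].
  by apply: powR_cts; rewrite subr_gt0.
- rewrite -[X in _ --> X](mulr0 (a * s)^-1); apply: cvgM; first exact: cvg_cst.
  rewrite -oppr0; apply: cvgN; rewrite -[X in _ --> X](mulr0 (s `^ (- a))).
  apply: cvgM; first by apply: cvg_at_left_filter; exact: powR_cts.
  apply/cvg_at_leftP => u [us ul].
  have /cvg_at_rightP/(_ (fun n => s - u n)) := powR_cvg0 b0; apply; split.
    by move=> n; rewrite subr_gt0.
  by rewrite -[X in _ --> X](subrr s); apply: cvgB => //; exact: cvg_cst.
Qed.

End gamma_beta.

(** * The heat kernel *)

Section tuple_integral.
Context {R : realType}.

Lemma ge0_integral_leb_succ (d : nat) (f : d.+1.-tuple R -> R) :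
  measurable_fun setT f -> (forall x, 0 <= f x) ->
  (\int[leb R d.+1]_x (f x)%:E =
   \int[@lebesgue_measure R]_a \int[leb R d]_z (f (tcons (a, z)))%:E)%E.
Proof.
move=> mf f0.
transitivity (\int[pushforward (@lebesgue_measure R \x leb R d)%E tcons]_x (f x)%:E)%E.
  by [].
rewrite ge0_integral_pushforward//; last 3 first.
- exact: measurable_tcons.
- exact/measurable_EFinP.
- by move=> x _; rewrite lee_fin.
rewrite preimage_setT fubini_tonelli1//; last 2 first.
- apply/measurable_EFinP; apply: measurableT_comp => //; exact: measurable_tcons.
- by move=> x; rewrite lee_fin.
Qed.

(** Squared lengths are additive over the coordinates, which suits the inductive construction of
    Lebesgue measure and the product structure of the heat kernel. *)
Definition sqnorm {d} (x : d.-tuple R) : R := \sum_(i < d) tnth x i ^+ 2.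
Definition sqdist {d} (x y : d.-tuple R) : R :=
  \sum_(i < d) (tnth x i - tnth y i) ^+ 2.

Lemma sqnorm_cons d a (z : d.-tuple R) : sqnorm (tcons (a, z)) = a ^+ 2 + sqnorm z.
Proof.
rewrite /sqnorm big_ord_recl; congr (_ ^+ 2 + _).
by apply: eq_bigr => i _; rewrite tnthS.
Qed.

Lemma sqdist_cons d a b (w z : d.-tuple R) :
  sqdist (tcons (a, w)) (tcons (b, z)) = (a - b) ^+ 2 + sqdist w z.
Proof.
rewrite /sqdist big_ord_recl; congr ((_ - _) ^+ 2 + _).
by apply: eq_bigr => i _; rewrite !tnthS.
Qed.

Lemma sqnorm_ge0 d (x : d.-tuple R) : 0 <= sqnorm x.
Proof. by apply: sumr_ge0 => i _; exact: sqr_ge0. Qed.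

Lemma sqdist_ge0 d (x y : d.-tuple R) : 0 <= sqdist x y.
Proof. by apply: sumr_ge0 => i _; exact: sqr_ge0. Qed.

Lemma sqdistC d (x y : d.-tuple R) : sqdist x y = sqdist y x.
Proof. by apply: eq_bigr => i _; rewrite -opprB sqrrN. Qed.

Lemma sqdist_gt0 d (x y : d.-tuple R) : x != y -> 0 < sqdist x y.
Proof.
move=> xy; rewrite lt_def sqdist_ge0 andbT; apply: contra xy.
rewrite psumr_eq0; last by move=> i _; exact: sqr_ge0.
move=> /allP h; apply/eqP/eq_from_tnth => i; apply/eqP.
by rewrite -subr_eq0 -sqrf_eq0; apply: h; rewrite mem_index_enum.
Qed.

Context {d'} {T : measurableType d'}.

Lemma measurable_comp_sqnorm d (f : T -> d.-tuple R) : measurable_fun setT f ->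
  measurable_fun setT (fun t => sqnorm (f t)).
Proof.
move=> mf; apply: measurable_sum => i; apply: measurable_funX.
by apply: (@measurableT_comp _ _ _ _ _ _ (fun x : d.-tuple R => tnth x i));
  first exact: measurable_tnth.
Qed.

Lemma measurable_comp_sqdist d (f g : T -> d.-tuple R) :
  measurable_fun setT f -> measurable_fun setT g ->
  measurable_fun setT (fun t => sqdist (f t) (g t)).
Proof.
move=> mf mg; apply: measurable_sum => i; apply: measurable_funX.
by apply: measurable_funB;
  apply: (@measurableT_comp _ _ _ _ _ _ (fun x : d.-tuple R => tnth x i)) => //;
  exact: measurable_tnth.
Qed.

End tuple_integral.

(* [r] is the squared distance. *)
Definition heat {R : realType} (d : nat) (t r : R) : R :=
  (4 * pi * t) `^ (- (d%:R / 2)) * expR (- (r / 4 / t)).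

Lemma heat_ge0 {R : realType} (d : nat) (t r : R) : 0 <= heat d t r.
Proof. by rewrite mulr_ge0 ?powR_ge0 ?expR_ge0. Qed.

Lemma measurable_comp_heat {R : realType} d' (T : measurableType d') (d : nat)
  (f g : T -> R) : measurable_fun setT f -> measurable_fun setT g ->
  measurable_fun setT (fun x => heat d (f x) (g x)).
Proof. by move=> mf mg; rewrite /heat; meas. Qed.

Ltac nonneg' := repeat (nonneg; lazymatch goal with
  | |- is_true (Order.le _ (heat _ _ _)) => exact: heat_ge0
  end).

Ltac meas' := repeat first [ progress meas | lazymatch goal with
  | |- measurable_fun _ (fun x => heat (@?f1 x) (@?f2 x) (@?f3 x)) => apply: measurable_comp_heat
  | |- measurable_fun _ (fun x => sqnorm (@?f1 x)) => apply: measurable_comp_sqnorm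
  | |- measurable_fun _ (fun x => sqdist (@?f1 x) (@?f2 x)) => apply: measurable_comp_sqdist
  end | apply: measurable_comp_sqnorm | apply: measurable_comp_sqdist].

Section heat_kernel.
Context {R : realType}.
Local Notation ell := (@lebesgue_measure R).
Implicit Types (d : nat) (p s t r : R).

Lemma heatD d t r1 r2 : 0 < t -> heat d.+1 t (r1 + r2) = heat 1 t r1 * heat d t r2.
Proof.
move=> t0; rewrite /heat mulrACA -expRD -gt0_powRD ?mulr_gt0 ?pi_gt0//.
congr (_ `^ _ * expR _); first by rewrite -natr1; ring.
by field; rewrite gt_eqF.
Qed.

Lemma heat0 t : 0 < t -> heat 0 t 0 = 1.
Proof. by move=> t0; rewrite /heat !mul0r oppr0 powRr0 expR0 mulr1. Qed.

(** At time [t] the one-dimensional heat kernel is a Gaussian of variance [2 t]; this gives access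
    to its total mass. *)
Lemma heat1_normal_pdf t m y : 0 < t ->
  heat 1 t ((y - m) ^+ 2) = normal_pdf m (Num.sqrt (2 * t)) y.
Proof.
move=> t0; have t2 : 0 < 2 * t by rewrite mulr_gt0.
rewrite /normal_pdf gt_eqF ?sqrtr_gt0// /normal_peak /normal_fun.
rewrite sqr_sqrtr ?ltW// /heat powRN mul1r powR12_sqrt; last first.
  by rewrite !mulr_ge0 ?pi_ge0// ltW.
congr (_^-1 * expR _); first by congr Num.sqrt; ring.
by field; rewrite gt_eqF.
Qed.

Lemma integral_heat1 t m : 0 < t ->
  (\int[ell]_y (heat 1 t ((m - y) ^+ 2))%:E = 1)%E.
Proof.
move=> t0; rewrite -(integral_normal_pdf m (Num.sqrt (2 * t))).
by apply: eq_integral => y _; rewrite -heat1_normal_pdf// -opprB sqrrN.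
Qed.

(** Completing the square in [y]: the product of the two Gaussians is again Gaussian in [y], with
    mean [s x / (t + s)] and time [t s / (t + s)], times a factor free of [y]. *)
Lemma heat1_mul t s x y : 0 < t -> 0 < s ->
  heat 1 t ((x - y) ^+ 2) * heat 1 s (y ^+ 2) =
  heat 1 (t + s) (x ^+ 2) * heat 1 (t * s / (t + s)) ((s * x / (t + s) - y) ^+ 2).
Proof.
move=> t0 s0; have ts0 : 0 < t + s by rewrite addr_gt0.
have q0 : 0 < t * s / (t + s) by rewrite divr_gt0 ?mulr_gt0.
rewrite /heat ![_ * expR _ * _]mulrACA -!expRD.
have h z : 0 < z -> 0 <= 4 * pi * z by move=> z0; rewrite !mulr_ge0 ?pi_ge0// ltW.
rewrite -!powRM ?h//.
congr (_ `^ _ * expR _); first by field; rewrite gt_eqF.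
by field; rewrite !gt_eqF.
Qed.

Lemma integral_heat d t (x : d.-tuple R) : 0 < t ->
  (\int[leb R d]_y (heat d t (sqdist x y))%:E = 1)%E.
Proof.
move=> t0; elim: d x => [|d IH] x.
  rewrite integral_dirac//= ?diracT ?mul1e.
    by rewrite /sqdist big_ord0 heat0.
  by apply/measurable_EFinP; meas'.
rewrite ge0_integral_leb_succ; [|by meas'|by move=> y; nonneg'].
rewrite -(tunconsK x); case: (tuncons x) => a w.
transitivity (\int[ell]_b (heat 1 t ((a - b) ^+ 2) * 1)%:E)%E; last first.
  by under eq_integral do rewrite mulr1; exact: integral_heat1.
apply: eq_integral => b _; rewrite EFinM -(IH w).
rewrite -ge0_integralZ; [|by nonneg'|by meas'|by move=> z; nonneg'].
by apply: eq_integral => z _; rewrite sqdist_cons heatD.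
Qed.

(** The semigroup law, by induction on the coordinates: in each one the factor depending on [y]
    integrates to 1. *)
Lemma heat_convolution d t s (x : d.-tuple R) : 0 < t -> 0 < s ->
  (\int[leb R d]_y (heat d t (sqdist x y) * heat d s (sqnorm y))%:E =
   (heat d (t + s) (sqnorm x))%:E)%E.
Proof.
move=> t0 s0; have ts0 : 0 < t + s by rewrite addr_gt0.
elim: d x => [|d IH] x.
  rewrite integral_dirac//= ?diracT ?mul1e.
    by rewrite /sqdist /sqnorm !big_ord0 !heat0// mulr1.
  by apply/measurable_EFinP; meas'.
rewrite ge0_integral_leb_succ; [|by meas'|by move=> y; nonneg'].
rewrite -(tunconsK x); case: (tuncons x) => a w.
transitivity (\int[ell]_b (heat d (t + s) (sqnorm w) * heat 1 (t + s) (a ^+ 2) *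
    (heat 1 (t * s / (t + s)) ((s * a / (t + s) - b) ^+ 2)))%:E)%E; last first.
  rewrite ge0_integralZ; [|by nonneg'|by meas'|by move=> z; nonneg'].
  rewrite integral_heat1 ?divr_gt0 ?mulr_gt0// mule1 sqnorm_cons heatD//.
  by rewrite mulrC.
apply: eq_integral => b _.
rewrite -mulrA -heat1_mul// mulrC EFinM -(IH w).
rewrite -ge0_integralZ; [|by nonneg'|by meas'|by move=> z; nonneg'].
apply: eq_integral => z _; rewrite sqdist_cons sqnorm_cons !heatD//.
by congr EFin; ring.
Qed.

(** Negative [p] is included: [p = b] and [p = b - a] give Riesz kernels [|x|^(2p-d)], and [p = -a]
    gives the stable jump kernel [|x|^(-d-2a)]. *)
Lemma integral_tpow_heat d p r : p < d%:R / 2 -> 0 < r ->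
  (\int[ell]_t (tpow 0 p t * heat d t r)%:E =
   ((4 * pi) `^ (- (d%:R / 2)) * ((r / 4) `^ (- (d%:R / 2 - p)) *
     Gamma (d%:R / 2 - p)))%:E)%E.
Proof.
move=> pd r0; rewrite EFinM -integral_heat_power ?subr_gt0 ?divr_gt0//.
rewrite -ge0_integralZ; [|by nonneg'|by meas'|by move=> z; nonneg'].
apply: eq_integral => t _; congr EFin; rewrite !tpowE /heat.
have [t0|t0] := ltP 0 t; last by rewrite !mul0r mulr0.
rewrite powRM ?mulr_ge0 ?pi_ge0 ?ltW//.
rewrite (_ : - (d%:R / 2 - p) - 1 = (p - 1) - d%:R / 2); last by ring.
by rewrite [X in _ = _ * (X * _)]gt0_powRD//; ring.
Qed.

End heat_kernel.

(** * The Hardy inequality *)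

Section ground_state.
Context {d} {T : measurableType d} {R : realType}.
Variable mu : {sigma_finite_measure set T -> \bar R}.

(* For [h x, h y > 0] one has
   [u x ^ 2 + u y ^ 2 <= (u x - u y) ^ 2 + u x ^ 2 * h y / h x + u y ^ 2 * h x / h y];
   this is integrated against the kernel [k]. *)
Lemma ground_state (k : T -> T -> R) (h u : T -> R) (Q : T -> \bar R) (m : R) :
  measurable_fun setT (fun z : T * T => k z.1 z.2) ->
  (forall x y, 0 <= k x y) -> (forall x y, k x y = k y x) ->
  measurable_fun setT h -> (forall x, 0 < h x) ->
  measurable_fun setT Q -> (forall x, 0 <= Q x)%E -> 0 <= m ->
  (forall x, \int[mu]_y (k x y)%:E = m%:E)%E ->
  {ae mu, forall x, (\int[mu]_y (k x y * h y)%:E + Q x <= (m * h x)%:E)%E} ->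
  measurable_fun setT u -> (\int[mu]_x (u x ^+ 2)%:E < +oo)%E ->
  (2%:E * \int[mu]_x ((u x ^+ 2 / h x)%:E * Q x) <=
   \int[mu]_x \int[mu]_y (k x y * (u x - u y) ^+ 2)%:E)%E.
Proof.
move=> mk k0 kC mh h0 mQ Q0 m0 km kh mu' u2.
have hV x : 0 <= (h x)^-1 by rewrite invr_ge0 ltW.
have h0' x : 0 <= h x by exact: ltW.
have w0 x : 0 <= u x ^+ 2 / h x by nonneg.
have mw : measurable_fun setT (fun x => u x ^+ 2 / h x) by meas.
have c1 (f : T -> R) : measurable_fun setT f ->
    measurable_fun setT (fun z : T * T => f z.1).
  by move=> mf; exact: measurableT_comp.
have c2 (f : T -> R) : measurable_fun setT f ->
    measurable_fun setT (fun z : T * T => f z.2).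
  by move=> mf; exact: measurableT_comp.
have mu1 := c1 _ mu'; have mu2 := c2 _ mu'.
have mh1 := c1 _ mh; have mh2 := c2 _ mh.
have mkx x : measurable_fun setT (k x).
  exact: (measurableT_comp mk (measurable_pair1 x)).
pose A := (\int[mu]_x \int[mu]_y (k x y * (u x - u y) ^+ 2)%:E)%E.
pose P := (\int[mu]_x \int[mu]_y (k x y * (u x ^+ 2 / h x * h y))%:E)%E.
pose U := (\int[mu]_x (u x ^+ 2)%:E)%E.
pose W := (\int[mu]_x ((u x ^+ 2 / h x)%:E * Q x))%E.
have PE : (\int[mu]_x \int[mu]_y (k x y * (u y ^+ 2 / h y * h x))%:E = P)%E.
  rewrite /P tonelliC.
  - by apply: eq_integral => x _; apply: eq_integral => y _; rewrite kC.
  - by meas.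
  - by move=> x y; nonneg.
have UE : (\int[mu]_x \int[mu]_y (k x y * u x ^+ 2)%:E = m%:E * U)%E.
  clear kh; rewrite /U -ge0_integralZ; [|exact: m0|by meas|by move=> x; nonneg].
  apply: eq_integral => x _; under eq_integral do rewrite mulrC.
  rewrite ge0_integralZ; [by rewrite km mulrC|exact: sqr_ge0|exact: mkx|by []].
have UE' : (\int[mu]_x \int[mu]_y (k x y * u y ^+ 2)%:E = m%:E * U)%E.
  rewrite -UE tonelliC.
  - by apply: eq_integral => x _; apply: eq_integral => y _; rewrite kC.
  - by meas.
  - by move=> x y; nonneg.
(* All terms are kept on the side where they are nonnegative, because [A] may be infinite; nothing
   is subtracted before the end. *)
have main : (m%:E * U + m%:E * U <= A + (P + P))%E.
  rewrite -{1}UE -UE' -{2}PE /A /P.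
  clear A P U W PE UE UE' km kh.
  rewrite -!integral_prodE; do ?[by meas|by move=> x y; nonneg].
  rewrite -!ge0_integralDr; do ?[by meas|by move=> x; nonneg].
  apply: le_integral_real; [by meas|by meas|].
  move=> z; apply/andP; split; first by nonneg.
  rewrite -!mulrDr ler_wpM2l//.
  have hx := h0 z.1; have hy := h0 z.2.
  rewrite -subr_ge0.
  (* The defect in the pointwise inequality is this square, that is [h x * h y] times the squared
     increment of [u / h]. *)
  rewrite [leRHS](_ : _ = (u z.1 * h z.2 - u z.2 * h z.1) ^+ 2 / (h z.1 * h z.2)).
    by rewrite divr_ge0 ?sqr_ge0// mulr_ge0.
  by field; rewrite !gt_eqF.
have PW : (P + W <= m%:E * U)%E.
  clear A PE UE UE' main km kC.
  rewrite /P /W /U -ge0_integralZ; [|exact: m0|by meas|by move=> x; nonneg].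
  clear P W U.
  have mkh : measurable_fun setT (fun z : T * T => k z.1 z.2 * h z.2) by meas.
  have I0 x : (0 <= \int[mu]_y (k x y * h y)%:E)%E.
    by apply: integral_real_ge0 => y; nonneg.
  rewrite (_ : (\int[mu]_x \int[mu]_y _)%E = (\int[mu]_x
      ((u x ^+ 2 / h x)%:E * \int[mu]_y (k x y * h y)%:E))%E); last first.
    apply: eq_integral => x _.
    rewrite -ge0_integralZ; [|exact: w0|by meas|by move=> y; nonneg].
    by apply: eq_integral => y _; congr EFin; ring.
  have mI : measurable_fun setT (fun x => \int[mu]_y (k x y * h y)%:E)%E.
    by apply: (measurable_integral_r mu (fun x y => k x y * h y)) => // x y; nonneg.
  have mw' : measurable_fun setT (fun x => (u x ^+ 2 / h x)%:E) by exact/measurable_EFinP.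
  rewrite -ge0_integralD; [|by []| | | |]; last 4 first.
  - by move=> x _; rewrite mule_ge0// lee_fin.
  - exact: emeasurable_funM.
  - by move=> x _; rewrite mule_ge0// lee_fin.
  - exact: emeasurable_funM.
  apply: ae_ge0_le_integral; first exact: measurableT.
  - by move=> x _; rewrite adde_ge0// mule_ge0// lee_fin.
  - by apply: emeasurable_funD; exact: emeasurable_funM.
  - by move=> x _; rewrite lee_fin; nonneg.
  - by apply/measurable_EFinP; meas.
  - apply: filterS kh => x xh _.
    rewrite -ge0_muleDr//.
    have -> : m * u x ^+ 2 = u x ^+ 2 / h x * (m * h x) by field; rewrite gt_eqF.
    by rewrite [leRHS]EFinM lee_wpmul2l// lee_fin.
have U0 : (0 <= U)%E by apply: integral_real_ge0 => x; nonneg.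
(* Finiteness of [U] passes to [P] and [W] through [PW], so [P] may be cancelled; an infinite [A]
   makes the claim trivial. *)
have [v Uv] : exists v, U = v%:E.
  by exists (fine U); rewrite fineK// ge0_fin_numE.
have P0 : (0 <= P)%E.
  by apply: integral_ge0 => x _; apply: integral_real_ge0 => y; nonneg.
have W0 : (0 <= W)%E.
  by apply: integral_ge0 => x _; rewrite mule_ge0// lee_fin.
have A0 : (0 <= A)%E.
  by apply: integral_ge0 => x _; apply: integral_real_ge0 => y; nonneg.
rewrite -/A -/W; move: main PW P0 W0 A0; rewrite Uv -EFinM.
move: (A) (P) (W) => a' p' w'; clear.
case: p' => [p| |]//; case: w' => [w| |]//; case: a' => [a| |] //=.
- rewrite -!EFinD -EFinM !lee_fin => *; lra.
- by move=> *; rewrite leey.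
Qed.

End ground_state.

Lemma sqnorm_eq0_null {R : realType} (d : nat) : (0 < d)%N ->
  leb R d [set x | sqnorm x = 0] = 0%E.
Proof.
case: d => // d _.
rewrite (_ : [set x | _] = [set x | forall i, [set 0] (tnth x i)]).
  rewrite (@leb_box R d.+1 (fun=> [set 0]))// big_ord_recl.
  by rewrite lebesgue_measure_set1 mul0e.
apply/seteqP; split => x /= x0.
  move=> i; apply/eqP; rewrite -sqrf_eq0.
  move/eqP: x0; rewrite psumr_eq0; last by move=> j _; exact: sqr_ge0.
  by move=> /allP; apply; rewrite mem_index_enum.
by rewrite /sqnorm big1// => i _; rewrite x0 expr0n.
Qed.

Lemma ae_sqnorm_gt0 {R : realType} (d : nat) : (0 < d)%N ->
  {ae leb R d, forall x, 0 < sqnorm x}.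
Proof.
move=> d0; exists [set x | sqnorm x = 0]; split.
- rewrite -[X in measurable X]setTI.
  have mf : measurable_fun setT (@sqnorm R d) by apply: measurable_comp_sqnorm; exact: measurable_id.
  exact: (mf measurableT [set 0] (measurable_set1 _)).
- exact: sqnorm_eq0_null.
- move=> x /= /negP; rewrite lt_def sqnorm_ge0 andbT negbK => /eqP.
  by [].
Qed.

(** * Supersolutions for the cut stable kernel *)

Section fractional_hardy.
Context {R : realType}.
Local Notation ell := (@lebesgue_measure R).
Variables (d : nat) (a b : R).
Hypotheses (a_gt0 : 0 < a) (a_lt1 : a < 1) (a_ltb : a < b) (b_ltd : b < d%:R / 2).

Let b_gt0 : 0 < b. Proof. exact: lt_trans a_ltb. Qed.
Let d_gt0 : (0 < d)%N.
Proof. by rewrite -(ltr_nat R); have := lt_trans b_gt0 b_ltd; lra. Qed.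
Let cH : R := (4 * pi) `^ (- (d%:R / 2)).

Let kern (e : R) (x y : d.-tuple R) : R :=
  fine (\int[ell]_t (tpow e (- a) t * heat d t (sqdist x y))%:E)%E.

(** The bound is uniform in the distance, so the cut kernel is finite on the diagonal too. *)
Lemma heat_le (e t r : R) : 0 < e -> e < t -> 0 <= r ->
  heat d t r <= (4 * pi * e) `^ (- (d%:R / 2)).
Proof.
move=> e0 et r0; have t0 : 0 < t by exact: lt_trans et.
have p4 : 0 < 4 * (pi : R) by rewrite mulr_gt0 ?pi_gt0.
rewrite /heat -[leRHS]mulr1; apply: ler_pM; [exact: powR_ge0|exact: expR_ge0| |].
  rewrite !powRN lef_pV2 ?posrE ?powR_gt0 ?mulr_gt0 ?pi_gt0//.
  apply: ge0_ler_powR; rewrite ?nnegrE ?divr_ge0 ?mulr_ge0 ?pi_ge0 ?(ltW e0) ?(ltW t0) ?pi_gt0//.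
  by rewrite ler_pM2l ?ltW ?pi_gt0.
by rewrite -[leRHS]expR0 ler_expR oppr_le0 !divr_ge0// ltW.
Qed.

Let kernE e x y : 0 < e ->
  (\int[ell]_t (tpow e (- a) t * heat d t (sqdist x y))%:E = (kern e x y)%:E)%E.
Proof.
move=> e0; rewrite /kern fineK// ge0_fin_numE; last first.
  by apply: integral_real_ge0 => t; nonneg'.
apply: (@le_lt_trans _ _ (\int[ell]_t ((4 * pi * e) `^ (- (d%:R / 2)) *
   tpow e (- a) t)%:E)%E).
  apply: le_integral_real; [by meas'|by meas'|move=> t].
  apply/andP; split; first by nonneg'.
  rewrite [leRHS]mulrC tpowE; case: ltP => et; last by rewrite !mul0r.
  by rewrite ler_wpM2l ?powR_ge0// heat_le// sqdist_ge0.
rewrite ge0_integralZ; [|by nonneg'|by meas'|by move=> t; nonneg'].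
by rewrite integral_tpow_tail// -EFinM ltry.
Qed.

Let kern_ge0 e x y : 0 <= kern e x y.
Proof. by rewrite fine_ge0//; apply: integral_real_ge0 => t; nonneg'. Qed.

Let measurable_kern e :
  measurable_fun setT (fun z : d.-tuple R * d.-tuple R => kern e z.1 z.2).
Proof.
apply: (@measurableT_comp _ _ _ _ _ _ fine) => //.
apply: (measurable_integral_r ell (fun z t => tpow e (- a) t * heat d t (sqdist z.1 z.2))).
  meas'.
    exact: measurableT_comp.
  exact: measurableT_comp.
by move=> x y; nonneg'.
Qed.

Let kernC e x y : kern e x y = kern e y x.
Proof. by rewrite /kern sqdistC. Qed.

(** The heat kernel has mass 1, so only the time weight remains. This is the constant [m] of the
    ground state inequality; it diverges as [e] tends to 0. *)
Let integral_kern e x : 0 < e ->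
  (\int[leb R d]_y (kern e x y)%:E = (e `^ (- a) / a)%:E)%E.
Proof.
move=> e0; under eq_integral do rewrite -kernE//.
rewrite tonelliC; [|by meas'|by move=> y t; nonneg'].
rewrite -integral_tpow_tail//; apply: eq_integral => t _.
rewrite ge0_integralZ; [|by nonneg'|by meas'|by move=> y; nonneg'].
rewrite tpowE; case: ltP => et; last by rewrite mul0e.
by rewrite integral_heat ?mule1// (lt_trans e0).
Qed.

(* A multiple of [|x|^(2b-d)], written so as to be positive at the origin too,
   where [ln 0 = 0]. *)
Let h (x : d.-tuple R) : R :=
  cH * (expR (- (d%:R / 2 - b) * ln (sqnorm x / 4)) * Gamma (d%:R / 2 - b)).

Let h_gt0 x : 0 < h x.
Proof.
by rewrite !mulr_gt0 ?powR_gt0 ?expR_gt0 ?Gamma_gt0 ?subr_gt0// mulr_gt0 ?pi_gt0.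
Qed.

Let mh : measurable_fun setT h.
Proof.
apply: measurable_funM; first exact: measurable_cst.
apply: measurable_funM; last exact: measurable_cst.
apply: measurable_comp_expR; apply: measurable_funM; first exact: measurable_cst.
apply: (@measurableT_comp _ _ _ _ _ _ (@ln R)); first exact: measurable_ln.
by meas'.
Qed.

Let hE x : 0 < sqnorm x ->
  h x = cH * ((sqnorm x / 4) `^ (- (d%:R / 2 - b)) * Gamma (d%:R / 2 - b)).
Proof. by move=> x0; rewrite /powR gt_eqF// divr_gt0. Qed.

Let integral_h x : 0 < sqnorm x ->
  (\int[ell]_s (tpow 0 b s * heat d s (sqnorm x))%:E = (h x)%:E)%E.
Proof. by move=> x0; rewrite hE// integral_tpow_heat. Qed.

(** The integrand of the gain [J], by which [h] is a strict supersolution: the second term of the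
    truncated Beta inequality, weighted by the heat kernel at time [s]. *)
Let F e (x : d.-tuple R) s t : R :=
  heat d s (sqnorm x) * (tpow 0 0 s * (tpow e (1 - a) t * tpow 0 b (s - t))).

Let F_ge0 e x s t : 0 <= F e x s t.
Proof. by rewrite /F; nonneg'. Qed.

Let J e (x : d.-tuple R) := (\int[ell]_s \int[ell]_t (F e x s t)%:E)%E.

Let J_ge0 e x : (0 <= J e x)%E.
Proof. by apply: integral_ge0 => s _; exact: integral_real_ge0. Qed.

Let mJ1 e : measurable_fun setT
  (fun z : d.-tuple R * R => \int[ell]_t (F e z.1 z.2 t)%:E)%E.
Proof.
apply: (measurable_integral_r ell (fun z t => F e z.1 z.2 t)) => //.
rewrite /F; meas'; do ?exact: measurableT_comp.
Qed.

Let mJ e : measurable_fun setT (J e).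
Proof.
apply: (measurable_eintegral_r ell (fun x s => \int[ell]_t (F e x s t)%:E)%E).
  exact: mJ1.
by move=> x s; exact: integral_real_ge0.
Qed.

(** By the semigroup law, applying the cut kernel to [h] gives a superposition of heat kernels whose
    density at time [s] is a truncated Beta integral. The bound for that integral is applied for
    each [s] and integrated against the heat kernel. *)
Let kern_supersolution e x : 0 < e -> 0 < sqnorm x ->
  (\int[leb R d]_y (kern e x y * h y)%:E + ((b - a) / a)%:E * J e x <=
   (e `^ (- a) / a * h x)%:E)%E.
Proof.
move=> e0 x0.
pose G (y : d.-tuple R) (t s : R) := tpow e (- a) t * heat d t (sqdist x y) *
   (tpow 0 b s * heat d s (sqnorm y)).
have mG : measurable_fun setT (fun w : d.-tuple R * R * R => G w.1.1 w.1.2 w.2).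
  have m1 : measurable_fun setT (fun w : d.-tuple R * R * R => w.1.1) by exact: measurableT_comp.
  have m2 : measurable_fun setT (fun w : d.-tuple R * R * R => w.1.2) by exact: measurableT_comp.
  by rewrite /G; meas'.
have G0 y t s : 0 <= G y t s by rewrite /G; nonneg'.
have step1 : (\int[leb R d]_y (kern e x y * h y)%:E =
    \int[leb R d]_y \int[ell]_t \int[ell]_s (G y t s)%:E)%E.
  (* The equality is only almost everywhere, because the value of [h] at the origin is conventional
     and differs from the time integral. *)
  apply: ge0_ae_eq_integral => //.
  - apply/measurable_EFinP; apply: measurable_funM => //.
    exact: (measurableT_comp (measurable_kern e) (measurable_pair1 x)).
  - exact: measurable_integral2.
  - by move=> y _; rewrite lee_fin mulr_ge0 ?kern_ge0// ltW.
  - by move=> y _; apply: integral_ge0 => t _; exact: integral_real_ge0.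
  - apply: filterS (ae_sqnorm_gt0 _ d_gt0) => y y0 _.
    rewrite EFinM -kernE// -integral_h//.
    rewrite -integral_tensor; [|by meas'|by meas'|by move=> t; nonneg'|by move=> t; nonneg'].
    by rewrite (integral_prodE ell ell (G y))//; rewrite /G; meas'.
have step2 : (\int[leb R d]_y \int[ell]_t \int[ell]_s (G y t s)%:E =
    \int[ell]_t \int[ell]_s (tpow e (- a) t * (tpow 0 b s * heat d (t + s) (sqnorm x)))%:E)%E.
  rewrite tonelliC3; [|exact: mG|exact: G0].
  apply: eq_integral => t _; apply: eq_integral => s _; rewrite /G /=.
  have [t0|t0] := ltP 0 t; last first.
    rewrite [tpow e _ t]tpowE ltNge (le_trans t0) ?ltW//= !mul0r.
    by rewrite integral0_eq// => y _; rewrite !mul0r.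
  have [s0|s0] := ltP 0 s; last first.
    rewrite [tpow 0 _ s]tpowE ltNge s0/= !mul0r mulr0.
    by rewrite integral0_eq// => y _; rewrite !mul0r !mulr0.
  rewrite mulrA EFinM -heat_convolution//.
  rewrite -ge0_integralZ; [|by nonneg'|by meas'|by move=> y; nonneg'].
  by apply: eq_integral => y _; congr EFin; ring.
have step3 : (\int[ell]_t \int[ell]_s (tpow e (- a) t * (tpow 0 b s * heat d (t + s) (sqnorm x)))%:E
   = \int[ell]_s ((heat d s (sqnorm x))%:E *
       \int[ell]_t (tpow e (- a) t * tpow 0 b (s - t))%:E))%E.
  (* The total time [t + s] becomes the new variable [s]. *)
  transitivity (\int[ell]_t \int[ell]_s (tpow e (- a) t * (tpow 0 b (s - t) * heat d s (sqnorm x)))%:E)%E.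
    apply: eq_integral => t _.
    rewrite -[RHS](ge0_integral_translate (fun s => (tpow e (- a) t * (tpow 0 b (s - t) * heat d s (sqnorm x)))%:E) t).
    - by apply: eq_integral => s _; rewrite addrK [s + t]addrC.
    - by apply/measurable_EFinP; meas'.
    - by move=> s; rewrite lee_fin; nonneg'.
  rewrite tonelliC; [|by meas'|by move=> t s; nonneg'].
  apply: eq_integral => s _.
  rewrite -ge0_integralZ; [|by nonneg'|by meas'|by move=> y; nonneg'].
  by apply: eq_integral => t _; congr EFin; ring.
have ba0 : 0 <= (b - a) / a by rewrite divr_ge0 ?subr_ge0 ?ltW.
have mI1 (p q : R) : measurable_fun setT (fun s : R => \int[ell]_t (tpow e p t * tpow 0 q (s - t))%:E)%E.
  by apply: (measurable_integral_r ell (fun s t : R => tpow e p t * tpow 0 q (s - t)));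
    [meas|move=> s t; nonneg].
have I0 (p q s : R) : (0 <= \int[ell]_t (tpow e p t * tpow 0 q (s - t))%:E)%E.
  by apply: integral_real_ge0 => t; nonneg.
have mheat : measurable_fun setT (fun s : R => (heat d s (sqnorm x))%:E).
  by apply/measurable_EFinP; meas'.
have JE : (((b - a) / a)%:E * J e x = \int[ell]_s ((heat d s (sqnorm x))%:E *
    (((b - a) / a * tpow 0 0 s)%:E * \int[ell]_t (tpow e (1 - a) t * tpow 0 b (s - t))%:E)))%E.
  rewrite -ge0_integralZl_EFin//; last 2 first.
  - by move=> s _; exact: integral_real_ge0.
  - exact: (measurableT_comp (mJ1 e) (measurable_pair1 x)).
  apply: eq_integral => s _.
  rewrite muleA -EFinM -ge0_integralZ; [|by nonneg'|by rewrite /F; meas'|by []].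
  rewrite -ge0_integralZ; [|by nonneg'|by meas'|by move=> y; nonneg'].
  by apply: eq_integral => t _; congr EFin; rewrite /F; ring.
have mI2 : measurable_fun setT (fun s : R => ((b - a) / a * tpow 0 0 s)%:E *
    \int[ell]_t (tpow e (1 - a) t * tpow 0 b (s - t))%:E)%E.
  by apply: emeasurable_funM => //; apply/measurable_EFinP; meas.
have I20 (s : R) : (0 <= ((b - a) / a * tpow 0 0 s)%:E *
    \int[ell]_t (tpow e (1 - a) t * tpow 0 b (s - t))%:E)%E.
  by rewrite mule_ge0// lee_fin; nonneg.
have h0 (s : R) : (0 <= (heat d s (sqnorm x))%:E)%E by rewrite lee_fin heat_ge0.
have mT1 := emeasurable_funM mheat (mI1 (- a) b).
have mT2 := emeasurable_funM mheat mI2.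
rewrite step1 step2 step3 JE -ge0_integralD//; last 2 first.
- by move=> s _; rewrite mule_ge0.
- by move=> s _; rewrite mule_ge0.
have ea0 : 0 <= e `^ (- a) / a by rewrite divr_ge0 ?powR_ge0 ?ltW.
rewrite EFinM -integral_h//.
rewrite -ge0_integralZ; [|by nonneg'|by meas'|by move=> y; nonneg'].
apply: ge0_le_integral => //.
- by move=> s _; rewrite adde_ge0// mule_ge0.
- exact: emeasurable_funD.
- by apply/measurable_EFinP; meas'.
move=> s _; rewrite -ge0_muleDr ?mule_ge0 ?lee_fin//; last by nonneg.
rewrite (_ : _ * (_ * _) = heat d s (sqnorm x) * (e `^ (- a) / a * tpow 0 b s)); last by ring.
by rewrite [leRHS]EFinM lee_wpmul2l//; exact: truncated_beta_le.
Qed.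

(** Without the cut the inner integral is a full Beta integral, a multiple of [s^(b-a)]. With the
    factor [1 / s] it leaves [s^(b-a-1)], hence the Riesz kernel [|x|^(2(b-a)-d)], whose ratio to
    [h] is a multiple of [|x|^(-2a)]. *)
Let J0E x : 0 < sqnorm x -> J 0 x =
  (Gamma (1 - a) * Gamma b / Gamma (1 - a + b) *
   (cH * ((sqnorm x / 4) `^ (- (d%:R / 2 - (b - a))) * Gamma (d%:R / 2 - (b - a)))))%:E.
Proof.
move=> x0.
have bda : b - a < d%:R / 2 by apply: lt_trans b_ltd; rewrite ltrBlDr ltrDl.
have B0 : 0 <= Gamma (1 - a) * Gamma b / Gamma (1 - a + b).
  by rewrite !mulr_ge0 ?invr_ge0 ?Gamma_ge0.
rewrite EFinM -integral_tpow_heat//.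
rewrite -ge0_integralZ; [|by nonneg'|by meas'|by move=> y; nonneg'].
apply: eq_integral => s _.
have p0 : 0 <= heat d s (sqnorm x) * tpow 0 0 s by nonneg'.
transitivity ((heat d s (sqnorm x) * tpow 0 0 s)%:E *
    \int[ell]_t (tpow 0 (1 - a) t * tpow 0 b (s - t))%:E)%E.
  rewrite -ge0_integralZ; [|by nonneg'|by meas'|by move=> y; nonneg'].
  by apply: eq_integral => t _; rewrite /F mulrA.
rewrite convolution_tpow ?subr_gt0// -EFinM; congr EFin.
rewrite !tpowE; case: ltP => s0; last by rewrite !mulr0 !mul0r mulr0.
rewrite (_ : b - a - 1 = (0 - 1) + (1 - a + b - 1)); last by ring.
by rewrite [in RHS]gt0_powRD//; ring.
Qed.

Let tpow_cvg (p t : R) :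
  nondecreasing_seq (fun n : nat => tpow n.+1%:R^-1 p t) /\
  tpow n.+1%:R^-1 p t @[n --> \oo] --> tpow 0 p t.
Proof.
split.
  move=> m n mn; rewrite !tpowE; case: ltP => h1; last by case: ifP; rewrite ?powR_ge0.
  by rewrite ifT// (le_lt_trans _ h1)// lef_pV2 ?posrE// ler_nat.
have [t0|t0] := ltP 0 t; last first.
  rewrite (_ : (fun _ => _) = fun=> tpow 0 p t); first exact: cvg_cst.
  by apply/funext => n; rewrite !tpowE !ifF//; apply/negbTE;
    rewrite -leNgt// (le_trans t0).
apply: cvg_near_cst; near=> n; rewrite !tpowE t0 ifT//.
by near: n; exact: (near_infty_natSinv_lt (PosNum t0)).
Unshelve. all: by end_near. Qed.

Let J_cvg x : nondecreasing_seq (fun n : nat => J n.+1%:R^-1 x) /\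
  J n.+1%:R^-1 x @[n --> \oo] --> J 0 x.
Proof.
have inner s : nondecreasing_seq (fun n : nat => \int[ell]_t (F n.+1%:R^-1 x s t)%:E)%E /\
    (\int[ell]_t (F n.+1%:R^-1 x s t)%:E)%E @[n --> \oo] --> (\int[ell]_t (F 0 x s t)%:E)%E.
  apply: cvg_integral_nondecreasing.
  - by move=> n; apply/measurable_EFinP; rewrite /F; meas'.
  - by move=> n t; rewrite lee_fin.
  - move=> t m n mn; rewrite lee_fin /F.
    rewrite ler_wpM2l ?heat_ge0// ler_wpM2l ?tpow_ge0// ler_wpM2r ?tpow_ge0//.
    exact: (tpow_cvg _ _).1.
  - move=> t; apply: cvg_EFin; first exact: nearW.
    apply: cvgM; first exact: cvg_cst.
    apply: cvgM; first exact: cvg_cst.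
    apply: cvgM; last exact: cvg_cst.
    exact: (tpow_cvg _ _).2.
apply: cvg_integral_nondecreasing.
- by move=> n; exact: (measurableT_comp (mJ1 _) (measurable_pair1 x)).
- by move=> n s; exact: integral_real_ge0.
- by move=> s; exact: (inner s).1.
- by move=> s; exact: (inner s).2.
Qed.

(** The constant is [2 (b-a) / a] times the constant in [J 0 / h]; the 2 comes from the ground state
    inequality. *)
Lemma fractional_hardy (u : d.-tuple R -> R) :
  measurable_fun setT u -> (\int[leb R d]_x (u x ^+ 2)%:E < +oo)%E ->
  ((2 * (Gamma (1 - a) * Gamma b / (a * Gamma (b - a)) *
      (Gamma (d%:R / 2 - (b - a)) / Gamma (d%:R / 2 - b))))%:E *
    \int[leb R d]_x (u x ^+ 2 * (sqnorm x / 4) `^ (- a))%:E <=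
   \int[leb R d]_x \int[leb R d]_y
     ((4 * pi) `^ (- (d%:R / 2)) * Gamma (d%:R / 2 + a) *
      ((sqdist x y / 4) `^ (- (d%:R / 2 + a)) * (u x - u y) ^+ 2))%:E)%E.
Proof.
move=> mu u2; set E := (X in (_ <= X)%E).
have ba0 : 0 <= (b - a) / a by rewrite divr_ge0 ?subr_ge0 ?ltW.
have hV x : 0 <= (h x)^-1 by rewrite invr_ge0 ltW.
have w0 x : 0 <= u x ^+ 2 / h x by nonneg'.
have mw : measurable_fun setT (fun x => (u x ^+ 2 / h x)%:E).
  by apply/measurable_EFinP; meas'.
have kd0 : 0 <= (4 * pi) `^ (- (d%:R / 2)) * Gamma (d%:R / 2 + a).
  by rewrite mulr_ge0 ?powR_ge0 ?Gamma_ge0.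
have mu1 : measurable_fun setT (fun z : d.-tuple R * d.-tuple R => u z.1) by exact: measurableT_comp.
have mu2 : measurable_fun setT (fun z : d.-tuple R * d.-tuple R => u z.2) by exact: measurableT_comp.
(* On the diagonal the full kernel takes a conventional value, but there the increment vanishes. *)
have kern_le e x y : 0 < e -> kern e x y * (u x - u y) ^+ 2 <=
    (4 * pi) `^ (- (d%:R / 2)) * Gamma (d%:R / 2 + a) *
      ((sqdist x y / 4) `^ (- (d%:R / 2 + a)) * (u x - u y) ^+ 2).
  move=> e0; have [->|xy] := eqVneq x y; first by rewrite subrr expr0n/= !mulr0.
  rewrite mulrA ler_wpM2r ?sqr_ge0//.
  have nad : - a < d%:R / 2 by rewrite (lt_trans _ b_ltd)// (lt_trans _ b_gt0)// oppr_lt0.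
  have := integral_tpow_heat _ _ _ nad (sqdist_gt0 _ _ _ xy); rewrite opprK => /esym eq.
  rewrite -mulrA [Gamma _ * _]mulrC -lee_fin eq -kernE//.
  apply: le_integral_real; [by meas'|by meas'|move=> t].
  apply/andP; split; first by nonneg'.
  rewrite ler_wpM2r ?heat_ge0// !tpowE; case: ltP => et; first by rewrite (lt_trans e0).
  by case: ifP => // _; exact: powR_ge0.
have step e : 0 < e ->
   (2%:E * \int[leb R d]_x ((u x ^+ 2 / h x)%:E * (((b - a) / a)%:E * J e x)) <= E)%E.
  move=> e0.
  apply: (@le_trans _ _ (\int[leb R d]_x \int[leb R d]_y
     (kern e x y * (u x - u y) ^+ 2)%:E)%E).
    apply: (@ground_state _ _ _ (leb R d) (kern e) h u _ (e `^ (- a) / a)).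
    - exact: measurable_kern.
    - exact: kern_ge0.
    - exact: kernC.
    - exact: mh.
    - exact: h_gt0.
    - by apply: emeasurable_funM => //; exact: mJ.
    - by move=> x; rewrite mule_ge0// lee_fin.
    - by rewrite divr_ge0 ?powR_ge0// ltW.
    - by move=> x; exact: integral_kern.
    - by apply: filterS (ae_sqnorm_gt0 _ d_gt0) => x x0; exact: kern_supersolution.
    - exact: mu.
    - exact: u2.
  have mk := measurable_kern e.
  have md : measurable_fun setT (fun z : d.-tuple R * d.-tuple R => sqdist z.1 z.2).
    by meas'.
  rewrite /E -!integral_prodE; [|by meas'| |by meas'|].
  - apply: le_integral_real; [by meas'|by meas'|move=> z].
    by rewrite kern_le// mulr_ge0 ?kern_ge0 ?sqr_ge0.
  - by move=> x y; nonneg'.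
  - by move=> x y; rewrite mulr_ge0 ?kern_ge0 ?sqr_ge0.
(* The bound [E] does not depend on [e], so monotone convergence is applied to the left side
   alone. *)
have lim : (2%:E * \int[leb R d]_x ((u x ^+ 2 / h x)%:E * (((b - a) / a)%:E * J 0 x)) <= E)%E.
  have [_ cv] : nondecreasing_seq (fun n => \int[leb R d]_x ((u x ^+ 2 / h x)%:E *
        (((b - a) / a)%:E * J n.+1%:R^-1 x)))%E /\
      (\int[leb R d]_x ((u x ^+ 2 / h x)%:E * (((b - a) / a)%:E * J n.+1%:R^-1 x))
        @[n --> \oo] -->
      \int[leb R d]_x ((u x ^+ 2 / h x)%:E * (((b - a) / a)%:E * J 0 x)))%E.
    apply: cvg_integral_nondecreasing.
    - move=> n; apply: emeasurable_funM => //.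
      by apply: emeasurable_funM => //; exact: mJ.
    - by move=> n x; rewrite mule_ge0 ?lee_fin// mule_ge0// lee_fin.
    - move=> x m n mn; apply: lee_wpmul2l; first by rewrite lee_fin.
      apply: lee_wpmul2l; first by rewrite lee_fin.
      exact: ((J_cvg x).1 m n mn).
    - by move=> x; apply: cvgeZl => //; apply: cvgeZl => //; exact: (J_cvg x).2.
  apply: (cvge_le _ (cvgeZl (y := 2%:E) isT cv)).
  by apply: nearW => n; apply: step; rewrite invr_gt0.
set c := Gamma (1 - a) * Gamma b / (a * Gamma (b - a)) *
  (Gamma (d%:R / 2 - (b - a)) / Gamma (d%:R / 2 - b)).
have G1 : 0 < Gamma (1 - a) by rewrite Gamma_gt0 ?subr_gt0.
have G2 : 0 < Gamma b by rewrite Gamma_gt0.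
have G3 : 0 < Gamma (b - a) by rewrite Gamma_gt0 ?subr_gt0.
have G4 : 0 < Gamma (d%:R / 2 - b) by rewrite Gamma_gt0 ?subr_gt0.
have c0 : 0 <= c by rewrite !mulr_ge0 ?invr_ge0 ?mulr_ge0 ?Gamma_ge0// ltW.
apply: le_trans lim; rewrite EFinM -muleA lee_wpmul2l ?lee_fin//.
rewrite -ge0_integralZ//; [|by meas'|by move=> x; nonneg'].
rewrite (@ge0_ae_eq_integral _ _ _ (leb R d) setT
  (fun x => (c * (u x ^+ 2 * (sqnorm x / 4) `^ (- a)))%:E)
  (fun x => (u x ^+ 2 / h x)%:E * (((b - a) / a)%:E * J 0 x))%E)//.
- by apply/measurable_EFinP; meas'.
- by apply: emeasurable_funM => //; apply: emeasurable_funM => //; exact: mJ.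
- by move=> x _; rewrite lee_fin; nonneg'.
- by move=> x _; rewrite mule_ge0 ?lee_fin// mule_ge0// lee_fin.
- apply: filterS (ae_sqnorm_gt0 _ d_gt0) => x x0 _.
  rewrite J0E// -!EFinM hE//; congr EFin.
  have q0 : 0 < sqnorm x / 4 by rewrite divr_gt0.
  have cH0 : 0 < cH by rewrite powR_gt0// mulr_gt0// pi_gt0.
  have p0 : 0 < (sqnorm x / 4) `^ (- (d%:R / 2 - b)) by rewrite powR_gt0.
  (* The recurrence of Gamma cancels the [b - a] of the prefactor. *)
  rewrite (_ : 1 - a + b = (b - a) + 1); last by ring.
  rewrite GammaS ?subr_gt0//.
  rewrite (_ : - (d%:R / 2 - (b - a)) = - a + - (d%:R / 2 - b)); last by ring.
  rewrite [in RHS]gt0_powRD// /c.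
  have ba : 0 < b - a by rewrite subr_gt0.
  move: (Gamma (1 - a)) (Gamma b) (Gamma (b - a)) (Gamma (d%:R / 2 - b))
    (Gamma (d%:R / 2 - (b - a))) (_ `^ (- a)) (_ `^ _) cH G3 G4 p0 cH0 ba a_gt0.
  move: (b - a) (u x) => c' v g1 g2 g3 g4 g5 q p k *.
  by field; rewrite !gt_eqF.
Qed.

End fractional_hardy.

(** * Integration against a density *)

Section integral_density.
Context {dd : measure_display} {T : measurableType dd} {R : realType}.
Variables (mu : {measure set T -> \bar R}) (f : T -> \bar R).
Hypotheses (mf : measurable_fun setT f) (f0 : forall x, (0 <= f x)%E).
Local Open Scope ereal_scope.

Import HBNNSimple.

Let integral_density_indicM (r : R) (A : set T) : (0 <= r)%R -> measurable A ->
  \int[mu]_x ((r * \1_A x)%:E * f x) = r%:E * density mu mf f0 A.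
Proof.
move=> r0 mA; rewrite /density [in RHS]integral_mkcond -ge0_integralZl//.
- apply: eq_integral => x _; rewrite patchE EFinM -muleA indicE.
  by case: ifP => _; rewrite ?mul1e ?mul0e.
- exact/(measurable_restrictT _ mA)/measurable_funTS.
- by move=> x _; rewrite patchE; case: ifP.
Qed.

Let integral_density_nnsfun (h : {nnsfun T >-> R}) :
  \int[density mu mf f0]_x (h x)%:E = \int[mu]_x ((h x)%:E * f x).
Proof.
under [LHS]eq_integral do rewrite fimfunE -fsumEFin//.
rewrite [LHS]ge0_integral_fsum//; last 2 first.
  - by move=> r; exact/measurable_EFinP/measurableT_comp.
  - by move=> n x _; rewrite EFinM nnfun_muleindic_ge0.
under [RHS]eq_integral.
  move=> x _; rewrite fimfunE -fsumEFin// ge0_mule_fsuml; last first.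
    by move=> r; rewrite EFinM nnfun_muleindic_ge0.
  over.
rewrite [RHS]ge0_integral_fsum//; last 2 first.
  - move=> r; apply: emeasurable_funM => //.
    exact/measurable_EFinP/measurableT_comp.
  - by move=> n x _; rewrite mule_ge0// EFinM nnfun_muleindic_ge0.
apply: eq_fsbigr => r /set_mem [y _ <-].
rewrite integral_density_indicM//.
rewrite integralZl_indic_nnsfun//= integral_indic// ?setIT//.
Qed.

Lemma ge0_integral_density (g : T -> \bar R) : measurable_fun setT g ->
  (forall x, 0 <= g x) ->
  \int[density mu mf f0]_x g x = \int[mu]_x (g x * f x).
Proof.
move=> mg g0; pose g_ := nnsfun_approx measurableT mg.
have gg x : (g_ n x)%:E @[n --> \oo] --> g x.
  by apply: cvg_nnsfun_approx => // y _; exact: g0.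
have nd x : nondecreasing_seq (fun n => (g_ n x)%:E).
  by move=> m n mn; rewrite lee_fin; exact/lefP/nd_nnsfun_approx.
have [_ c1] : nondecreasing_seq (fun n => \int[density mu mf f0]_x (g_ n x)%:E) /\ (\int[density mu mf f0]_x (g_ n x)%:E @[n --> \oo] -->
    \int[density mu mf f0]_x g x).
  apply: (cvg_integral_nondecreasing (density mu mf f0) (fun n x => (g_ n x)%:E)) => //.
  - by move=> n; exact/measurable_EFinP.
  - by move=> n x; rewrite lee_fin.
have [_ c2] : nondecreasing_seq (fun n => \int[mu]_x ((g_ n x)%:E * f x)) /\ (\int[mu]_x ((g_ n x)%:E * f x) @[n --> \oo] -->
    \int[mu]_x (g x * f x)).
  apply: (cvg_integral_nondecreasing mu (fun n x => (g_ n x)%:E * f x)).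
  - by move=> n; apply: emeasurable_funM => //; exact/measurable_EFinP.
  - by move=> n x; rewrite mule_ge0// lee_fin.
  - by move=> x m n mn; rewrite lee_wpmul2r//; exact: (nd x m n mn).
  - move=> x; case: (f x) (f0 x) => [r r0| _|//].
      under eq_fun do rewrite muleC.
      by rewrite muleC; exact: cvgeZl.
    (* Where [f x = +oo], multiplication by [f x] is not continuous at 0. The products are
       nevertheless eventually constant: 0 if [g x = 0], and [+oo] once an approximation is
       positive. *)
    have gsup : g x = ereal_sup (range (fun n => (g_ n x)%:E)).
      apply: (cvg_unique _ (gg x)) => //; apply: ereal_nondecreasing_cvgn; exact: nd.
    have gle n : (g_ n x)%:E <= g x.
      by rewrite gsup; apply: ereal_sup_ubound; exists n.
    have [gx0|gx0] := eqVneq (g x) 0.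
      apply: cvg_near_cst; apply: nearW => n.
      suff -> : g_ n x = 0%R by rewrite gx0.
      by have := gle n; rewrite gx0 lee_fin => h; apply/eqP; rewrite eq_le h/=.
    have [N gN] : exists N, 0 < (g_ N x)%:E.
      apply: contrapT => /forallNP h; move/negP: gx0; apply.
      rewrite eq_le g0 andbT gsup; apply: ge_ereal_sup => _ [n _ <-].
      by rewrite leNgt; exact/negP.
    apply: cvg_near_cst; exists N => // n /= Nn.
    by rewrite !gt0_muley//; [rewrite lt_def gx0 g0|apply: lt_le_trans gN _; exact: nd].
apply: (cvg_unique _ c1) => //.
have E n : \int[mu]_x ((g_ n x)%:E * f x) = \int[density mu mf f0]_x (g_ n x)%:E.
  exact/esym/integral_density_nnsfun.
by move: c2; rewrite (eq_cvg _ _ E).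
Qed.

End integral_density.

(** * The Hardy inequality for the stable form *)

Section hardy_stable.
Context {R : realType} {d : nat}.
Implicit Types (alpha delta : R) (u : d.-tuple R -> R).
Local Notation L := (leb R d).

Definition stable_weight alpha (z : d.-tuple R * d.-tuple R) : R :=
  (eucl_dist z.1 z.2 `^ (d%:R + alpha))^-1.

Lemma stable_weight_ge0 alpha z : 0 <= stable_weight alpha z.
Proof. by rewrite invr_ge0 powR_ge0. Qed.

Lemma measurable_stable_weight alpha : measurable_fun setT (stable_weight alpha).
Proof.
apply: measurable_comp_inv; apply: measurable_comp_powR.
apply: (@measurableT_comp _ _ _ _ _ _ (@Num.sqrt R) _ (fun z => sqdist z.1 z.2)).
  by apply: continuous_measurable_fun; exact: sqrt_continuous.
by apply: measurable_comp_sqdist; [exact: measurable_fst|exact: measurable_snd].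
Qed.

Definition incr u (z : d.-tuple R * d.-tuple R) : R := u z.1 - u z.2.

Lemma measurable_incr u : measurable_fun setT u -> measurable_fun setT (incr u).
Proof. by move=> mu; apply: measurable_funB; exact: measurableT_comp. Qed.

(* The diagonal may be included because the increment vanishes there. *)
Lemma stable_energyE alpha u : stable_energy alpha u =
  (\int[L \x L]_z (stable_weight alpha z * incr u z ^+ 2)%:E)%E.
Proof.
rewrite /stable_energy integral_mkcond; apply: eq_integral => -[x y] _.
rewrite patchE /stable_weight /incr; case: ifPn => /= [_|]; first by rewrite mulrC.
move/negP => h; have -> : x = y.
  by apply/eqP; apply: contrapT => /negP xy; apply: h; rewrite inE.
by rewrite subrr expr0n/= mulr0.
Qed.

Lemma sqrt_powR (x p : R) : 0 <= x -> Num.sqrt x `^ (2 * p) = x `^ p.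
Proof.
move=> x0; rewrite -powR12_sqrt// -powRrM; congr powR.
by rewrite mulrA mulVf ?mul1r.
Qed.

(** The case [a = alpha / 2], [b = (d - delta) / 2] of the fractional inequality, for which [h] is a
    multiple of [|x|^(-delta)]. The range of [delta] makes every Gamma argument positive. *)
Lemma hardy_kappa alpha delta u : 0 < alpha -> alpha < 2 ->
  0 < delta -> delta < d%:R - alpha ->
  measurable_fun setT u -> (\int[L]_x (u x ^+ 2)%:E < +oo)%E ->
  ((2 `^ (d%:R - alpha) * kappa d alpha delta)%:E *
     \int[L]_x (u x ^+ 2 * eucl_norm x `^ (- alpha))%:E <=
   (2^-1 * stable_const d alpha)%:E * stable_energy alpha u)%E.
Proof.
move=> a0 a2 d0 dd mu u2.
have ha : 0 < alpha / 2 by rewrite divr_gt0.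
have hd : 0 < delta / 2 by rewrite divr_gt0.
have hda : 0 < (d%:R - delta - alpha) / 2 by rewrite divr_gt0//; lra.
have ha1 : alpha / 2 < 1 by rewrite ltr_pdivrMr// mul1r.
have hab : alpha / 2 < (d%:R - delta) / 2 by rewrite ltr_pM2r//; lra.
have hbd : (d%:R - delta) / 2 < d%:R / 2 by rewrite ltr_pM2r//; lra.
have := fractional_hardy d _ _ ha ha1 hab hbd u mu u2.
have dn : (0 < d)%N by rewrite -(ltr_nat R); lra.
set G1 := Gamma (1 - alpha / 2).
have e1 : d%:R / 2 - (d%:R - delta) / 2 = delta / 2 by field.
have e2 : d%:R / 2 - ((d%:R - delta) / 2 - alpha / 2) = (delta + alpha) / 2 by field.
have e3 : (d%:R - delta) / 2 - alpha / 2 = (d%:R - delta - alpha) / 2 by field.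
have e4 : d%:R / 2 + alpha / 2 = (alpha + d%:R) / 2 by field.
rewrite e1 e2 e3 e4.
have G1p : 0 < G1 by rewrite Gamma_gt0; lra.
have G2p : 0 < Gamma (delta / 2) by rewrite Gamma_gt0; lra.
have G3p : 0 < Gamma ((d%:R - delta - alpha) / 2) by rewrite Gamma_gt0; lra.
have pp : 0 < (pi : R) by exact: pi_gt0.
have four p : (4 : R) `^ p = 2 `^ (2 * p).
  by rewrite powRrM powR_mulrn// -natrX.
have mw := measurable_stable_weight alpha.
have min := measurable_incr u mu.
have mnorm : measurable_fun setT (@eucl_norm R d) by exact: measurable_eucl_norm.
rewrite (_ : (\int[L]_x \int[L]_y _)%E = (pi `^ (- (d%:R / 2)) * 2 `^ alpha *
   Gamma ((alpha + d%:R) / 2))%:E * stable_energy alpha u)%E; last first.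
  rewrite stable_energyE.
  rewrite -[RHS]ge0_integralZ; last 3 first.
  - by rewrite !mulr_ge0 ?powR_ge0 ?Gamma_ge0.
  - by apply: measurable_funM => //; exact: measurable_funX.
  - by move=> z; rewrite mulr_ge0 ?stable_weight_ge0 ?sqr_ge0.
  rewrite fubini_tonelli1; last 2 first.
  - apply/measurable_EFinP; apply: measurable_funM; first exact: measurable_cst.
    by apply: measurable_funM => //; exact: measurable_funX.
  - move=> z; rewrite lee_fin mulr_ge0//; first by rewrite !mulr_ge0 ?powR_ge0 ?Gamma_ge0.
    by rewrite mulr_ge0 ?stable_weight_ge0 ?sqr_ge0.
  apply: eq_integral => x _; apply: eq_integral => y _; congr EFin.
  rewrite /stable_weight /incr /= mulrA [RHS]mulrA; congr (_ * _).
  rewrite -powRN /eucl_dist -/(sqdist x y).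
  rewrite (_ : - (d%:R + alpha) = 2 * (- ((alpha + d%:R) / 2))); last by field.
  rewrite sqrt_powR ?sqdist_ge0// !powRM ?sqdist_ge0 ?invr_ge0 ?pi_ge0//.
  rewrite -[4^-1]powR_inv1// -powRrM !four.
  rewrite (_ : 2 * (-1 * - ((alpha + d%:R) / 2)) = alpha + d%:R); last by field.
  rewrite (_ : 2 * - (d%:R / 2) = - d%:R); last by field.
  rewrite (gt0_powRD _ alpha d%:R)// (powRN 2 d%:R).
  have : (2 : R) `^ d%:R != 0 by rewrite gt_eqF// powR_gt0.
  by move=> ?; field.
rewrite (_ : (\int[L]_x (u x ^+ 2 * (sqnorm x / 4) `^ _)%:E)%E =
  ((2 `^ alpha)%:E * \int[L]_x (u x ^+ 2 * eucl_norm x `^ (- alpha))%:E)%E); last first.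
  rewrite -[RHS]ge0_integralZ; last 3 first.
  - by rewrite powR_ge0.
  - apply: measurable_funM; [exact: measurable_funX|exact: measurable_comp_powR].
  - by move=> x; nonneg.
  apply: eq_integral => x _; congr EFin.
  rewrite /eucl_norm -/(sqnorm x) (_ : - alpha = 2 * (- (alpha / 2))); last by field.
  rewrite sqrt_powR ?sqnorm_ge0// powRM ?sqnorm_ge0 ?invr_ge0//.
  rewrite -[4^-1]powR_inv1// -powRrM four.
  rewrite (_ : 2 * (-1 * - (alpha / 2)) = alpha); last by field.
  by ring.
set V := (\int[L]_x _)%E; set E := stable_energy alpha u.
move: (V) (E) => {}V {}E {mw min mnorm mu u2} H.
(* Multiplying by this factor turns the kernel constant on the right into half of [stable_const];
   its power of 2 is what produces [2^(d-alpha)] in front of [kappa]. *)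
have K0 : 0 <= alpha / 2 * 2 `^ (d%:R - 1 - alpha) / G1.
  by apply: (divr_ge0 _ (ltW G1p)); apply: (mulr_ge0 (ltW ha) (powR_ge0 _ _)).
have := lee_wpmul2l (x := (alpha / 2 * 2 `^ (d%:R - 1 - alpha) / G1)%:E) K0 H.
have P2 p : 0 < (2 : R) `^ p by rewrite powR_gt0.
rewrite !muleA -!EFinM /kappa /rGamma ifF; last by apply/negbTE/lt0r_neq0/hd.
rewrite ifF; last by apply/negbTE/lt0r_neq0/hda.
rewrite (_ : d%:R - 1 - alpha = (d%:R - alpha) + (- 1)); last by ring.
rewrite gt0_powRD// powR_inv1//.
rewrite (_ : _ * (2 * _) * _ = 2 `^ (d%:R - alpha) *
  (2 `^ alpha * Gamma ((delta + alpha) / 2) * Gamma ((d%:R - delta) / 2) *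
      (Gamma (delta / 2))^-1 * (Gamma ((d%:R - delta - alpha) / 2))^-1)); last first.
  move: (Gamma (delta / 2)) (Gamma ((d%:R - delta - alpha) / 2))
    (Gamma ((delta + alpha) / 2)) (Gamma ((d%:R - delta) / 2))
    (2 `^ (d%:R - alpha)) (2 `^ alpha) (G1) G1p G2p G3p => g2 g3 g4 g5 p q g1 *.
  by field; rewrite !gt_eqF.
move=> /le_trans; apply.
rewrite [leLHS](_ : _ = (2^-1 * stable_const d alpha)%:E * E)%E //.
congr (_%:E * _)%E; rewrite /stable_const -/G1.
rewrite (_ : 2 ^+ d.-1 = 2 `^ (d%:R - alpha) * 2^-1 * 2 `^ alpha); last first.
  rewrite -powR_mulrn// -[2^-1]powR_inv1// -!gt0_powRD//; congr powR.
  by rewrite -[in RHS](prednK dn) -natr1; ring.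
rewrite powRN.
have pip : 0 < (pi : R) `^ (d%:R / 2) by rewrite powR_gt0.
move: (pi `^ _) (2 `^ (d%:R - alpha)) (2 `^ alpha) (Gamma _) (G1) pip G1p => r p q g g1 *.
by field; rewrite !gt_eqF.
Qed.

Lemma integral_mudelta alpha delta u : measurable_fun setT u ->
  (\int[mudelta alpha delta]_x (u x ^+ 2)%:E =
   (kappa d alpha delta)%:E *
   \int[L]_x (u x ^+ 2 * eucl_norm x `^ (- alpha))%:E)%E.
Proof.
move=> mu.
rewrite /mudelta ge0_integral_density; last 2 first.
- by apply/measurable_EFinP; exact: measurable_funX.
- by move=> x; rewrite lee_fin sqr_ge0.
rewrite -[RHS]ge0_integralZ; last 3 first.
- exact: kappa_ge0.
- apply: measurable_funM; first exact: measurable_funX.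
  by apply: measurable_comp_powR; exact: measurable_eucl_norm.
- by move=> x; nonneg.
apply: eq_integral => x _; rewrite /mudelta_dens -EFinM; congr EFin; ring.
Qed.

End hardy_stable.

(** * The Schroedinger form *)

Section fatou_bound.
Context {dd} {T : measurableType dd} {R : realType} (mu : {measure set T -> \bar R}).
Local Open Scope ereal_scope.

Lemma fatou_le (f : nat -> T -> \bar R) (g : T -> \bar R) (M : \bar R) :
  (forall n, measurable_fun setT (f n)) -> (forall n x, 0 <= f n x) ->
  measurable_fun setT g -> (forall x, 0 <= g x) ->
  {ae mu, forall x, f n x @[n --> \oo] --> g x} ->
  (\forall n \near \oo, \int[mu]_x f n x <= M) -> \int[mu]_x g x <= M.
Proof.
move=> mf f0 mg g0 fg fM.
have -> : \int[mu]_x g x = \int[mu]_x limn_einf (f ^~ x).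
  apply: ge0_ae_eq_integral => //.
  - apply: (emeasurable_fun_cvg (fun n x => einfs (f ^~ x) n)) => [n|x _].
      exact: measurable_fun_einfs.
    by rewrite limn_einf_lim; exact: is_cvg_einfs.
  - move=> x _; rewrite limn_einf_lim; apply: lime_ge; first exact: is_cvg_einfs.
    by apply: nearW => n; apply: le_ereal_inf_tmp => _ [m _ <-].
  - by apply: filterS fg => x /cvg_limn_einf_sup[-> _].
apply: (le_trans (fatou _ _ _ _)) => //.
rewrite limn_einf_lim; apply: lime_le; first exact: is_cvg_einfs.
apply: filterS fM => n; apply: le_trans; apply: ereal_inf_lbound.
by exists n => //=.
Qed.

End fatou_bound.

(** Transfers almost everywhere convergence of functions to their increments [u x - u y] on the
    product space. *)
Lemma ae_prod {d1 d2} {T1 : measurableType d1} {T2 : measurableType d2} {R : realType}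
  (m1 : {sigma_finite_measure set T1 -> \bar R})
  (m2 : {sigma_finite_measure set T2 -> \bar R}) (P1 : set T1) (P2 : set T2) :
  {ae m1, forall x, P1 x} -> {ae m2, forall y, P2 y} ->
  {ae (m1 \x m2)%E, forall z, P1 z.1 /\ P2 z.2}.
Proof.
move=> [N1 [mN1 N10 s1]] [N2 [mN2 N20 s2]].
exists (N1 `*` setT `|` setT `*` N2); split.
- by apply: measurableU; exact: measurableX.
- apply/eqP; rewrite -measure_le0.
  apply: (le_trans (measureU2 _ _ _)); [exact: measurableX|exact: measurableX|].
  rewrite [X in (X + _ <= _)%E](_ : _ = 0%E) ?add0e; last first.
    by transitivity (m1 N1 * m2 setT)%E; [exact: product_measure1E|rewrite N10 mul0e].
  rewrite [X in (X <= _)%E](_ : _ = 0%E)//.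
  by transitivity (m1 setT * m2 N2)%E; [exact: product_measure1E|rewrite N20 mule0].
- move=> [x y] /= /not_andP[h|h]; [left|right]; split=> //.
    exact: s1.
  exact: s2.
Qed.

(** * Square integrals and convergence in L2 *)

Section square_integrable.
Context {dd} {T : measurableType dd} {R : realType} (mu : {measure set T -> \bar R}).
Implicit Types u v : T -> R.

Lemma L2normE u : (L2norm mu u = (\int[mu]_x (u x ^+ 2)%:E) `^ 2^-1)%E.
Proof.
rewrite /L2norm unlock; congr poweR; apply: eq_integral => x _ /=.
by rewrite powR_mulrn// real_normK ?num_real.
Qed.

Lemma L2P u : L2 mu u <->
  measurable_fun setT u /\ (\int[mu]_x (u x ^+ 2)%:E < +oo)%E.
Proof.
have h : (L2norm mu u < +oo)%E <-> (\int[mu]_x (u x ^+ 2)%:E < +oo)%E.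
  rewrite L2normE; split; first exact: lty_poweRy.
  exact: poweR_lty.
rewrite /L2 /=; split.
  by rewrite inE => /andP[]; rewrite !inE/= => mu' fu; split => //; apply/h.
by move=> [mu' /h fu]; rewrite inE; apply/andP; rewrite !inE.
Qed.

Lemma L2cvgP (u_ : nat -> T -> R) u : L2cvg mu u_ u <->
  forall e : R, 0 < e ->
  \forall n \near \oo, (\int[mu]_x ((u_ n x - u x) ^+ 2)%:E <= e%:E)%E.
Proof.
have h (e : R) (A : \bar R) : 0 < e -> (0 <= A)%E ->
    (A `^ 2^-1 <= e%:E)%E <-> (A <= (e ^+ 2)%:E)%E.
  move=> e0; case: A => [r| |]//.
    rewrite lee_fin => r0; rewrite poweR_EFin !lee_fin powR12_sqrt//.
    split=> [re|re]; last by rewrite -(ger0_norm (ltW e0)) -sqrtr_sqr ler_sqrt// sqr_ge0.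
    by rewrite -(sqr_sqrtr r0) ler_sqr ?nnegrE ?sqrtr_ge0// ltW.
  by move=> _; rewrite poweRyr// !leye_eq.
have A0 n : (0 <= \int[mu]_x ((u_ n x - u x) ^+ 2)%:E)%E.
  by apply: integral_real_ge0 => x; exact: sqr_ge0.
split.
  move=> uu e e0.
  have se : 0 < Num.sqrt e by rewrite sqrtr_gt0.
  have /fine_cvgP[uf /cvgrPdist_le/(_ _ se) ue] := uu.
  near=> n.
  have fn : L2norm mu (u_ n \- u) \is a fin_num by near: n.
  have : `|0 - fine (L2norm mu (u_ n \- u))| <= Num.sqrt e by near: n.
  rewrite sub0r normrN ger0_norm; last by rewrite fine_ge0// Lnorm_ge0.
  rewrite -lee_fin fineK// L2normE => /(h _ _ se (A0 n)).
  by rewrite sqr_sqrtr// ltW.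
move=> H; apply/fine_cvgP; split.
  have := H 1 ltr01; apply: filterS => n.
  rewrite -(expr1n _ 2) => /(h _ _ ltr01 (A0 n)) l1.
  rewrite L2normE ge0_fin_numE ?poweR_ge0//; apply: le_lt_trans l1 _; exact: ltry.
apply/cvgrPdist_le => e e0; rewrite /=.
have := H _ (exprn_gt0 2 e0); apply: filterS => n /(h _ _ e0 (A0 n)).
rewrite -L2normE => l1; rewrite sub0r normrN ger0_norm; last by rewrite fine_ge0// Lnorm_ge0.
by rewrite -lee_fin fineK// ge0_fin_numE ?Lnorm_ge0// (le_lt_trans l1)// ltry.
Unshelve. all: by end_near. Qed.

Lemma integral_sqrD_le u v : measurable_fun setT u -> measurable_fun setT v ->
  (\int[mu]_x ((u x + v x) ^+ 2)%:E <=
   2%:E * \int[mu]_x (u x ^+ 2)%:E + 2%:E * \int[mu]_x (v x ^+ 2)%:E)%E.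
Proof.
move=> mu' mv.
rewrite -!ge0_integralZ//; do ?[by meas|by move=> x; nonneg].
rewrite -ge0_integralDr; do ?[by meas|by move=> x; nonneg].
apply: le_integral_real; [by meas|by meas|move=> x].
rewrite sqr_ge0/= -subr_ge0 (_ : _ - _ = (u x - v x) ^+ 2) ?sqr_ge0//; ring.
Qed.

Lemma integral_sqrZ (c : R) u : measurable_fun setT u ->
  (\int[mu]_x ((c * u x) ^+ 2)%:E = (c ^+ 2)%:E * \int[mu]_x (u x ^+ 2)%:E)%E.
Proof.
move=> mu'; rewrite -ge0_integralZ ?sqr_ge0//; [|by meas|by move=> x; nonneg].
by apply: eq_integral => x _; rewrite exprMn.
Qed.

(* Choose indices along which the squared distances are summable. *)
Lemma L2cvg_ae_subseq (u_ : nat -> T -> R) u :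
  (forall n, measurable_fun setT (u_ n)) -> measurable_fun setT u ->
  L2cvg mu u_ u -> exists phi : nat -> nat, (forall k, (k <= phi k)%N) /\
  {ae mu, forall x, u_ (phi k) x @[k --> \oo] --> u x}.
Proof.
move=> mu_ mu' /L2cvgP H.
have ex k : exists n, (k <= n)%N /\
    (\int[mu]_x ((u_ n x - u x) ^+ 2)%:E <= (1 / (2 ^ k.+1)%:R)%:E)%E.
  have e0 : 0 < 1 / (2 ^ k.+1)%:R :> R by rewrite divr_gt0// ltr0n expn_gt0.
  have [N _ HN] := H _ e0; exists (maxn k N); split; first exact: leq_maxl.
  by apply: HN; exact: leq_maxr.
have [phi phiP] := choice ex.
exists phi; split; first by move=> k; have [] := phiP k.
pose a k x := (u_ (phi k) x - u x) ^+ 2.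
have ma k : measurable_fun setT (fun x => (a k x)%:E).
  by apply/measurable_EFinP; rewrite /a; have := mu_ (phi k) => ?; meas.
have a0 k x : 0 <= a k x by exact: sqr_ge0.
have S1 : (\int[mu]_x (\sum_(k <oo) (a k x)%:E) < +oo)%E.
  rewrite integral_nneseries//; last by move=> k x _; rewrite lee_fin.
  apply: (@le_lt_trans _ _ (\sum_(k <oo) (1 / (2 ^ k.+1)%:R)%:E)%E).
    by apply: lee_nneseries => [k _ _|k _]; [exact: integral_real_ge0|have [] := phiP k].
  apply: (@le_lt_trans _ _ 1%E); last exact: ltry.
  exact: epsilon_trick0.
have S0 x : (0 <= \sum_(k <oo) (a k x)%:E)%E by apply: nneseries_ge0 => k _ _; rewrite lee_fin.
have : mu.-integrable setT (fun x => \sum_(k <oo) (a k x)%:E)%E.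
  apply/integrableP; split.
    by apply: ge0_emeasurable_sum => // k x _ _; rewrite lee_fin.
  by under eq_integral do rewrite gee0_abs//.
move=> /(integrable_ae measurableT); apply: filterS => x /(_ Logic.I) fx.
have : a k x @[k --> \oo] --> (0 : R).
  apply: cvg_series_cvg_0.
  have cs : (\sum_(0 <= i < n) (a i x)%:E)%E @[n --> \oo] --> (\sum_(k <oo) (a k x)%:E)%E.
    by apply: is_cvg_nneseries => k _ _; rewrite lee_fin.
  move: cs; rewrite -(fineK fx) => /fine_cvg cs.
  apply/cvg_ex; exists (fine (\sum_(k <oo) (a k x)%:E)%E).
  move: cs; rewrite (_ : fine \o _ = series (a ^~ x))//.
  by apply/funext => n /=; rewrite sumEFin.
move=> ax; apply/cvgrPdist_lt => e e0.
have /cvgrPdist_lt/(_ _ (exprn_gt0 2 e0)) := ax.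
apply: filterS => k; rewrite sub0r normrN ger0_norm// /a => h.
by rewrite distrC -(ltr_pXn2r (n := 2))// ?nnegrE ?normr_ge0 ?ltW// real_normK ?num_real.
Qed.

End square_integrable.

(** The infimum over [s] of the right side of the hypothesis is [(sqrt B + sqrt C)^2], approached
    near [s = sqrt C / sqrt B]. This yields a triangle inequality for forms known only on the
    diagonal. *)
Lemma sqrt_le_add {R : realType} (A B C : R) : 0 <= B -> 0 <= C ->
  (forall s, 0 < s -> A <= (1 + s) * B + (1 + s^-1) * C) ->
  Num.sqrt A <= Num.sqrt B + Num.sqrt C.
Proof.
move=> B0 C0 H; apply/ler_addgt0Pr => e e0.
(* The shifts keep the choice [s = c / b] positive and defined when [B] or [C] is 0. *)
pose b := Num.sqrt B + e / 2; pose c := Num.sqrt C + e / 2.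
have b0 : 0 < b by rewrite ltr_wpDl ?sqrtr_ge0// divr_gt0.
have c0 : 0 < c by rewrite ltr_wpDl ?sqrtr_ge0// divr_gt0.
have sq D : 0 <= D -> D <= (Num.sqrt D + e / 2) ^+ 2.
  move=> D0; rewrite -[leLHS]sqr_sqrtr//; have := sqrtr_ge0 D.
  by move: (Num.sqrt D) => q q0; rewrite ler_sqr ?nnegrE//; lra.
have bB := sq _ B0; have cC := sq _ C0.
have Abc : A <= (b + c) ^+ 2.
  apply: (le_trans (H (c / b) _)); first by rewrite divr_gt0.
  rewrite (_ : (b + c) ^+ 2 = (1 + c / b) * b ^+ 2 + (1 + (c / b)^-1) * c ^+ 2).
    by rewrite lerD// ler_wpM2l// addr_ge0// ?invr_ge0 divr_ge0 ?ltW.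
  by field; rewrite !gt_eqF.
have -> : Num.sqrt B + Num.sqrt C + e = b + c by rewrite /b /c; field.
rewrite -(ger0_norm (ltW (addr_gt0 b0 c0))) -sqrtr_sqr ler_wsqrtr//.
Qed.

(** The cross terms [2 f g] and [- 2 f g] cancel. Stated as a sum, the identity holds for infinite
    integrals too. *)
Lemma parallelogram_weighted {dd} {T : measurableType dd} {R : realType}
    (mu : {measure set T -> \bar R}) (f g : T -> R) (s : R) : 0 < s ->
  measurable_fun setT f -> measurable_fun setT g ->
  (\int[mu]_x ((f x + g x) ^+ 2)%:E +
   \int[mu]_x ((Num.sqrt s * f x - (Num.sqrt s)^-1 * g x) ^+ 2)%:E =
   (1 + s)%:E * \int[mu]_x (f x ^+ 2)%:E +
   (1 + s^-1)%:E * \int[mu]_x (g x ^+ 2)%:E)%E.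
Proof.
move=> s0 mf mg.
have s1 : 0 <= 1 + s by rewrite addr_ge0// ltW.
have s2 : 0 <= 1 + s^-1 by rewrite addr_ge0// invr_ge0 ltW.
rewrite -!ge0_integralZ//; do ?[by meas|by move=> x; nonneg].
rewrite -!ge0_integralDr; do ?[by meas|by move=> x; nonneg].
apply: eq_integral => x _; congr EFin.
have q0 : 0 < Num.sqrt s by rewrite sqrtr_gt0.
rewrite -[in RHS](sqr_sqrtr (ltW s0)); move: (Num.sqrt s) q0 => q q0.
by field; rewrite gt_eqF.
Qed.

Lemma form_cauchyP {dd} {T : measurableType dd} {R : realType} (E : qform T R) (u_ : nat -> T -> R) :
  form_cauchy E u_ <-> forall e, 0 < e -> exists N : nat, forall n m,
    (N <= n)%N -> (N <= m)%N -> `|qval E (u_ n \- u_ m)| < e.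
Proof.
split.
  move=> /cvgrPdist_lt H e /H[[A B]/= [[NA _ hA] [NB _ hB]] hAB].
  exists (maxn NA NB) => n m; rewrite !geq_max => /andP[n1 n2] /andP[m1 m2].
  have := hAB (n, m); rewrite sub0r normrN; apply; split; [exact: hA|exact: hB].
move=> H; apply/cvgrPdist_lt => e /H[N HN].
exists ([set n | (N <= n)%N], [set n | (N <= n)%N]) => /=.
  by split; exists N.
by move=> [n m] /= [n1 m1]; rewrite sub0r normrN; exact: HN.
Qed.

(** * Coercivity and closedness of the Schroedinger form *)

Section schroedinger_form.
Context {R : realType} {d : nat}.
Variables (alpha delta : R).
Hypotheses (alpha_gt0 : 0 < alpha) (alpha_lt2 : alpha < 2) (alpha_ltd : alpha < d%:R)
  (delta_ge0 : 0 <= delta) (delta_le : delta <= d%:R - alpha).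
Implicit Types u v : d.-tuple R -> R.
Local Notation L := (leb R d).

Let A : R := 2^-1 * stable_const d alpha.
Let kap : R := kappa d alpha delta.
Let En u := stable_energy alpha u.
Let V u := (\int[L]_x (u x ^+ 2 * eucl_norm x `^ (- alpha))%:E)%E.
Let dom u := qdom (stable_form alpha) u.
(** The formula of the form on its core, read on all of [dom]; the closure will turn out to have its
    domain inside [dom] and the values of [Q]. *)
Let Q u : R := qval (pre_schroedinger alpha (mudelta alpha delta)) u.
Let slack : R := 2 `^ (d%:R - alpha).

Let slack_gt1 : 1 < slack.
Proof.
rewrite /slack -[ltLHS](_ : 1 `^ (d%:R - alpha) = 1); last by rewrite powR1.
by apply: gt0_ltr_powR; rewrite ?nnegrE// ?subr_gt0// ltr1n.
Qed.

Let A_gt0 : 0 < A.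
Proof.
have ha2 : 0 < (alpha + d%:R) / 2 by rewrite divr_gt0// addr_gt0// (lt_trans alpha_gt0).
have g1 : 0 < Gamma ((alpha + d%:R) / 2) by rewrite Gamma_gt0.
have g2 : 0 < Gamma (1 - alpha / 2).
  by rewrite Gamma_gt0// subr_gt0 ltr_pdivrMr// mul1r.
have p0 : 0 < (pi : R) `^ (d%:R / 2) by rewrite powR_gt0// pi_gt0.
by rewrite /A /stable_const !mulr_gt0 ?invr_gt0 ?exprn_gt0 ?mulr_gt0.
Qed.

(** With the roots of the weights, the energy and the Hardy potential are integrals of squares of
    functions linear in [u], so the same quadratic lemmas serve both. *)
Let sw z : R := Num.sqrt (@stable_weight R d alpha z).
Let sr (x : d.-tuple R) : R := Num.sqrt (eucl_norm x `^ (- alpha)).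

Let msw : measurable_fun setT sw.
Proof.
apply: (@measurableT_comp _ _ _ _ _ _ (@Num.sqrt R)).
  by apply: continuous_measurable_fun; exact: sqrt_continuous.
exact: measurable_stable_weight.
Qed.

Let msr : measurable_fun setT sr.
Proof.
apply: (@measurableT_comp _ _ _ _ _ _ (@Num.sqrt R)).
  by apply: continuous_measurable_fun; exact: sqrt_continuous.
by apply: measurable_comp_powR; exact: measurable_eucl_norm.
Qed.

Let EnE u : En u = (\int[L \x L]_z ((sw z * incr u z) ^+ 2)%:E)%E.
Proof.
rewrite /En stable_energyE; apply: eq_integral => z _.
by rewrite exprMn sqr_sqrtr// stable_weight_ge0.
Qed.

Let VE u : V u = (\int[L]_x ((sr x * u x) ^+ 2)%:E)%E.
Proof.
apply: eq_integral => x _.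
by rewrite exprMn sqr_sqrtr ?powR_ge0// mulrC.
Qed.

Let En_ge0 u : (0 <= En u)%E.
Proof. by rewrite EnE; apply: integral_real_ge0 => z; exact: sqr_ge0. Qed.

Let V_ge0 u : (0 <= V u)%E.
Proof. by rewrite VE; apply: integral_real_ge0 => z; exact: sqr_ge0. Qed.

Let domP u : dom u <-> [/\ measurable_fun setT u,
  (\int[L]_x (u x ^+ 2)%:E < +oo)%E & (En u < +oo)%E].
Proof.
split; first by move=> [/L2P[? ?] ?].
by move=> [mu u2 eu]; split => //; apply/L2P.
Qed.

Let mincr u : measurable_fun setT u -> measurable_fun setT (fun z => sw z * incr u z).
Proof. by move=> mu; apply: measurable_funM => //; exact: measurable_incr. Qed.

Let msru u : measurable_fun setT u -> measurable_fun setT (fun x => sr x * u x).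
Proof. by move=> mu; exact: measurable_funM. Qed.

Let dom_comb a b u v : dom u -> dom v -> dom (fun x => a * u x + b * v x).
Proof.
move=> /domP[mu u2 eu] /domP[mv v2 ev].
have mau : measurable_fun setT (fun x => a * u x) by meas.
have mbv : measurable_fun setT (fun x => b * v x) by meas.
apply/domP; split.
- by meas.
- apply: (le_lt_trans (integral_sqrD_le L _ _ mau mbv)).
  by rewrite !integral_sqrZ// !muleA -!EFinM lte_add_pinfty// lte_mul_pinfty// lee_fin;
    rewrite mulr_ge0 ?sqr_ge0.
- have m1 : measurable_fun setT (fun z => a * (sw z * incr u z)).
    by apply: measurable_funM => //; exact: mincr.
  have m2 : measurable_fun setT (fun z => b * (sw z * incr v z)).
    by apply: measurable_funM => //; exact: mincr.
  have h := integral_sqrD_le (L \x L)%E _ _ m1 m2.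
  rewrite (integral_sqrZ (L \x L)%E _ _ (mincr _ mu)) in h.
  rewrite (integral_sqrZ (L \x L)%E _ _ (mincr _ mv)) in h.
  rewrite -!EnE !muleA -!EFinM in h.
  apply: (@le_lt_trans _ _ ((2 * a ^+ 2)%:E * En u + (2 * b ^+ 2)%:E * En v)%E).
    apply: le_trans h; rewrite EnE le_eqVlt; apply/orP; left; apply/eqP.
    by apply: eq_integral => z _; congr (_ ^+ 2)%:E; rewrite /incr; ring.
  by rewrite lte_add_pinfty// lte_mul_pinfty// lee_fin mulr_ge0 ?sqr_ge0.
Qed.

Let domB u v : dom u -> dom v -> dom (u \- v).
Proof.
move=> du dv; have := dom_comb 1 (-1) _ _ du dv.
by congr dom; apply/funext => x /=; ring.
Qed.

Let hardyE dl u : 0 < dl -> dl < d%:R - alpha -> dom u ->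
  ((slack * kappa d alpha dl)%:E * V u <= A%:E * En u)%E.
Proof. by move=> d1 d2 /domP[mu u2 eu]; exact: hardy_kappa. Qed.

(** An interior parameter, where [kappa] is positive; [K] is thus positive even if [delta] is an
    endpoint. *)
Let critical : R := (d%:R - alpha) / 2.

Let K : R := slack * kappa d alpha critical.

Let critical_in : 0 < critical < d%:R - alpha.
Proof.
have h : 0 < d%:R - alpha by rewrite subr_gt0.
by rewrite /critical; move: (d%:R - alpha) h => x h; apply/andP; split; lra.
Qed.

Let kappa_gt0 dl : 0 < dl -> dl < d%:R - alpha -> 0 < kappa d alpha dl.
Proof.
move=> d1 d2.
have h1 : 0 < (d%:R - dl - alpha) / 2 by rewrite divr_gt0// addrAC subr_gt0.
have h2 : 0 < (d%:R - dl) / 2.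
  by rewrite divr_gt0// subr_gt0 (lt_trans d2)// gtrBl.
have h3 : 0 < (dl + alpha) / 2 by rewrite divr_gt0// addr_gt0.
have h4 : 0 < dl / 2 by rewrite divr_gt0.
rewrite /kappa /rGamma (gt_eqF h1) (gt_eqF h4).
by rewrite !mulr_gt0 ?invr_gt0 ?Gamma_gt0// powR_gt0.
Qed.

Let K_gt0 : 0 < K.
Proof.
have /andP[c1 c2] := critical_in.
by rewrite /K mulr_gt0 ?kappa_gt0// (lt_trans _ slack_gt1).
Qed.

Let e u : R := fine (En u).
Let v_ u : R := fine (V u).

Let En_fin u : dom u -> En u = (e u)%:E.
Proof. by move=> /domP[_ _ eu]; rewrite /e fineK// ge0_fin_numE. Qed.

(** Hardy's inequality with the positive constant [K] bounds [V] by the finite energy; from here on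
    the form is handled by real arithmetic. *)
Let V_fin u : dom u -> V u = (v_ u)%:E.
Proof.
move=> du; rewrite /v_ fineK// ge0_fin_numE//.
have /andP[c1 c2] := critical_in.
have := hardyE _ _ c1 c2 du; rewrite -/K (En_fin _ du) -EFinM.
by case: (V u) (V_ge0 u) => [r| |]//= _; rewrite ?ltry// gt0_muley ?lte_fin.
Qed.

Let e_ge0 u : 0 <= e u. Proof. exact: fine_ge0. Qed.
Let v_ge0 u : 0 <= v_ u. Proof. exact: fine_ge0. Qed.

Let hardyR dl u : 0 < dl -> dl < d%:R - alpha -> dom u ->
  slack * kappa d alpha dl * v_ u <= A * e u.
Proof.
move=> d1 d2 du; have := hardyE _ _ d1 d2 du.
by rewrite (En_fin _ du) (V_fin _ du) -!EFinM lee_fin.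
Qed.

(* At the endpoints [kappa] vanishes, because [1 / Gamma 0 = 0]. *)
Let hardy_delta u : dom u -> slack * kap * v_ u <= A * e u.
Proof.
move=> du; have Ae : 0 <= A * e u by rewrite mulr_ge0// ltW.
have k0 : kap = 0 -> slack * kap * v_ u <= A * e u by move=> ->; rewrite mulr0 mul0r.
have [d0|d0] := ltP 0 delta; last first.
  apply: k0; rewrite /kap /kappa /rGamma.
  by rewrite (_ : delta / 2 == 0) ?mulr0 ?mul0r// mulf_eq0 eq_le d0 delta_ge0.
have [d1|d1] := ltP delta (d%:R - alpha); first exact: hardyR.
apply: k0; rewrite /kap /kappa {2}/rGamma.
by rewrite (_ : (d%:R - delta - alpha) / 2 == 0) ?mulr0// mulf_eq0; apply/orP; left; rewrite addrAC subr_eq0 eq_le d1 delta_le.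
Qed.

Let QE u : dom u -> Q u = A * e u - kap * v_ u.
Proof.
move=> du; rewrite /Q /= /Rintegral integral_mudelta; last by have /domP[] := du.
by rewrite -/(V u) (V_fin _ du).
Qed.

(** Hardy's inequality at [delta] bounds the potential term by [slack^-1] times the energy term;
    [theta] is the share that remains. *)
Let theta : R := 1 - slack^-1.

Let theta_gt0 : 0 < theta.
Proof. by rewrite /theta subr_gt0 invf_lt1// (lt_trans _ slack_gt1). Qed.

Let Q_ge u : dom u -> theta * (A * e u) <= Q u.
Proof.
move=> du; rewrite QE// /theta mulrBl mul1r lerD2l lerN2.
rewrite ler_pdivlMl ?(lt_trans _ slack_gt1)// mulrA; exact: hardy_delta.
Qed.

Let Q_le u : dom u -> Q u <= A * e u.
Proof. by move=> du; rewrite QE// gerBl mulr_ge0 ?kappa_ge0. Qed.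

Let Q_ge0 u : dom u -> 0 <= Q u.
Proof.
move=> du; apply: le_trans (Q_ge _ du).
by apply: mulr_ge0; [exact: ltW|apply: mulr_ge0; [exact: ltW|exact: e_ge0]].
Qed.

Let Q_hardy u : dom u -> theta * K * v_ u <= Q u.
Proof.
move=> du; have /andP[c1 c2] := critical_in.
by apply: le_trans (Q_ge _ du); rewrite -mulrA ler_wpM2l ?(ltW theta_gt0)// hardyR.
Qed.

Let Q_parallelogram u v s : 0 < s -> dom u -> dom v ->
  Q (fun x => u x + v x) +
  Q (fun x => Num.sqrt s * u x - (Num.sqrt s)^-1 * v x) =
  (1 + s) * Q u + (1 + s^-1) * Q v.
Proof.
move=> s0 du dv.
have dp : dom (fun x => u x + v x).
  have := dom_comb 1 1 _ _ du dv.
  by congr dom; apply/funext => x /=; ring.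
have dm : dom (fun x => Num.sqrt s * u x - (Num.sqrt s)^-1 * v x).
  have := dom_comb (Num.sqrt s) (- (Num.sqrt s)^-1) _ _ du dv.
  by congr dom; apply/funext => x /=; ring.
have /domP[mu _ _] := du; have /domP[mv _ _] := dv.
have He : e (fun x => u x + v x) +
    e (fun x => Num.sqrt s * u x - (Num.sqrt s)^-1 * v x) =
    (1 + s) * e u + (1 + s^-1) * e v.
  apply: EFin_inj; rewrite !EFinD !EFinM -!En_fin// !EnE.
  rewrite -(parallelogram_weighted (L \x L)%E _ _ _ s0 (mincr _ mu) (mincr _ mv)).
  by congr (_ + _)%E; apply: eq_integral => z _; congr (_ ^+ 2)%:E; rewrite /incr; ring.
have Hv : v_ (fun x => u x + v x) +
    v_ (fun x => Num.sqrt s * u x - (Num.sqrt s)^-1 * v x) =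
    (1 + s) * v_ u + (1 + s^-1) * v_ v.
  apply: EFin_inj; rewrite !EFinD !EFinM -!V_fin// !VE.
  rewrite -(parallelogram_weighted L _ _ _ s0 (msru _ mu) (msru _ mv)).
  by congr (_ + _)%E; apply: eq_integral => z _; congr (_ ^+ 2)%:E; ring.
rewrite !QE//.
transitivity (A * (e (fun x => u x + v x) +
    e (fun x => Num.sqrt s * u x - (Num.sqrt s)^-1 * v x)) -
    kap * (v_ (fun x => u x + v x) +
    v_ (fun x => Num.sqrt s * u x - (Num.sqrt s)^-1 * v x))); first by ring.
by rewrite He Hv; ring.
Qed.

Let Q_add_le u v s : 0 < s -> dom u -> dom v ->
  Q (fun x => u x + v x) <= (1 + s) * Q u + (1 + s^-1) * Q v.
Proof.
move=> s0 du dv; rewrite -Q_parallelogram// lerDl Q_ge0//.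
have := dom_comb (Num.sqrt s) (- (Num.sqrt s)^-1) _ _ du dv.
by congr dom; apply/funext => x /=; ring.
Qed.

Let sqrtQ_le u v : dom u -> dom v ->
  Num.sqrt (Q u) <= Num.sqrt (Q v) + Num.sqrt (Q (u \- v)).
Proof.
move=> du dv; have duv := domB _ _ du dv.
apply: sqrt_le_add => [||s s0]; [exact: Q_ge0|exact: Q_ge0|].
have := Q_add_le _ _ _ s0 dv duv.
by congr (Q _ <= _); apply/funext => x /=; ring.
Qed.

Let QBC u v : dom u -> dom v -> Q (u \- v) = Q (v \- u).
Proof.
move=> du dv; rewrite !QE; do ?exact: domB.
congr (_ * fine _ - _ * fine _).
  by rewrite !EnE; apply: eq_integral => z _; congr EFin; rewrite /incr/=; ring.
by rewrite !VE; apply: eq_integral => z _; congr EFin; rewrite /=; ring.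
Qed.

Let sqrtQ_dist u v : dom u -> dom v ->
  `|Num.sqrt (Q u) - Num.sqrt (Q v)| <= Num.sqrt (Q (u \- v)).
Proof.
move=> du dv; rewrite ler_norml; apply/andP; split.
  by rewrite lerNl opprB lerBlDl (QBC _ _ du dv); exact: sqrtQ_le.
by rewrite lerBlDl; exact: sqrtQ_le.
Qed.

(** The reason why the closure stays inside [dom]. Fatou's lemma along an almost everywhere
    convergent subsequence bounds the energy of [u_ n - u] by the Cauchy bound; comparability of [Q]
    with the energy then gives convergence of [sqrt Q]. *)
Let closed_approx (u_ : nat -> d.-tuple R -> R) u : (forall n, dom (u_ n)) ->
  (forall eps, 0 < eps -> exists N : nat, forall n m,
    (N <= n)%N -> (N <= m)%N -> `|Q (u_ n \- u_ m)| < eps) ->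
  L2 L u -> L2cvg L u_ u -> dom u /\ Q (u_ n) @[n --> \oo] --> Q u.
Proof.
move=> du cau l2 ul; have /L2P[mu u2] := l2.
have mun n : measurable_fun setT (u_ n) by have /domP[] := du n.
have [phi [phik aephi]] := L2cvg_ae_subseq L _ _ mun mu ul.
have mD n : measurable_fun setT (u_ n \- u) by exact: measurable_funB.
have small (eps : R) : 0 < eps -> exists N : nat, forall n, (N <= n)%N ->
    (En (u_ n \- u)%R <= (eps / A)%:E)%E.
  (* Asking for [Q < theta * eps] makes the energy term [A * e] less than [eps], by coercivity. *)
  move=> e0; have [N HN] := cau _ (mulr_gt0 theta_gt0 e0).
  exists N => n Nn; rewrite EnE.
  have ck : \forall k \near \oo,
      (\int[L \x L]_z ((sw z * incr (u_ n \- u_ (phi k))%R z) ^+ 2)%:E <= (eps / A)%:E)%E.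
    exists N => // k /= Nk.
    have dk : dom (u_ n \- u_ (phi k)) by exact: domB.
    rewrite -EnE En_fin// lee_fin ler_pdivlMr// mulrC.
    rewrite -(ler_pM2l theta_gt0); apply: le_trans (Q_ge _ dk) _.
    apply: ltW; apply: le_lt_trans (ler_norm _) _; apply: HN => //.
    exact: leq_trans (phik k).
  have mDk k : measurable_fun setT (u_ n \- u_ (phi k)) by exact: measurable_funB.
  apply: (fatou_le (L \x L)%E
    (fun k z => ((sw z * incr (u_ n \- u_ (phi k))%R z) ^+ 2)%:E)) ck.
  - move=> k; apply/measurable_EFinP; apply: measurable_funX; apply: mincr.
    exact: (mDk k).
  - by move=> k z; rewrite lee_fin sqr_ge0.
  - apply/measurable_EFinP; apply: measurable_funX; apply: mincr.
    exact: (mD n).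
  - by move=> z; rewrite lee_fin sqr_ge0.
  - apply: filterS (ae_prod L L _ _ aephi aephi) => -[x y] /= [cx cy].
    apply: cvg_EFin; first exact: nearW.
    have c1 : sw (x, y) * (u_ n x - u_ (phi k) x - (u_ n y - u_ (phi k) y)) @[k --> \oo]
        --> sw (x, y) * (u_ n x - u x - (u_ n y - u y)).
      apply: cvgM; first exact: cvg_cst.
      by apply: cvgB; apply: cvgB => //; exact: cvg_cst.
    rewrite expr2; under eq_fun do rewrite expr2.
    exact: (cvgM c1 c1).
have dD n : (En (u_ n \- u)%R < +oo)%E -> dom (u_ n \- u).
  move=> fin; apply/domP; split => //.
  have mN : measurable_fun setT (fun x => (-1) * u x) by meas.
  apply: (@le_lt_trans _ _ (\int[L]_x ((u_ n x + (-1) * u x) ^+ 2)%:E)%E).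
    rewrite le_eqVlt; apply/orP; left; apply/eqP; apply: eq_integral => x _.
    by congr (_ ^+ 2)%:E; rewrite /=; ring.
  apply: (le_lt_trans (integral_sqrD_le L _ _ (mun n) mN)).
  rewrite integral_sqrZ// muleA -EFinM; have /domP[_ un2 _] := du n.
  by rewrite lte_add_pinfty// lte_mul_pinfty// lee_fin mulr_ge0 ?sqr_ge0.
(* [u = u_ N - (u_ N - u)], a difference of two elements of [dom]. *)
have du' : dom u.
  have [N HN] := small 1 ltr01.
  have dN : dom (u_ N \- u).
    by apply: dD; apply: le_lt_trans (HN N (leqnn N)) _; exact: ltry.
  have := domB _ _ (du N) dN.
  by congr dom; apply/funext => x /=; ring.
split=> //.
have sq : Num.sqrt (Q (u_ n)) @[n --> \oo] --> Num.sqrt (Q u).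
  apply/cvgrPdist_le => eps e0.
  have [N HN] := small _ (exprn_gt0 2 e0).
  exists N => // n /= Nn; rewrite distrC.
  apply: le_trans (sqrtQ_dist _ _ (du n) du') _.
  rewrite -[leRHS]ger0_norm ?(ltW e0)// -sqrtr_sqr ler_wsqrtr//.
  have dn := domB _ _ (du n) du'.
  apply: le_trans (Q_le _ dn) _.
  by have := HN n Nn; rewrite En_fin// lee_fin ler_pdivlMr// mulrC.
rewrite -(sqr_sqrtr (Q_ge0 _ du')) expr2.
under eq_fun do rewrite -(sqr_sqrtr (Q_ge0 _ (du _))) expr2.
exact: (cvgM sq sq).
Qed.

(** For sequences of the extended space, which need not converge in L2: by the triangle inequality
    their values [sqrt Q] form a Cauchy sequence of reals. *)
Let Q_cauchy_cvg (u_ : nat -> d.-tuple R -> R) : (forall n, dom (u_ n)) ->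
  (forall eps, 0 < eps -> exists N : nat, forall n m,
    (N <= n)%N -> (N <= m)%N -> `|Q (u_ n \- u_ m)| < eps) ->
  exists a : R, Q (u_ n) @[n --> \oo] --> a.
Proof.
move=> du cau.
have : cauchy ((fun n => Num.sqrt (Q (u_ n))) @ \oo).
  apply: cauchy_exP => eps e0.
  have [N HN] := cau _ (exprn_gt0 2 e0).
  exists (Num.sqrt (Q (u_ N))); exists N => // n /= Nn.
  rewrite /ball_ /=; apply: le_lt_trans (sqrtQ_dist _ _ (du N) (du n)) _.
  rewrite -[ltRHS]ger0_norm ?(ltW e0)// -sqrtr_sqr ltr_sqrt ?exprn_gt0//.
  by apply: le_lt_trans (ler_norm _) _; exact: HN.
move=> /cauchy_cvgP/cvg_ex[a sa]; exists (a * a).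
under eq_fun do rewrite -(sqr_sqrtr (Q_ge0 _ (du _))) expr2.
exact: (cvgM sa sa).
Qed.

(** * The reference function *)

Let gauss (x : d.-tuple R) : R := heat d 1 (sqnorm x).

Let integral_gauss : (\int[L]_x (gauss x)%:E = 1)%E.
Proof.
rewrite -[RHS](integral_heat d 1 [tuple 0 | i < d] ltr01).
apply: eq_integral => x _; rewrite /gauss; congr (heat d 1 _)%:E.
by apply: eq_bigr => i _; rewrite tnth_mktuple sub0r sqrrN.
Qed.

Let gauss_le1 x : gauss x <= 1.
Proof.
rewrite /gauss /heat -[leRHS]mulr1; apply: ler_pM; rewrite ?powR_ge0 ?expR_ge0//.
  have p4 : 1 <= 4 * (pi : R) * 1 by have := @pi_ge2 R; lra.
  rewrite powRN invf_le1 ?powR_gt0//; last exact: lt_le_trans p4.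
  rewrite -[leLHS](_ : 1 `^ (d%:R / 2) = 1); last by rewrite powR1.
  by apply: ge0_ler_powR; rewrite ?nnegrE ?divr_ge0//; exact: le_trans p4.
by rewrite -[leRHS]expR0 ler_expR oppr_le0 !divr_ge0// sqnorm_ge0.
Qed.

Let gauss_gt0 x : 0 < gauss x.
Proof. by rewrite /gauss mulr_gt0 ?expR_gt0// powR_gt0 ?mulr_gt0 ?pi_gt0. Qed.

Let mgauss : measurable_fun setT gauss.
Proof. by rewrite /gauss; meas'. Qed.

(** Cauchy-Schwarz against the Hardy potential requires the integral of [g0^2 |x|^alpha] to be at
    most [theta * K]. The denominator absorbs [|x|^alpha], and [gauss], bounded by 1 and of mass 1,
    provides integrability and normalization. *)
Let g0 (x : d.-tuple R) : R :=
  Num.sqrt (theta * K) * (gauss x / (1 + eucl_norm x `^ alpha)).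

Let thetaK_gt0 : 0 < theta * K. Proof. exact: mulr_gt0. Qed.

Let g0_gt0 x : 0 < g0 x.
Proof.
rewrite /g0 mulr_gt0 ?sqrtr_gt0// divr_gt0//.
by rewrite ltr_wpDr ?powR_ge0.
Qed.

Let g0_le x : g0 x <= Num.sqrt (theta * K) * gauss x.
Proof.
rewrite /g0 ler_wpM2l ?sqrtr_ge0// ler_pdivrMr ?ltr_wpDr ?powR_ge0//.
by rewrite ler_peMr ?(ltW (gauss_gt0 x))// lerDl powR_ge0.
Qed.

Let mg0 : measurable_fun setT g0.
Proof.
apply: measurable_funM; first exact: measurable_cst.
apply: measurable_funM => //; apply: measurable_comp_inv.
apply: measurable_funD; first exact: measurable_cst.
by apply: measurable_comp_powR; exact: measurable_eucl_norm.
Qed.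

Let integral_g0 : (\int[L]_x (g0 x)%:E < +oo)%E.
Proof.
apply: (@le_lt_trans _ _ (\int[L]_x (Num.sqrt (theta * K) * gauss x)%:E)%E).
  apply: le_integral_real => //; first exact: measurable_funM.
  by move=> x; rewrite (ltW (g0_gt0 x)) g0_le.
rewrite ge0_integralZ ?sqrtr_ge0//; last by move=> x; exact: ltW.
by rewrite integral_gauss mule1 ltry.
Qed.

Let reference_g0 : reference L g0.
Proof.
split => //.
- exists (Num.sqrt (theta * K)) => x.
  rewrite ger0_norm ?(ltW (g0_gt0 x))// (le_trans (g0_le x))//.
  by rewrite ler_piMr ?sqrtr_ge0.
- apply/integrableP; split; first exact/measurable_EFinP.
  under eq_integral do rewrite gee0_abs ?lee_fin ?(ltW (g0_gt0 _))//.
  exact: integral_g0.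
- by apply: aeW.
Qed.

(* AM-GM in place of Cauchy-Schwarz: [t] will be close to [1 / sqrt (Q u)]. *)
Let g0_bound u x t : 0 < t -> 0 < sqnorm x ->
  `|u x| * g0 x <=
  2^-1 * (t * (theta * K * (u x ^+ 2 * eucl_norm x `^ (- alpha))) + t^-1 * gauss x).
Proof.
move=> t0 x0.
have r0 : 0 < eucl_norm x `^ alpha by rewrite powR_gt0// sqrtr_gt0.
have G0 := gauss_gt0 x; have G1 := gauss_le1 x.
rewrite /g0 powRN -(real_normK (num_real (u x))).
rewrite -[in leRHS](sqr_sqrtr (ltW thetaK_gt0)).
move: (eucl_norm x `^ alpha) (gauss x) `|u x| (Num.sqrt (theta * K)) r0 G0 G1.
move=> r G w c r0 G0 G1.
have r1 : 0 < 1 + r by rewrite addr_gt0.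
have h1 : 0 <= (t * r)^-1 * (t * c * w - G * r / (1 + r)) ^+ 2.
  by rewrite mulr_ge0 ?sqr_ge0// invr_ge0 ltW// mulr_gt0.
(* From [G <= 1] and [r <= (1 + r)^2]. *)
have h2 : G ^+ 2 * r / (1 + r) ^+ 2 <= G.
  rewrite ler_pdivrMr ?exprn_gt0//.
  have : G * (G * r) <= G * (1 + r) ^+ 2.
    rewrite ler_pM2l//; have : G * r <= 1 * r by rewrite ler_pM2r.
    by nra.
  by rewrite expr2 mulrA.
have h3 : t^-1 * (G ^+ 2 * r / (1 + r) ^+ 2) <= t^-1 * G.
  by rewrite ler_wpM2l// invr_ge0 ltW.
have E : (t * r)^-1 * (t * c * w - G * r / (1 + r)) ^+ 2 =
    t * (c ^+ 2 * (w ^+ 2 / r)) - 2 * (w * (c * (G / (1 + r)))) +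
    t^-1 * (G ^+ 2 * r / (1 + r) ^+ 2).
  by field; rewrite !gt_eqF.
move: h1; rewrite E; lra.
Qed.

Let d_gt0 : (0 < d)%N.
Proof. by rewrite -(ltr_nat R) (lt_trans alpha_gt0). Qed.

Let bound u : dom u -> (\int[L]_x (`|u x| * g0 x)%:E <= (Num.sqrt (Q u))%:E)%E.
Proof.
move=> du; have /domP[mu _ _] := du.
apply/lee_addgt0Pr => eps e0.
(* [eps] keeps [q] positive when [Q u = 0]. With [t = 1 / q], each of the two integrals in the bound
   is at most [q], and their half-sum gives [q]. *)
pose q := Num.sqrt (Q u) + eps.
have q0 : 0 < q by rewrite ltr_wpDl ?sqrtr_ge0.
have mV : measurable_fun setT (fun x : d.-tuple R => u x ^+ 2 * eucl_norm x `^ (- alpha)).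
  apply: measurable_funM; first exact: measurable_funX.
  by apply: measurable_comp_powR; exact: measurable_eucl_norm.
have m1 : measurable_fun setT (fun x => q^-1 * (theta * K * (u x ^+ 2 * eucl_norm x `^ (- alpha)))).
  by do 2 (apply: measurable_funM; first exact: measurable_cst).
have m2 : measurable_fun setT (fun x => q^-1^-1 * gauss x) by exact: measurable_funM.
have V0 (x : d.-tuple R) : 0 <= u x ^+ 2 * eucl_norm x `^ (- alpha) by nonneg.
have qV0 : 0 <= q^-1 by rewrite invr_ge0 ltW.
have qVV0 : 0 <= q^-1^-1 by rewrite invrK ltW.
have tK0 : 0 <= theta * K by exact: ltW.
have G0 x : 0 <= gauss x by exact: ltW.
have h20 : 0 <= 2^-1 :> R by rewrite invr_ge0.
apply: (@le_trans _ _ (\int[L]_x (2^-1 *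
   (q^-1 * (theta * K * (u x ^+ 2 * eucl_norm x `^ (- alpha))) + q^-1^-1 * gauss x))%:E)%E).
  apply: ae_ge0_le_integral => //.
  - by move=> x _; rewrite lee_fin mulr_ge0// ltW.
  - apply/measurable_EFinP; apply: measurable_funM => //.
    exact: measurableT_comp.
  - by move=> x _; rewrite lee_fin; nonneg.
  - apply/measurable_EFinP; apply: measurable_funM; first exact: measurable_cst.
    exact: measurable_funD.
  - apply: filterS (ae_sqnorm_gt0 _ d_gt0) => x x0 _.
    by rewrite lee_fin; apply: g0_bound; rewrite ?invr_gt0.
rewrite ge0_integralZ//; [|exact: measurable_funD|by move=> x; nonneg].
rewrite ge0_integralDr//; [|by move=> x; nonneg|by move=> x; nonneg].
have mtV : measurable_fun setT (fun x => theta * K * (u x ^+ 2 * eucl_norm x `^ (- alpha))).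
  by apply: measurable_funM; first exact: measurable_cst.
rewrite (ge0_integralZ L _ gauss)// (ge0_integralZ L _ _ qV0 mtV); last by move=> x; nonneg.
rewrite ge0_integralZ//.
rewrite integral_gauss -/(V u) (V_fin _ du) mule1 -?(EFinM, EFinD) lee_fin.
have h := Q_hardy _ du; rewrite -/q.
have hq : Q u <= q ^+ 2.
  rewrite -[leLHS](sqr_sqrtr (Q_ge0 _ du)).
  by apply: lerXn2r; rewrite ?nnegrE ?sqrtr_ge0 ?(ltW q0)// /q lerDl ltW.
have : q^-1 * (theta * K * v_ u) <= q.
  by rewrite ler_pdivrMl//; apply: le_trans h _; rewrite -expr2.
by rewrite invrK; lra.
Qed.

(** * Passage to the closure, the extended space and the h-transforms *)

Let E := schroedinger alpha (@mudelta R d alpha delta).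

Let pre_dom u : qdom (pre_schroedinger alpha (@mudelta R d alpha delta)) u -> dom u.
Proof. by case. Qed.

Let closure_cvg (u_ : nat -> d.-tuple R -> R) u : L2 L u ->
  closure_approx L (pre_schroedinger alpha (@mudelta R d alpha delta)) u_ u ->
  dom u /\ Q (u_ n) @[n --> \oo] --> Q u.
Proof.
move=> l2 [pd cau ul]; apply: closed_approx => //.
- by move=> n; exact: pre_dom.
- exact/form_cauchyP.
Qed.

Let closure_dom u : qdom E u -> dom u.
Proof. by move=> [l2 [u_ ca]]; have [] := closure_cvg _ _ l2 ca. Qed.

(** [get] selects a limit along some approximating sequence; along every such sequence [Q] tends to
    [Q u], so the selection is immaterial. *)
Let closure_val u : qdom E u -> qval E u = Q u.
Proof.
move=> [l2 [u_ ca]]; rewrite /E /schroedinger /=.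
set S := (X in get X).
have : S (get S).
  by apply: getPex; exists (Q u); exists u_ => //; have [] := closure_cvg _ _ l2 ca.
move=> [w_ cw wa]; have [_ wQ] := closure_cvg _ _ l2 cw.
exact: (cvg_unique _ wa wQ).
Qed.

Let C0B u v : C0 u -> C0 v -> C0 (u \- v).
Proof.
move=> [cu ku] [cv kv]; split.
  by move=> x; apply: (@continuousB _ _ _ (u \o tuple_of_row) (v \o tuple_of_row)); [exact: cu|exact: cv].
apply: (subclosed_compact (@closed_closure _ _) (compactU ku kv)).
rewrite -closureU; apply: closure_subset => x /=.
have [->|u0 _] := eqVneq (u (tuple_of_row x)) 0; last by left.
by rewrite sub0r oppr_eq0; right.
Qed.

(** The Cauchy condition of the extended space evaluates the closed form at differences; they must
    lie in its domain before the value can be replaced by [Q]. *)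
Let closureB u v : qdom E u -> qdom E v -> qdom E (u \- v).
Proof.
move=> qu qv; have [l2u [u_ [pu cu uu]]] := qu; have [l2v [w_ [pv cv vv]]] := qv.
have du := closure_dom _ qu; have dv := closure_dom _ qv.
have /domP[mu _ _] := du; have /domP[mv _ _] := dv.
have dn n : dom (u_ n) by exact: pre_dom.
have dw n : dom (w_ n) by exact: pre_dom.
split; first by have [] := domB _ _ du dv.
exists (fun n => u_ n \- w_ n); split.
- by move=> n; split; [exact: domB|have [_ ?] := pu n; have [_ ?] := pv n; exact: C0B].
- apply/form_cauchyP => eps e0.
  (* The quadratic bound with [s = 1] doubles each of the two terms. *)
  have e4 : 0 < eps / 4 by rewrite divr_gt0.
  have [N HN] := (form_cauchyP _ _).1 cu _ e4.
  have [M HM] := (form_cauchyP _ _).1 cv _ e4.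
  exists (maxn N M) => n m; rewrite !geq_max => /andP[Nn Mn] /andP[Nm Mm].
  have h1 := HN n m Nn Nm; have h2 := HM m n Mm Mn.
  have d1 := domB _ _ (dn n) (dn m); have d2 := domB _ _ (dw m) (dw n).
  have := Q_add_le _ _ _ ltr01 d1 d2.
  rewrite (_ : (fun x => _) = (u_ n \- w_ n) \- (u_ m \- w_ m)); last first.
    by apply/funext => x /=; ring.
  rewrite -/(Q _) ger0_norm; last by apply: Q_ge0; apply: domB; exact: domB.
  have := le_lt_trans (ler_norm _) h1; have := le_lt_trans (ler_norm _) h2.
  rewrite -/(Q _) -/(Q _) invr1.
  move: (Q (u_ n \- u_ m)) (Q (w_ m \- w_ n)) (Q _) => x y z; lra.
- apply/L2cvgP => eps e0.
  have e4 : 0 < eps / 4 by rewrite divr_gt0.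
  have := (L2cvgP _ _ _).1 uu _ e4; have := (L2cvgP _ _ _).1 vv _ e4.
  apply: filterS2 => n hv hu.
  have /domP[mun _ _] := dn n; have /domP[mwn _ _] := dw n.
  have m1 : measurable_fun setT (fun x => u_ n x - u x) by exact: measurable_funB.
  have m2 : measurable_fun setT (fun x => v x - w_ n x) by exact: measurable_funB.
  apply: (@le_trans _ _ (\int[L]_x (((u_ n x - u x) + (v x - w_ n x)) ^+ 2)%:E)%E).
    rewrite le_eqVlt; apply/orP; left; apply/eqP; apply: eq_integral => x _.
    by congr (_ ^+ 2)%:E; rewrite /=; ring.
  apply: (le_trans (integral_sqrD_le L _ _ m1 m2)).
  have -> : (\int[L]_x ((v x - w_ n x) ^+ 2)%:E = \int[L]_x ((w_ n x - v x) ^+ 2)%:E)%E.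
    by apply: eq_integral => x _; congr EFin; ring.
  apply: (@le_trans _ _ (2%:E * (eps / 4)%:E + 2%:E * (eps / 4)%:E)%E).
    by apply: leeD; apply: lee_wpmul2l.
  rewrite -!EFinM -EFinD lee_fin; lra.
Qed.

(** The extended value is the limit of the form along the sequence selected by [get]. Fatou's lemma
    is applied along this same sequence, which converges to [u] almost everywhere. *)
Lemma subcritical_schroedinger : subcritical L E.
Proof.
exists g0; first exact: reference_g0.
move=> u [mu _ [u_ ua]].
have good w_ : ext_approx L E w_ u -> (forall n, dom (w_ n)) /\
   exists2 a : R, Q (w_ n) @[n --> \oo] --> a & qval E (w_ n) @[n --> \oo] --> a.
  move=> [qw cw _]; have dw n : dom (w_ n) by exact: closure_dom.
  split => //.
  have [a Qa] : exists a : R, Q (w_ n) @[n --> \oo] --> a.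
    apply: Q_cauchy_cvg => // eps e0.
    have [N HN] := (form_cauchyP _ _).1 cw _ e0; exists N => n m Nn Nm.
    by rewrite -closure_val; [exact: HN|exact: closureB].
  exists a => //; move: Qa.
  by rewrite (_ : (fun n => Q (w_ n)) = (fun n => qval E (w_ n)))//; apply/funext => n; rewrite closure_val.
rewrite /ext_val; set S := (X in get X).
have : S (get S).
  by apply: getPex; have [_ [a _ qa]] := good _ ua; exists a; exists u_.
move=> [w_ wa]; have [dw [a Qa qa]] := good _ wa => qS.
have -> : get S = a by exact: (cvg_unique _ qS qa).
apply/lee_addgt0Pr => eps e0.
have a0 : 0 <= a.
  by apply: (cvgr_to_ge Qa); apply: nearW => n; exact: Q_ge0.
have sq : Num.sqrt (Q (w_ n)) @[n --> \oo] --> Num.sqrt a.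
  by apply: (@continuous_cvg _ _ _ _ _ _ (@Num.sqrt R)) => //; exact: sqrt_continuous.
apply: (fatou_le L (fun n x => (`|w_ n x| * g0 x)%:E)).
- move=> n; apply/measurable_EFinP; apply: measurable_funM => //.
  by apply: measurableT_comp => //; have /domP[] := dw n.
- by move=> n x; rewrite lee_fin mulr_ge0// ltW.
- apply: emeasurable_funM; first exact: measurableT_comp.
  exact/measurable_EFinP.
- by move=> x; rewrite mule_ge0// lee_fin ltW.
- have [_ _ ae] := wa; apply: filterS ae => x wx.
  under eq_fun do rewrite EFinM -abse_EFin muleC.
  rewrite muleC; apply: cvgeZl => //.
  by apply: (@continuous_cvg _ _ _ _ _ _ abse) => //; exact: abse_continuous.
- have /cvgrPdist_le/(_ _ e0) := sq; apply: filterS => n h.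
  apply: le_trans (bound _ (dw n)) _; rewrite -EFinD lee_fin.
  by move: h; rewrite ler_norml => /andP[h _]; lra.
Qed.

Lemma transient_h_transform (h : {mfun d.-tuple R >-> \bar R}) :
  {ae L, forall x, (0 < h x < +oo)%E} -> transient (h2dx h) (h_transform E h).
Proof.
move=> ha; pose hf x := fine (h x).
have mhf : measurable_fun setT hf by apply: (@measurableT_comp _ _ _ _ _ _ fine).
pose g x := g0 x / (1 + hf x ^+ 2).
have hp x : 0 < 1 + hf x ^+ 2 by rewrite ltr_wpDr ?sqr_ge0.
have gp x : 0 < g x by rewrite divr_gt0.
have gle x : g x <= g0 x.
  by rewrite ler_pdivrMr// ler_peMr ?(ltW (g0_gt0 x))// lerDl sqr_ge0.
have mg : measurable_fun setT g.
  by apply: measurable_funM => //; apply: measurable_comp_inv; meas.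
have mg0E : measurable_fun setT (EFin \o g) by exact/measurable_EFinP.
have [_ [M gM] ig0 _] := reference_g0.
(* Compares integrals against [h^2 dx] with Lebesgue integrals, both for the integrability of [g]
   and for the final bound; almost everywhere [h] is the positive real [hf]. *)
have hh (w : d.-tuple R -> R) (w' : d.-tuple R -> R) :
    measurable_fun setT w -> measurable_fun setT w' -> (forall x, 0 <= w x) ->
    (forall x, 0 < hf x -> w x * hf x ^+ 2 <= w' x) -> (forall x, 0 <= w' x) ->
    (\int[h2dx h]_x (w x)%:E <= \int[L]_x (w' x)%:E)%E.
  move=> mw mw' w0 ww w0'.
  rewrite /h2dx ge0_integral_density; [|exact/measurable_EFinP|by move=> x; rewrite lee_fin].
  apply: ae_ge0_le_integral => //.
  - by move=> x _; rewrite mule_ge0 ?lee_fin// sq_ge0.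
  - by apply: emeasurable_funM; [exact/measurable_EFinP|exact: measurable_sq].
  - by move=> x _; rewrite lee_fin.
  - exact/measurable_EFinP.
  - apply: filterS ha => x /andP[h0 hoo] _.
    have hE : h x = (hf x)%:E by rewrite /hf fineK// ge0_fin_numE// ltW.
    rewrite hE -!EFinM lee_fin -expr2; apply: ww.
    by rewrite -lte_fin -hE.
exists g.
  split => //.
  - exists M => x; rewrite ger0_norm ?(ltW (gp x))//.
    by apply: le_trans (gM x); rewrite ger0_norm ?(ltW (g0_gt0 x)).
  - apply/integrableP; split => //.
    under eq_integral do rewrite /= ger0_norm ?(ltW (gp _))//.
    apply: le_lt_trans integral_g0; apply: hh => //; do ?by move=> x; exact: ltW.
    move=> x _; rewrite /g mulrAC ler_pdivrMr// ler_wpM2l ?(ltW (g0_gt0 x))//.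
    by rewrite lerDr.
  - exact: aeW.
move=> u [l2u qu]; have /L2P[mu _] := l2u.
have -> : qval (h_transform E h) u = Q (hmul h u) by exact: closure_val.
apply: le_trans (bound _ (closure_dom _ qu)).
apply: hh.
- by apply: measurable_funM => //; exact: measurableT_comp.
- apply: measurable_funM => //; apply: measurableT_comp => //; exact: measurable_funM.
- by move=> x; rewrite mulr_ge0// ltW.
- move=> x h0; rewrite /hmul -/(hf x) normrM (gtr0_norm h0) /g.
  rewrite [leLHS](_ : _ = `|u x| * g0 x * (hf x ^+ 2 / (1 + hf x ^+ 2))); last by ring.
  rewrite [leRHS](_ : _ = `|u x| * g0 x * hf x); last by ring.
  apply: ler_wpM2l; first by rewrite mulr_ge0// ltW.
  rewrite ler_pdivrMr; last by rewrite ltr_wpDr ?sqr_ge0.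
  (* [y^2 <= y (1 + y^2)], as the difference is [y ((y - 1)^2 + y)]. *)
  move: (hf x) h0 => y y0.
  have : 0 <= y * ((y - 1) ^+ 2 + y) by rewrite mulr_ge0 ?addr_ge0 ?sqr_ge0// ltW.
  by move=> pos; rewrite -subr_ge0 (_ : _ - _ = y * ((y - 1) ^+ 2 + y))//; ring.
- by move=> x; rewrite mulr_ge0// ltW.
Qed.

End schroedinger_form.

Theorem mainTheorem9 (R : realType) (d : nat) (alpha delta : R)
    (alpha_gt0 : 0 < alpha) (alpha_lt2 : alpha < 2)
    (d_ge1 : (1 <= d)%N) (alpha_ltd : alpha < d%:R)
    (delta_ge0 : 0 <= delta) (delta_le : delta <= d%:R - alpha)
    (delta_neq : delta <> (d%:R - alpha) / 2) :
  let E := schroedinger alpha (@mudelta R d alpha delta) in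
  subcritical (leb R d) E /\
  forall S, semigroup_of (leb R d) E S ->
  forall h, excessive S h -> transient (h2dx h) (h_transform E h).
Proof.
move=> E; split.
  exact: (@subcritical_schroedinger _ _ _ _ alpha_gt0 alpha_lt2 alpha_ltd delta_ge0 delta_le).
move=> S _ h [hae _].
exact: (@transient_h_transform _ _ _ _ alpha_gt0 alpha_lt2 alpha_ltd delta_ge0 delta_le _ hae).
Qed.
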